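(* Let $f:M\to\mathbb{R}^3$ be a CMC surface ($H=1$, not a round sphere) with Gauss map $N$, and let $\mu\in\mathbb{C}\setminus\{0,1\}$. Let $\hat f=D^S_{\varphi,\mu}(f)=f+\nu\beta^{-1}:\tilde M\to\mathbb{H}$ be the Darboux transform given by a $d^S_\mu$-parallel section $\varphi=e\nu+\psi\beta$, where $d^S_\lambda$ is the associated family of flat connections given by the conformal Gauss map $S$ of $f$. Then $\hat f$ is constrained Willmore with harmonic right normal. Moreover, $\hat f$ is a CMC surface in 3-space (up to translation) if and only if $\hat f$ is, up to translation, a $\mu$-Darboux transform $D^N_{\alpha,\mu}(f)$ of $f$.
   Context: $\mathbb{H}=\mathrm{span}_{\mathbb{R}}\{1,i,j,k\}=\mathbb{R}^4$, $\mathbb{R}^3=\mathrm{Im}\,\mathbb{H}$, $S^2=\{n\in \mathrm{Im}\,\mathbb{H}: n^2=-1\}$, $\mathbb{C}=\mathrm{span}_{\mathbb{R}}\{1,i\}$ acting by right multiplication. $M$ is a Riemann surface with universal cover $\tilde M$; $*\omega(X)=\omega(JX)$; $e=\begin{pmatrix}1\\0\end{pmatrix}$, $\psi=\begin{pmatrix}f\\1\end{pmatrix}$, $L=\psi\mathbb{H}$. A conformal (branched) immersion $h$ into $\mathbb{R}^4$ has left normal $N_h$ and right normal $R_h$, maps into $S^2$, with $*dh=N_h\,dh=-dh\,R_h$; for surfaces in $\mathbb{R}^3$ these coincide with the Gauss map. CMC surfaces are normalized to $H=1$: $dh=-\frac12(dN_h-N_h*dN_h)$. Put $g=f+N$. CMC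 family and $\mu$-Darboux transform: $d^N_\lambda\alpha=d\alpha+\frac12 df(N\alpha(a_\lambda-1)+\alpha b_\lambda)$, $a_\lambda=\frac{\lambda+\lambda^{-1}}2$, $b_\lambda=i\frac{\lambda^{-1}-\lambda}2$; $D^N_{\alpha,\mu}(f)=f+\alpha\beta^{-1}$ with $\alpha\neq0$ a $d^N_\mu$-parallel section on $\tilde M$ and $\beta=\frac12(N\alpha(a_\mu-1)+\alpha b_\mu)$. Constrained Willmore family: $S=F\begin{pmatrix}N&0\\1&-N\end{pmatrix}F^{-1}$ with $F=\begin{pmatrix}1&f\\0&1\end{pmatrix}$ is the conformal Gauss map of $f$, and $d^S_\lambda(e\nu+\psi\beta)=d(e\nu+\psi\beta)+\frac12\psi\,dg(-N\beta(a_\lambda-1)+\beta b_\lambda)$ for $\lambda\in\mathbb{C}\setminus\{0\}$. If $\varphi=e\nu+\psi\beta$ is $d^S_\mu$-parallel then $d\nu=-df\,\beta$, and $D^S_{\varphi,\mu}(f)$ is the Darboux transform of $f$ with line bundle $\varphi\mathbb{H}$ (for a Darboux transform, $d\varphi\in\Omega^1(\tilde L)$ and $\tilde M\times\mathbb{H}^2=\varphi\mathbb{H}\oplus\tilde L$, where $\tilde L$ is the lift of $L$ to $\tilde M$). Constrained Willmore: a conformal immersion $h$ with line bundle $L_h=\begin{pmatrix}h\\1\end{pmatrix}\mathbb{H}$ has a conformal Gauss map $S_h$, the unique quaternionic complex structure on $\mathbb{H}^2$ with $S_hL_h=L_h$, $S_h\begin{pmatrix}h\\1\end{pmatrix}=-\begin{pmatrix}h\\1\end{pmatrix}N_h$,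 $(dS_h)L_h\subset\Omega^1(L_h)$ and $A_h\mathbb{H}^2\subset L_h$, where $A_h=\frac14(S_hdS_h+*dS_h)$. $h$ is constrained Willmore if there is $\eta\in\Omega^1(\mathrm{Hom}(\mathbb{H}^2/L_h,L_h))$ with $d( *A_h+\eta)=0$ and $*\eta=S_h\eta=\eta S_h$ (understood away from branch points). A map $R$ into $S^2$ is harmonic if $d*dR+2|dR|^2R=0$, 2-forms being identified with their quadratic forms.
   Formalization: In the definition of the conformal Gauss map of a surface in 4-space, S_h psi_h = -psi_h N_h is corrected to use the right normal R_h; with the left normal N_h no such S_h exists unless N_h = ±R_h, and for surfaces in 3-space the two agree. *)

(* Defs.v *)
From HB Require Import structures.
From mathcomp Require Import all_boot all_order all_algebra.
From mathcomp Require Import all_classical all_reals all_analysis.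
From mathcomp Require Import ring.

Set Implicit Arguments.
Unset Strict Implicit.
Unset Printing Implicit Defensive.

Import Order.TTheory GRing.Theory Num.Theory.
Import numFieldNormedType.Exports.
Local Open Scope classical_set_scope.
Local Open Scope ring_scope.

(** * Quaternions, as a (noncommutative) [unitRingType] *)

Record quat (R : realType) := Quat { qre : R; qim1 : R; qim2 : R; qim3 : R }.

Section QuaternionRing.
Variable R : realType.
Implicit Types x y z : quat R.

Definition tuple_of_quat x := (qre x, qim1 x, qim2 x, qim3 x).
Definition quat_of_tuple (t : R * R * R * R) :=
  Quat t.1.1.1 t.1.1.2 t.1.2 t.2.
Lemma tuple_of_quatK : cancel tuple_of_quat quat_of_tuple.
Proof. by case. Qed.
HB.instance Definition _ := Choice.copy (quat R) (can_type tuple_of_quatK).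

Definition addq x y :=
  Quat (qre x + qre y) (qim1 x + qim1 y) (qim2 x + qim2 y) (qim3 x + qim3 y).
Definition oppq x := Quat (- qre x) (- qim1 x) (- qim2 x) (- qim3 x).
Definition zeroq : quat R := Quat 0 0 0 0.
Definition oneq : quat R := Quat 1 0 0 0.
Definition mulq x y :=
  let: Quat a b c d := x in
  let: Quat a' b' c' d' := y in
  Quat (a * a' - b * b' - c * c' - d * d')
       (a * b' + b * a' + c * d' - d * c')
       (a * c' - b * d' + c * a' + d * b')
       (a * d' + b * c' - c * b' + d * a').
(** |x|^2 *)
Definition sqnq x := qre x ^+ 2 + qim1 x ^+ 2 + qim2 x ^+ 2 + qim3 x ^+ 2.
Definition invq x :=
  Quat (qre x / sqnq x) (- qim1 x / sqnq x) (- qim2 x / sqnq x)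
       (- qim3 x / sqnq x).

Lemma addqA : associative addq.
Proof. by move=> x y z; rewrite /addq /= !addrA. Qed.
Lemma addqC : commutative addq.
Proof. by move=> x y; congr Quat; rewrite addrC. Qed.
Lemma add0q : left_id zeroq addq.
Proof. by case=> a b c d; rewrite /addq /= !add0r. Qed.
Lemma addNq : left_inverse zeroq oppq addq.
Proof. by case=> a b c d; rewrite /addq /= !addNr. Qed.
HB.instance Definition _ :=
  GRing.isZmodule.Build (quat R) addqA addqC add0q addNq.

Lemma mulqA : associative mulq.
Proof. by case=> a b c d [? ? ? ?] [? ? ? ?]; congr Quat; ring. Qed.
Lemma mul1q : left_id oneq mulq.
Proof. by case=> a b c d; congr Quat; ring. Qed.
Lemma mulq1 : right_id oneq mulq.
Proof. by case=> a b c d; congr Quat; ring. Qed.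
Lemma mulqDl : left_distributive mulq addq.
Proof. by case=> a b c d [? ? ? ?] [? ? ? ?]; congr Quat => /=; ring. Qed.
Lemma mulqDr : right_distributive mulq addq.
Proof. by case=> a b c d [? ? ? ?] [? ? ? ?]; congr Quat => /=; ring. Qed.
Lemma oneq_neq0 : oneq != zeroq.
Proof. by apply/eqP => -[] /eqP; rewrite oner_eq0. Qed.
HB.instance Definition _ :=
  GRing.Zmodule_isNzRing.Build (quat R) mulqA mul1q mulq1 mulqDl mulqDr oneq_neq0.

Lemma sqnq_eq0 x : (sqnq x == 0) = (x == 0).
Proof.
apply/eqP/eqP => [|->]; last by rewrite /sqnq /= expr0n /= !addr0.
case: x => a b c d; rewrite /sqnq /= => /eqP.
rewrite !paddr_eq0 ?addr_ge0 ?sqr_ge0 // !sqrf_eq0.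
by move=> /andP[/andP[/andP[/eqP-> /eqP->] /eqP->] /eqP->].
Qed.
Definition totinvq x := if x != 0 then invq x else x.
Lemma mulVq : {in [pred x | x != 0], left_inverse 1 totinvq *%R}.
Proof.
move=> x; rewrite inE /totinvq => x0; rewrite x0.
have := x0; rewrite -sqnq_eq0; case: x {x0} => a b c d s0.
by congr Quat; rewrite /= /sqnq /=; field.
Qed.
Lemma mulqV : {in [pred x | x != 0], right_inverse 1 totinvq *%R}.
Proof.
move=> x; rewrite inE /totinvq => x0; rewrite x0.
have := x0; rewrite -sqnq_eq0; case: x {x0} => a b c d s0.
by congr Quat; rewrite /= /sqnq /=; field.
Qed.
Lemma quat_unitP x y : y * x = 1 /\ x * y = 1 -> [pred x | x != 0] x.
Proof.
case=> + _; rewrite /=; case: eqP => // ->.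
by rewrite mulr0 => /esym/eqP; rewrite oner_eq0.
Qed.
Lemma invq_out : {in [predC [pred x : quat R | x != 0]], totinvq =1 id}.
Proof. by move=> x; rewrite !inE /totinvq => /negbTE ->. Qed.
HB.instance Definition _ :=
  GRing.NzRing_hasMulInverse.Build (quat R) mulVq mulqV quat_unitP invq_out.

End QuaternionRing.

Section QuaternionNotions.
Variable R : realType.
Implicit Types x y : quat R.

Definition qi : quat R := Quat 0 1 0 0.
Definition imaginary x := qre x = 0.
Definition inS2 x := imaginary x /\ x * x = -1.
(** C = span_R {1, i} inside H *)
Definition complexq x := qim2 x = 0 /\ qim3 x = 0.

Definition a_ (mu : quat R) : quat R := (mu + mu^-1) / 2.
Definition b_ (mu : quat R) : quat R := qi * (mu^-1 - mu) / 2.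

(** H^2 is a right H-module. *)
Definition rscale (v : 'cV[quat R]_2) x : 'cV[quat R]_2 := map_mx ( *%R^~ x) v.
Definition evec : 'cV[quat R]_2 := delta_mx 0 0.
Definition psi x : 'cV[quat R]_2 := \col_i (if i == 0 then x else 1).
Definition line (v : 'cV[quat R]_2) : set 'cV[quat R]_2 := range (rscale v).

End QuaternionNotions.

(** * Calculus in the plane R^2 = C *)

Section Plane.
Variable R : realType.
Local Notation plane := (R * R)%type.

(** multiplication by i *)
Definition Jp (v : plane) : plane := (- v.2, v.1).
Definition e1 : plane := (1, 0).
Definition e2 : plane := (0, 1).

Fixpoint ndiff (n : nat) (D : set plane) (F : plane -> R) : Prop :=
  if n is m.+1 then
    (forall z, D z -> differentiable F z) /\
    (forall v, ndiff m D (fun z => 'D_v F z))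
  else True.
(** C^infinity on D; only used for D open. *)
Definition smoothR D F := forall n, ndiff n D F.

Definition jac (F : plane -> plane) (z v : plane) : plane :=
  ('D_v (fun x => (F x).1) z, 'D_v (fun x => (F x).2) z).
(** The first two conditions are redundant (holomorphic maps are smooth), but
    assuming them avoids any appeal to Goursat's theorem. *)
Definition holomorphicR (D : set plane) (F : plane -> plane) :=
  [/\ smoothR D (fun x => (F x).1), smoothR D (fun x => (F x).2)
    & forall z v, D z -> jac F z (Jp v) = Jp (jac F z v)].

Definition dirq (F : plane -> quat R) (z v : plane) : quat R :=
  Quat ('D_v (fun x => qre (F x)) z) ('D_v (fun x => qim1 (F x)) z)
       ('D_v (fun x => qim2 (F x)) z) ('D_v (fun x => qim3 (F x)) z).
Definition smoothq (D : set plane) (F : plane -> quat R) :=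
  [/\ smoothR D (fun x => qre (F x)), smoothR D (fun x => qim1 (F x)),
      smoothR D (fun x => qim2 (F x)) & smoothR D (fun x => qim3 (F x))].

Definition dirm m n (F : plane -> 'M[quat R]_(m, n)) (z v : plane) :
    'M[quat R]_(m, n) :=
  \matrix_(i, j) dirq (fun x => F x i j) z v.
Definition smoothm m n (D : set plane) (F : plane -> 'M[quat R]_(m, n)) :=
  forall i j, smoothq D (fun x => F x i j).

End Plane.

(** * Riemann surfaces *)

Section RiemannSurfaces.
Variable R : realType.
Local Notation plane := (R * R)%type.

(** [cinv] is only meaningful on the image [cimg] of the chart. *)
Record chart (T : topologicalType) := Chart {
  cdom : set T;
  cmap : T -> plane;
  cinv : plane -> T;
  cdom_open : open cdom;
  cimg_open : open (cmap @` cdom);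
  cmapK : {in cdom, cancel cmap cinv};
  cmap_cont : {in cdom, continuous cmap};
  cinv_cont : {in cmap @` cdom, continuous cinv} }.

Record riemannSurface := RiemannSurface {
  carrier :> topologicalType;
  atlas : set (chart carrier);
  carrier_hausdorff : hausdorff_space carrier;
  carrier_connected : connected [set: carrier];
  atlas_cover : forall p, exists2 c, atlas c & cdom c p;
  atlas_compat : forall c c', atlas c -> atlas c' ->
    holomorphicR (cmap c @` (cdom c `&` cdom c')) (cmap c' \o cinv c) }.

Definition chart_at (X : riemannSurface) (c : chart X) (p : X) :=
  atlas c /\ cdom c p.

Definition holomorphic (X Y : riemannSurface) (h : X -> Y) :=
  continuous h /\
  forall c c', atlas c -> atlas c' ->
    holomorphicR (cmap c @` (cdom c `&` h @^-1` cdom c')) (cmap c' \o h \o cinv c).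

Definition covering_map (X Y : topologicalType) (h : X -> Y) :=
  [/\ continuous h, set_surj setT setT h
    & forall y, exists (U : set Y) (F : set (set X)),
      [/\ open U, U y, h @^-1` U = \bigcup_(V in F) V,
          forall V W, F V -> F W -> V `&` W !=set0 -> V = W
        & forall V, F V -> [/\ open V, set_bij V U h
            & forall W, open W -> W `<=` V -> open (h @` W)]]].

Definition path_connected (X : topologicalType) :=
  forall x y : X, exists2 gamma : R -> X, {within `[0, 1], continuous gamma}
    & gamma 0 = x /\ gamma 1 = y.

Definition simply_connected (X : topologicalType) :=
  path_connected X /\
  forall gamma : R -> X, {within `[0, 1], continuous gamma} ->
    gamma 0 = gamma 1 ->
    exists H : plane -> X,
      [/\ {within `[0, 1] `*` `[0, 1], continuous H},
          forall t, t \in `[0, 1] -> H (0, t) = gamma t /\ H (1, t) = gamma 0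
        & forall s, s \in `[0, 1] -> H (s, 0) = gamma 0 /\ H (s, 1) = gamma 0].

Definition universal_cover (Mt M : riemannSurface) (pi : Mt -> M) :=
  [/\ simply_connected Mt, covering_map pi & holomorphic pi].

End RiemannSurfaces.

(** * Functions and 1-forms on a Riemann surface *)

Section Forms.
Variables (R : realType) (X : riemannSurface R).
Local Notation plane := (R * R)%type.

Definition smooth_on (U : set X) (h : X -> quat R) :=
  forall c, atlas c -> smoothq (cmap c @` (cdom c `&` U)) (h \o cinv c).
Definition smoothm_on m n (U : set X) (S : X -> 'M[quat R]_(m, n)) :=
  forall c, atlas c -> smoothm (cmap c @` (cdom c `&` U)) (S \o cinv c).

(** [w c p v] is the value of the 1-form w at p on the tangent vector whose
    coordinates in the chart c are v; it is relevant only if [chart_at c p]. *)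
Definition preform (V : Type) := chart R X -> X -> plane -> V.

Definition is_form m n (U : set X) (w : preform 'M[quat R]_(m, n)) :=
  [/\ forall c v, atlas c ->
        smoothm (cmap c @` (cdom c `&` U)) (fun z => w c (cinv c z) v),
      forall c p (s : R) v v', chart_at c p -> U p ->
        w c p (s *: v + v') = Quat s 0 0 0 *: w c p v + w c p v'
    & forall c c' p v, chart_at c p -> chart_at c' p -> U p ->
        w c p v = w c' p (jac (cmap c' \o cinv c) (cmap c p) v)].

Definition d_ (h : X -> quat R) : preform (quat R) :=
  fun c p v => dirq (h \o cinv c) (cmap c p) v.
Definition dm_ m n (S : X -> 'M[quat R]_(m, n)) : preform 'M[quat R]_(m, n) :=
  fun c p v => dirm (S \o cinv c) (cmap c p) v.

(** ( *w)(X) = w(JX) *)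
Definition star (V : Type) (w : preform V) : preform V :=
  fun c p v => w c p (Jp v).

(** Coefficient of dx /\ dy in the exterior derivative, where z = x + iy is the
    coordinate of the chart c; that is, (dw)(X, JX) for X = d/dx. *)
Definition ext (w : preform (quat R)) (c : chart R X) (p : X) : quat R :=
  dirq (fun z => w c (cinv c z) (e2 R)) (cmap c p) (e1 R)
  - dirq (fun z => w c (cinv c z) (e1 R)) (cmap c p) (e2 R).
Definition extm m n (w : preform 'M[quat R]_(m, n)) (c : chart R X) (p : X) :
    'M[quat R]_(m, n) :=
  dirm (fun z => w c (cinv c z) (e2 R)) (cmap c p) (e1 R)
  - dirm (fun z => w c (cinv c z) (e1 R)) (cmap c p) (e2 R).

(** h is an immersion at p; the other points are the branch points. *)
Definition regular (h : X -> quat R) : set X :=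
  [set p | forall c v, chart_at c p -> d_ h c p v = 0 -> v = 0].

(** Branched conformal immersion with left normal Nh and right normal Rh. *)
Definition conformal (h Nh Rh : X -> quat R) :=
  [/\ smooth_on setT h, smooth_on setT Nh /\ smooth_on setT Rh,
      forall p, inS2 (Nh p) /\ inS2 (Rh p),
      forall c p v, chart_at c p ->
        star (d_ h) c p v = Nh p * d_ h c p v /\
        star (d_ h) c p v = - (d_ h c p v * Rh p)
    & forall p, \forall q \near p^', regular h q].

(** Surface in R^3 = Im H of constant mean curvature H = 1, with Gauss map N. *)
Definition cmc_surface (h N : X -> quat R) :=
  [/\ conformal h N N, forall p, imaginary (h p)
    & forall c p v, chart_at c p ->
        d_ h c p v = - (2^-1 * (d_ N c p v - N p * star (d_ N) c p v))].

Definition round_sphere (h : X -> quat R) :=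
  exists (m : quat R) (r : R), imaginary m /\ forall p, sqnq (h p - m) = r ^+ 2.

(** d*dRh + 2|dRh|^2 Rh = 0, with 2|dRh|^2 = |Rh_x|^2 + |Rh_y|^2.
    Since [ext (star (d_ Rh))] is minus the Laplacian of Rh, the sign is the one
    for which this is the harmonic map equation into S^2, i.e. for which 2-forms
    w are identified with w(JX, X). *)
Definition harmonicS2 (Rh : X -> quat R) :=
  smooth_on setT Rh /\ forall c p, chart_at c p ->
    - ext (star (d_ Rh)) c p
    + Quat (sqnq (d_ Rh c p (e1 R)) + sqnq (d_ Rh c p (e2 R))) 0 0 0 * Rh p = 0.

(** A = (S dS + *dS) / 4 *)
Definition Aform (S : X -> 'M[quat R]_2) : preform 'M[quat R]_2 :=
  fun c p v => 4^-1 *: (S p *m dm_ S c p v + star (dm_ S) c p v).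

(** The equation S psi = - psi Rh involves the right normal: it is the only
    possibility compatible with (dS)L in L, and gives S L = L. *)
Definition conformal_gauss_map (U : set X) (h Rh : X -> quat R)
    (S : X -> 'M[quat R]_2) :=
  [/\ smoothm_on U S,
      forall p, U p -> S p *m S p = - 1%:M,
      forall p, U p -> S p *m psi (h p) = - rscale (psi (h p)) (Rh p),
      forall c p v, chart_at c p -> U p ->
        line (psi (h p)) (dm_ S c p v *m psi (h p))
    & forall c p v w, chart_at c p -> U p ->
        line (psi (h p)) (Aform S c p v *m w)].

Definition constrained_willmore (h Nh Rh : X -> quat R) :=
  conformal h Nh Rh /\
  exists (S : X -> 'M[quat R]_2) (eta : preform 'M[quat R]_2),
    let U := regular h in
    [/\ conformal_gauss_map U h Rh S,
        is_form U eta,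
        forall c p v, chart_at c p -> U p ->
          eta c p v *m psi (h p) = 0 /\
          (forall w, line (psi (h p)) (eta c p v *m w)),
        forall c p v, chart_at c p -> U p ->
          star eta c p v = S p *m eta c p v /\
          star eta c p v = eta c p v *m S p
      & forall c p, chart_at c p -> U p ->
          extm (fun c p v => star (Aform S) c p v + eta c p v) c p = 0].

(** * The two families of flat connections and their Darboux transforms *)

Definition dN (f N : X -> quat R) (mu : quat R) (alpha : X -> quat R) :
    preform (quat R) :=
  fun c p v => d_ alpha c p v
    + 2^-1 * d_ f c p v * (N p * alpha p * (a_ mu - 1) + alpha p * b_ mu).

Definition dN_parallel f N mu alpha :=
  smooth_on setT alpha /\
  forall c p v, chart_at c p -> dN f N mu alpha c p v = 0.

Definition DN (f N : X -> quat R) (mu : quat R) (alpha : X -> quat R) :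
    X -> quat R :=
  fun p =>
    let beta := 2^-1 * (N p * alpha p * (a_ mu - 1) + alpha p * b_ mu) in
    f p + alpha p * beta^-1.

(** e nu + psi beta *)
Definition section2 (f nu beta : X -> quat R) : X -> 'cV[quat R]_2 :=
  fun p => rscale (evec R) (nu p) + rscale (psi (f p)) (beta p).

(** Since g = f + N, this is the family d^S_mu of the conformal Gauss map
    S = F (N 0; 1 -N) F^-1 of f, with F = (1 f; 0 1), applied to e nu + psi beta. *)
Definition dS (f N : X -> quat R) (mu : quat R) (nu beta : X -> quat R) :
    preform 'cV[quat R]_2 :=
  fun c p v => dm_ (section2 f nu beta) c p v
    + rscale (psi (f p)) (2^-1 * d_ (fun q => f q + N q) c p v
        * (- (N p * beta p * (a_ mu - 1)) + beta p * b_ mu)).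

Definition dS_parallel f N mu nu beta :=
  [/\ smooth_on setT nu, smooth_on setT beta
    & forall c p v, chart_at c p -> dS f N mu nu beta c p v = 0].

(** The line bundle phi H is a Darboux transform of L = psi H. *)
Definition darboux_bundle (f : X -> quat R) (phi : X -> 'cV[quat R]_2) :=
  (forall c p v, chart_at c p -> line (psi (f p)) (dm_ phi c p v)) /\
  (forall p w, exists! ab : quat R * quat R,
     w = rscale (phi p) ab.1 + rscale (psi (f p)) ab.2).

(** Affine coordinate of the line bundle (e nu + psi beta) H. *)
Definition DS (f nu beta : X -> quat R) : X -> quat R :=
  fun p => f p + nu p * (beta p)^-1.

End Forms.

(* Main.v *)
(* Idea. With c = a_mu - 1 and b = b_mu, the equations of phi = e nu + psi beta read
   d nu = - df beta and d beta = dg/2 (N beta c - beta b), g = f + N, so that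
   fh = f + T with T = nu beta^-1. Put r = (N beta c - beta b) beta^-1 and
   E = beta b c^-1 beta^-1. Then d fh = - T dg/2 r, and fh has left normal
   - T N T^-1, right normal Rh = E - 2 r^-1 and Hh = (E - N) T^-1. The form
   q = dRh + Rh *dRh = - 4 r^-1 df beta c beta^-1 r^-1 is closed, which is the harmonicity
   of Rh; moreover dfh wedge q = 0, and for a suitable eta the entries of *A + eta
   are 0, fh q / 4 and q / 4, so that it is closed.
   The branch points of fh are the zeros of dg. In a chart, s = |g_x|^2 satisfies
   s lap s - |grad s|^2 >= - K s^2, so that non isolated zeros would by the maximum
   principle make dg vanish identically, and f would be a round sphere.
   If fh is CMC up to translation, then density of the regular points gives
   Hh = -1, that is T = N - E, and nu itself is d^N_mu-parallel with
   D^N(f) = fh. Conversely a d^N_mu-parallel alpha satisfies the equation of beta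
   for the parallel surface g with normal - N, and the same identities show that
   fh satisfies the CMC equations; d fh is then imaginary, hence Re fh constant. *)
Require Import Defs.
From mathcomp Require Import all_boot all_order all_algebra.
From mathcomp Require Import all_classical all_reals all_analysis.
From mathcomp Require Import ring lra.

Set Implicit Arguments.
Unset Strict Implicit.
Unset Printing Implicit Defensive.

Import Order.TTheory GRing.Theory Num.Theory.
Import numFieldNormedType.Exports.
Local Open Scope classical_set_scope.
Local Open Scope ring_scope.

(** * Calculus in the plane *)

(** The CMC equation enters only as two rules of type: *df = N df and *dg = - N dg, where df and dg
    anticommute with N. The parameter mu enters only through c != 0, bc = cb and c^2 + b^2 = - 2c,
    the last one being a_mu^2 + b_mu^2 = 1. All this is unchanged when dg, df, N are replaced by df,
    dg, - N, which is why one computation of r, E and R serves both the equation of beta and that of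
    alpha. All identities live in a skew field, so they are decided by rewriting words with oriented
    relations; many lemmas therefore express values at J v by values at v. The zeros of dg are the
    umbilics, classically the zeros of the holomorphic Hopf differential. Real-variable estimates
    replace complex analysis here: the Laplacian of ln s is bounded below, and this bound survives
    the division of s^2 by squared distances to finitely many zeros. Isolated branch points are
    needed twice, as a clause of [conformal] and to recover the right normal and H of fh from d fh
    by density. *)

Section NearDifferentiable.
Variables (K : numFieldType) (V W : normedModType K).
Implicit Types (f g : V -> W) (x : V).

(** The zero map is exhibited as the differential. Subtracting two functions with the same germ
    reduces the locality of differentiability to this case. *)
Lemma near0_differentiable f x : (\near x, f x = 0) -> differentiable f x.
Proof.
move=> fx0; apply/diffP.
apply: (@getPex _ (fun df : {linear V -> W} => continuous df /\
  forall y, f y = f (lim (nbhs x)) + df (y - lim (nbhs x))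
                  +o_(y \near x) (y - lim (nbhs x)))).
exists (\0 : {linear V -> W}); split; first exact: cst_continuous.
rewrite lim_id //; apply/funeqP/eqaddoP => e e0; near=> z => /=.
rewrite !fctE (_ : f z = 0) ?(nbhs_singleton fx0); last by near: z.
by rewrite !add0r oppr0 normr0 mulr_ge0 // ltW.
Unshelve. all: by end_near. Qed.

Lemma near_eq_differentiable f g x :
  (\near x, f x = g x) -> differentiable f x -> differentiable g x.
Proof.
move=> fg df; rewrite (_ : g = f + (g - f)); last by rewrite addrC subrK.
apply: differentiableD => //; apply: near0_differentiable.
by apply: filterS fg => y /= e; rewrite !fctE e subrr.
Qed.

End NearDifferentiable.

Section PlaneCalculus.
Variable R : realType.
Local Notation plane := (R * R)%type.
Implicit Types (D E : set plane) (F G : plane -> R) (z v w : plane) (n : nat).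

Lemma near_open D F G z : open D -> D z ->
  (forall y, D y -> F y = G y) -> \near z, F z = G z.
Proof. by move=> oD Dz FG; apply: filterS FG _; exact: open_nbhs_nbhs. Qed.

Lemma ndiffS n D F : ndiff n.+1 D F <->
  (forall z, D z -> differentiable F z) /\ (forall v, ndiff n D ('D_v F)).
Proof. by []. Qed.

Lemma ndiff_ext n D F G : open D -> (forall z, D z -> F z = G z) ->
  ndiff n D F -> ndiff n D G.
Proof.
move=> oD; elim: n F G => [//|n IH] F G FG /ndiffS[dF nF]; split=> [z Dz|v].
  exact: near_eq_differentiable (near_open oD Dz FG) (dF z Dz).
apply: IH (nF v) => z Dz; apply: near_eq_derive; exact: near_open FG.
Qed.

Lemma ndiff_sub n D E F : E `<=` D -> ndiff n D F -> ndiff n E F.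
Proof.
move=> ED; elim: n F => [//|n IH] F /ndiffS[dF nF]; split=> [z /ED|v]; first exact: dF.
exact: IH (nF v).
Qed.

Lemma ndiffW n D F : ndiff n.+1 D F -> ndiff n D F.
Proof.
elim: n F => [//|n IH] F /ndiffS[dF nF]; split=> // v; exact: IH (nF v).
Qed.

(** [E] need not be open, because each clause of [ndiff] concerns the germ of F at a point. *)
Lemma ndiff_local n D F :
  (forall z, D z -> exists2 E, E z & ndiff n E F) -> ndiff n D F.
Proof.
elim: n F => [//|n IH] F H; split=> [z Dz|v].
  by have [E Ez [dF _]] := H z Dz; exact: dF.
by apply: IH => z Dz; have [E Ez /ndiffS[_ nF]] := H z Dz; exists E; last exact: nF.
Qed.

Lemma ndiff_cst n D (a : R) : ndiff n D (cst a).
Proof.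
elim: n a => [//|n IH] a; split=> [z _|v]; first exact: differentiable_cst.
rewrite (_ : (fun z => _) = cst 0); first exact: IH.
by apply/funext => z; rewrite derive_cst.
Qed.

Lemma ndiffD n D F G : open D -> ndiff n D F -> ndiff n D G ->
  ndiff n D (fun z => F z + G z).
Proof.
move=> oD; elim: n F G => [//|n IH] F G /ndiffS[dF nF] /ndiffS[dG nG]; split=> [z Dz|v].
  by apply: differentiableD; [exact: dF|exact: dG].
apply: ndiff_ext (IH _ _ (nF v) (nG v)) => // z Dz.
by rewrite deriveD //; apply: diff_derivable; [exact: dF|exact: dG].
Qed.

Lemma ndiffN n D F : open D -> ndiff n D F -> ndiff n D (fun z => - F z).
Proof.
move=> oD; elim: n F => [//|n IH] F /ndiffS[dF nF]; split=> [z Dz|v].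
  by apply: differentiableN; exact: dF.
apply: ndiff_ext (IH _ (nF v)) => // z Dz.
by rewrite deriveN //; apply: diff_derivable; exact: dF.
Qed.

Lemma ndiffB n D F G : open D -> ndiff n D F -> ndiff n D G ->
  ndiff n D (fun z => F z - G z).
Proof. by move=> oD nF nG; apply: ndiffD => //; exact: ndiffN. Qed.

Lemma ndiffM n D F G : open D -> ndiff n D F -> ndiff n D G ->
  ndiff n D (fun z => F z * G z).
Proof.
move=> oD; elim: n F G => [//|n IH] F G nF nG.
have /ndiffS[dF nF'] := nF; have /ndiffS[dG nG'] := nG; split=> [z Dz|v].
  by apply: differentiableM; [exact: dF|exact: dG].
apply: (@ndiff_ext _ _ (fun z => F z * 'D_v G z + G z * 'D_v F z)) => //.
  move=> z Dz; rewrite deriveM //; last 2 first.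
  - by apply: diff_derivable; exact: dF.
  - by apply: diff_derivable; exact: dG.
by apply: ndiffD => //; apply: IH; by [exact: nF'|exact: nG'|exact: ndiffW].
Qed.

Lemma ndiffV n D F : open D -> (forall z, D z -> F z != 0) -> ndiff n D F ->
  ndiff n D (fun z => (F z)^-1).
Proof.
move=> oD F0; elim: n => [//|n IH] nF; have /ndiffS[dF nF'] := nF; split=> [z Dz|v].
  by apply: differentiableV; [exact: dF|exact: F0].
have nV := IH (ndiffW nF).
apply: (@ndiff_ext _ _ (fun z => - ((F z)^-1 * (F z)^-1 * 'D_v F z))) => //.
  move=> z Dz; rewrite deriveV ?F0 //.
    by rewrite /GRing.scale /= mulNr expr2 invfM.
  by apply: diff_derivable; exact: dF.
by apply: ndiffN => //; apply: ndiffM => //; exact: ndiffM.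
Qed.

Lemma planeE v : v = v.1 *: e1 R + v.2 *: e2 R.
Proof.
case: v => a b; apply: injective_projections => /=.
  by rewrite [_ *: _]mulr1 [_ *: _]mulr0 addr0.
by rewrite [_ *: _]mulr0 [_ *: _]mulr1 add0r.
Qed.

Lemma derive_lin F z (a : R) v w : differentiable F z ->
  'D_(a *: v + w) F z = a * 'D_v F z + 'D_w F z.
Proof. by move=> dF; rewrite !deriveE //; exact: linearP. Qed.

Lemma derive_planeE F z v : differentiable F z ->
  'D_v F z = v.1 * 'D_(e1 R) F z + v.2 * 'D_(e2 R) F z.
Proof.
move=> dF; rewrite {1}(planeE v) derive_lin //; congr (_ + _).
by rewrite -[_ *: e2 R]addr0 derive_lin // derive0 addr0.
Qed.

Lemma derive_comp_plane F (Phi : plane -> plane) z v :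
  differentiable (fun x => (Phi x).1) z ->
  differentiable (fun x => (Phi x).2) z -> differentiable F (Phi z) ->
  differentiable (F \o Phi) z /\
  'D_v (F \o Phi) z = 'D_(jac Phi z v) F (Phi z).
Proof.
move=> d1 d2 dF.
have PE : Phi = (fun y => ((Phi y).1, (Phi y).2)).
  by apply/funext => y; case: (Phi y).
have dP : differentiable Phi z by rewrite PE; exact: differentiable_pair.
have dFP : differentiable (F \o Phi) z by exact: differentiable_comp.
have E : 'd Phi z v = jac Phi z v.
  rewrite /jac (deriveE _ d1) (deriveE _ d2) {1}PE.
  exact: (congr1 (fun h => h v) (diff_pair d1 d2)).
have E2 : 'd (F \o Phi) z v = 'd F (Phi z) ('d Phi z v).
  exact: (congr1 (fun h => h v) (diff_comp dP dF)).
split; first exact: dFP.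
by apply: (etrans (deriveE v dFP)); rewrite E2 E; exact: esym (deriveE _ dF).
Qed.

Lemma ndiff_comp n D E F (Phi : plane -> plane) : open D -> open E ->
  (forall z, D z -> E (Phi z)) ->
  ndiff n D (fun x => (Phi x).1) -> ndiff n D (fun x => (Phi x).2) ->
  ndiff n E F -> ndiff n D (F \o Phi).
Proof.
move=> oD oE PDE; elim: n F => [//|n IH] F n1 n2 nF.
have /ndiffS[d1 n1'] := n1; have /ndiffS[d2 n2'] := n2; have /ndiffS[dF nF'] := nF; split=> [z Dz|v].
  have := @derive_comp_plane F Phi z 0 (d1 z Dz) (d2 z Dz) (dF _ (PDE _ Dz)).
  by case.
apply: (@ndiff_ext _ _ (fun z => 'D_v (fun x => (Phi x).1) z
    * ((fun y => 'D_(e1 R) F y) \o Phi) z + 'D_v (fun x => (Phi x).2) z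
    * ((fun y => 'D_(e2 R) F y) \o Phi) z)) => //.
  move=> z Dz /=.
  have [_ ->] := @derive_comp_plane F Phi z v (d1 z Dz) (d2 z Dz)
    (dF _ (PDE _ Dz)).
  by rewrite [RHS]derive_planeE //; exact: dF (PDE _ Dz).
have n1w := ndiffW n1; have n2w := ndiffW n2.
exact: (ndiffD oD (ndiffM oD (n1' v) (IH _ n1w n2w (nF' _)))
                  (ndiffM oD (n2' v) (IH _ n1w n2w (nF' _)))).
Qed.

End PlaneCalculus.

Lemma diff_eps_gen (K : numFieldType) (V W : normedModType K) (F : V -> W)
    (z : V) (e : K) : differentiable F z -> 0 < e ->
  \forall h \near (0 : V), `|F (z + h) - F z - 'd F z h| <= e * `|h|.
Proof.
move=> dF e0; have [_ H] := (diff_locallyP z F).1 dF.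
have /eqaddoP/(_ e e0) : F \o shift z = cst (F z) + 'd F z +o_ 0 id by [].
by apply: filterS => h /=; rewrite !fctE opprD addrA [h + z]addrC.
Qed.

(** * Mean values, symmetry of second derivatives, maxima, a Gronwall inequality *)

Section PlaneAnalysis.
Variable R : realType.
Local Notation plane := (R * R)%type.
Implicit Types (D E : set plane) (F G : plane -> R) (z v w : plane).

Lemma is_derive_line F z v (t : R) : differentiable F (z + t *: v) ->
  is_derive t 1 (fun s : R => F (z + s *: v)) ('D_v F (z + t *: v)).
Proof.
move=> dF.
have E : (fun h : R => h^-1 *: (((fun s : R => F (z + s *: v)) \o shift t)
      (h *: (1 : R^o)) - F (z + t *: v)))
    = (fun h : R => h^-1 *: ((F \o shift (z + t *: v)) (h *: v) - F (z + t *: v))).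
  apply/funext => h /=; congr (_ *: (F _ - _)).
  by rewrite [h *: (1 : R^o)]mulr1 scalerDl addrCA.
split.
  have dv : derivable F (z + t *: v) v by exact: diff_derivable.
  by rewrite /derivable E; exact: dv.
by rewrite /derive E.
Qed.

Lemma MVT_line F z v (h : R) : 0 < h ->
  (forall t : R, 0 <= t <= h -> differentiable F (z + t *: v)) ->
  exists2 t : R, 0 < t < h & F (z + h *: v) - F z = 'D_v F (z + t *: v) * h.
Proof.
move=> h0 dF.
have := @MVT R (fun s : R => F (z + s *: v))
  (fun s : R => 'D_v F (z + s *: v)) 0 h h0.
case.
- move=> t; rewrite in_itv /= => /andP[t0 th]; apply: is_derive_line.
  by apply: dF; rewrite !ltW.
- apply: derivable_within_continuous => t; rewrite in_itv /= => th.
  by case: (is_derive_line (dF t th)).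
- move=> t; rewrite in_itv /= => th; rewrite scale0r addr0 subr0 => e.
  by exists t.
Qed.

Lemma diff_eps F z (e : R) : differentiable F z -> 0 < e ->
  \forall h \near (0 : plane), `|F (z + h) - F z - 'D_h F z| <= e * `|h|.
Proof.
move=> dF e0; apply: filterS (diff_eps_gen dF e0) => h.
by rewrite (deriveE _ dF).
Qed.

Lemma deriveZdir F z (a : R) v : differentiable F z -> 'D_(a *: v) F z = a * 'D_v F z.
Proof. by move=> dF; rewrite -[_ *: v]addr0 derive_lin // derive0 addr0. Qed.

Lemma derive_eps F z v (e : R) : differentiable F z -> 0 < e ->
  \forall t \near (0 : R), `|F (z + t *: v) - F z - t * 'D_v F z| <= e * `|t|.
Proof.
move=> dF e0.
have e1 : 0 < e / (1 + `|v|) by rewrite divr_gt0 // ltr_pwDl.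
have /= cv : (fun t : R => t *: v) @ (0 : R) --> (0 : plane).
  rewrite -[X in _ --> X](scale0r v); apply: cvgZl; exact: cvg_id.
have H : \forall t \near (0 : R), `|F (z + t *: v) - F z - 'D_(t *: v) F z|
    <= e / (1 + `|v|) * `|t *: v| := cv _ (diff_eps dF e1).
apply: filterS H => t.
rewrite deriveZdir // => /le_trans; apply.
have n0 : 0 < 1 + `|v| by rewrite ltr_pwDl.
rewrite normrZ (_ : _ * _ = e * `|t| * (`|v| / (1 + `|v|))); last first.
  by field; rewrite gt_eqF.
apply: ler_piMr; first by rewrite mulr_ge0 // ltW.
by rewrite ler_pdivrMr // mul1r lerDr.
Qed.

Lemma near_line D z v : open D -> D z ->
  exists2 r : R, 0 < r & forall t : R, `|t| <= r -> D (z + t *: v).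
Proof.
move=> oD Dz.
have cv : (fun t : R => z + t *: v) @ (0 : R) --> z.
  rewrite -[X in _ --> X]addr0 -[X in _ + X](scale0r v).
  by apply: cvgD; [exact: cvg_cst|apply: cvgZl; exact: cvg_id].
have /nbhs_ballP[r /= r0 H] := cv _ (open_nbhs_nbhs (conj oD Dz)).
exists (r / 2); first by rewrite divr_gt0.
move=> t tr; apply: (H t); rewrite /ball /= sub0r normrN.
by apply: le_lt_trans tr _; rewrite ltr_pdivrMr // mulr_natr mulr2n ltrDl.
Qed.

Lemma near_plane D z : open D -> D z ->
  exists2 r : R, 0 < r & forall h : plane, `|h| <= r -> D (z + h).
Proof.
move=> oD Dz.
have /nbhs_ballP[r /= r0 H] := open_nbhs_nbhs (conj oD Dz).
exists (r / 2); first by rewrite divr_gt0.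
move=> h hr; apply: (H (z + h)); rewrite -ball_normE /= opprD addNKr normrN.
by apply: le_lt_trans hr _; rewrite ltr_pdivrMr // mulr_natr mulr2n ltrDl.
Qed.

Lemma derive_translate F z v w :
  'D_v (F \o shift w) z = 'D_v F (z + w).
Proof.
rewrite /derive; have -> : (fun h : R => h^-1 *:
    ((F \o shift w \o shift z) (h *: v) - (F \o shift w) z))
  = (fun h : R => h^-1 *: ((F \o shift (z + w)) (h *: v) - F (z + w))) => //.
by apply/funext => h /=; rewrite addrA.
Qed.

(** The second difference over the parallelogram with sides h v and h w. Its symmetry in v and w is
    the source of the symmetry of second derivatives. *)
Definition secdiff F z v w (h : R) :=
  F (z + h *: w + h *: v) - F (z + h *: w) - (F (z + h *: v) - F z).

Lemma secdiff_sym F z v w h : secdiff F z v w h = secdiff F z w v h.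
Proof.
rewrite /secdiff (_ : z + h *: w + h *: v = z + h *: v + h *: w); first by ring.
exact: addrAC.
Qed.

Lemma secdiff_estimate (a b c d f e h : R) : 0 < h ->
  `|a - c - (h * d + f)| <= e * h / 2 -> `|b - c - f| <= e * h / 2 ->
  `|(a - b) * h - h ^+ 2 * d| <= e * h ^+ 2.
Proof.
move=> h0 a1 a2.
rewrite (_ : _ - _ = h * ((a - c - (h * d + f)) - (b - c - f))); last by ring.
rewrite normrM (gtr0_norm h0) (_ : e * h ^+ 2 = h * (e * h / 2 + e * h / 2));
  last by field.
by rewrite ler_pM2l //; apply: le_trans (ler_normB _ _) _; exact: lerD.
Qed.

Lemma secdiff_limit_unique (a b c d e h : R) : 0 < h -> a = b ->
  `|a - h ^+ 2 * c| <= e / 2 * h ^+ 2 -> `|b - h ^+ 2 * d| <= e / 2 * h ^+ 2 ->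
  `|c - d| <= e.
Proof.
move=> h0 <- a1 a2; have h20 : 0 < h ^+ 2 by rewrite exprn_gt0.
rewrite -(ler_pM2l h20) -{1}(gtr0_norm h20) -normrM.
rewrite (_ : _ * (_ - _) = (a - h ^+ 2 * d) - (a - h ^+ 2 * c)); last by ring.
apply: le_trans (ler_normB _ _) _.
by rewrite (_ : h ^+ 2 * e = e / 2 * h ^+ 2 + e / 2 * h ^+ 2); [exact: lerD|field].
Qed.

(** The mean value theorem along v, applied to x |-> F (x + h w) - F x, gives a difference of two
    values of D_v F; each is then expanded to first order at z. *)
Lemma secdiff_lim D F z v w (e : R) : open D -> D z -> ndiff 2 D F -> 0 < e ->
  exists2 d : R, 0 < d & forall h : R, 0 < h < d ->
    `|secdiff F z v w h - h ^+ 2 * 'D_w ('D_v F) z| <= e * h ^+ 2.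
Proof.
move=> oD Dz /ndiffS[dF /(_ v)/ndiffS[dF' _]] e0.
(* Displacements k w + l v with 0 <= k, l <= h have norm at most h M, so the tolerance e / (2 M)
   makes each of the two first-order errors at most e h / 2. *)
pose M := 1 + `|v| + `|w|; have M0 : 0 < M.
  by rewrite /M -addrA ltr_pwDl // addr_ge0.
have e1 : 0 < e / (2 * M) by rewrite divr_gt0 // mulr_gt0.
have [r1 r10 H1] := near_plane oD Dz.
have /nbhs_ballP[r2 /= r20 H2] := diff_eps (dF' z Dz) e1.
exists (Num.min (r1 / M) (r2 / M)); first by rewrite lt_min !divr_gt0.
move=> h /andP[h0]; rewrite lt_min !ltr_pdivlMr // => /andP[/ltW hr1 hr2].
have hM (k l : R) : 0 <= k <= h -> 0 <= l <= h ->
   `|k *: w + l *: v| <= h * M.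
  move=> /andP[k0 kh] /andP[l0 lh]; apply: le_trans (ler_normD _ _) _.
  rewrite !normrZ !ger0_norm //.
  have := ler_wpM2r (normr_ge0 w) kh; have := ler_wpM2r (normr_ge0 v) lh.
  rewrite /M; lra.
have hh : 0 <= h <= h by rewrite ltW /=.
have h00 : 0 <= (0 : R) <= h by rewrite lexx ltW.
have inD (k l : R) : 0 <= k <= h -> 0 <= l <= h -> D (z + (k *: w + l *: v)).
  by move=> hk hl; apply: H1; exact: le_trans (hM _ _ hk hl) hr1.
pose G x := F (x + h *: w) - F x.
have dG (t : R) : 0 <= t <= h -> differentiable G (z + t *: v) /\
    'D_v G (z + t *: v) = 'D_v F (z + t *: v + h *: w) - 'D_v F (z + t *: v).
  move=> th.
  have d1 : differentiable F (z + t *: v).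
    by apply: dF; have := inD _ _ h00 th; rewrite scale0r add0r.
  have d2 : differentiable F (z + t *: v + h *: w).
    by apply: dF; have := inD _ _ hh th; rewrite [_ + t *: v]addrC addrA.
  have d3 : differentiable (F \o shift (h *: w)) (z + t *: v) by exact: differentiable_comp.
  have E : 'D_v (F \o shift (h *: w)) (z + t *: v) = 'D_v F (z + t *: v + h *: w).
    exact: derive_translate.
  split; first exact: differentiableB.
  have -> : G = (F \o shift (h *: w)) - F by [].
  by rewrite deriveB ?E //; exact: diff_derivable.
have [t /andP[t0 tlh]] := MVT_line h0 (fun t th => (dG t th).1).
have th : 0 <= t <= h by rewrite !ltW.
rewrite (dG t th).2 => E.
have -> : secdiff F z v w h = G (z + h *: v) - G z.
  by rewrite /secdiff /G (addrAC z); ring.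
rewrite E.
have em : e / (2 * M) * (h * M) = e * h / 2 by field; rewrite gt_eqF.
have key (k : R) : 0 <= k <= h -> `|'D_v F (z + t *: v + k *: w) - 'D_v F z
    - (k * 'D_w ('D_v F) z + 'D_(t *: v) ('D_v F) z)| <= e * h / 2.
  move=> hk; rewrite -em -derive_lin; last exact: dF'.
  rewrite -(addrA z) (addrC (t *: v)).
  apply: le_trans (ler_wpM2l (ltW e1) (hM _ _ hk th)).
  apply: H2; rewrite -ball_normE /= sub0r normrN; exact: le_lt_trans (hM _ _ hk th) hr2.
have a1 := key _ hh.
have := key _ h00; rewrite scale0r addr0 mul0r add0r => a2.
exact: (secdiff_estimate h0 a1 a2).
Qed.

Lemma schwarz D F z v w : open D -> D z -> ndiff 2 D F ->
  'D_w ('D_v F) z = 'D_v ('D_w F) z.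
Proof.
move=> oD Dz nF; apply/eqP; rewrite -subr_eq0 -normr_le0.
apply/ler_addgt0Pr => e e0; rewrite add0r.
have e0' : 0 < e / 2 by rewrite divr_gt0.
have [d1 d10 H1] := @secdiff_lim D F z v w _ oD Dz nF e0'.
have [d2 d20 H2] := @secdiff_lim D F z w v _ oD Dz nF e0'.
pose h := Num.min d1 d2 / 2.
have m0 : 0 < Num.min d1 d2 by rewrite lt_min d10.
have h0 : 0 < h by rewrite divr_gt0.
have hm : h < Num.min d1 d2 by rewrite ltr_pdivrMr // mulr_natr mulr2n ltrDl.
have [hd1 hd2] : h < d1 /\ h < d2 by move: hm; rewrite lt_min => /andP.
apply: (secdiff_limit_unique h0 (secdiff_sym F z v w h) (H1 h _) (H2 h _)).
  by rewrite h0.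
by rewrite h0.
Qed.

Lemma local_max_derive F z v : (\forall y \near z, differentiable F y) ->
  (\forall y \near z, F y <= F z) -> 'D_v F z = 0.
Proof.
move=> dF mF.
have [D [[oD Dz] DH]] : exists D, open_nbhs z D /\
    D `<=` [set y | differentiable F y /\ F y <= F z].
  have : nbhs z [set y | differentiable F y /\ F y <= F z].
    by apply: filterS2 dF mF => y.
  by rewrite nbhsE => -[D oD DH]; exists D.
have [r r0 H] := near_line v oD Dz.
have Hin (t : R) : t \in `]-r, r[ -> D (z + t *: v).
  by rewrite in_itv /= => /andP[t1 t2]; apply: H; rewrite ler_norml !ltW.
have F0 : is_derive (0 : R) 1 (fun s : R => F (z + s *: v)) 0.
  apply: (@derive1_at_max R _ (- r) r).
  - by rewrite ge0_cp // ltW.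
  - move=> t /Hin/DH[d _]; by case: (is_derive_line d).
  - by rewrite in_itv /= oppr_lt0 r0.
  - by move=> t /Hin/DH[_]; rewrite scale0r addr0.
have dz : differentiable F (z + 0 *: v) by rewrite scale0r addr0; case: (DH _ Dz).
have := is_derive_line dz; rewrite scale0r addr0 => -[_ <-].
by case: F0.
Qed.

(** The first derivative vanishes at z. A positive second derivative would make it positive just
    after z on the line through z, and the mean value theorem would give a value above F z. *)
Lemma local_max_derive2 D F z v : open D -> D z -> ndiff 2 D F ->
  (\forall y \near z, F y <= F z) -> 'D_v ('D_v F) z <= 0.
Proof.
move=> oD Dz /ndiffS[dF /(_ v)/ndiffS[dF' _]] mF; rewrite leNgt; apply/negP => c0.
have F0 : 'D_v F z = 0.
  apply: local_max_derive => //.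
  by apply: filterS (open_nbhs_nbhs (conj oD Dz)) => y /dF.
have c2 : 0 < 'D_v ('D_v F) z / 2 by rewrite divr_gt0.
have /nbhs_ballP[r1 /= r10 H1] := derive_eps v (dF' z Dz) c2.
have [r2 r20 H2] := near_line v oD Dz.
have cv : (fun t : R => z + t *: v) @ (0 : R) --> z.
  rewrite -[X in _ --> X]addr0 -[X in _ + X](scale0r v).
  by apply: cvgD; [exact: cvg_cst|apply: cvgZl; exact: cvg_id].
have /nbhs_ballP[r3 /= r30 H3] := cv _ mF.
pose h := Num.min (r1 / 2) (Num.min r2 (r3 / 2)).
have h0 : 0 < h by rewrite !lt_min r20 !divr_gt0.
have hr1 : h < r1.
  rewrite (@le_lt_trans _ _ (r1 / 2)) ?ge_min ?lexx //.
  by rewrite ltr_pdivrMr // mulr_natr mulr2n ltrDl.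
have hr2 : h <= r2 by rewrite !ge_min lexx orbT.
have hr3 : h < r3.
  rewrite (@le_lt_trans _ _ (r3 / 2)) ?ge_min ?lexx ?orbT //.
  by rewrite ltr_pdivrMr // mulr_natr mulr2n ltrDl.
have [t /andP[t0 th]] : exists2 t : R, 0 < t < h &
    F (z + h *: v) - F z = 'D_v F (z + t *: v) * h.
  apply: MVT_line => // t /andP[t0 th]; apply: dF; apply: H2.
  by rewrite ger0_norm // (le_trans th).
have : F (z + h *: v) <= F z.
  by apply: (H3 h); rewrite /ball /= sub0r normrN gtr0_norm.
rewrite -subr_le0 => + E; rewrite E pmulr_lle0 // leNgt => /negP; apply.
have := H1 t; rewrite /ball /= sub0r normrN gtr0_norm // => /(_ (lt_trans th hr1)).
rewrite F0 subr0 ler_distl => /andP[+ _]; apply: lt_le_trans.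
by rewrite (_ : _ - _ = t * ('D_v ('D_v F) z / 2)); [rewrite mulr_gt0|field].
Qed.

Lemma zero_gradient_const F z (r : R) :
  (forall h : plane, `|h| <= r ->
     differentiable F (z + h) /\ forall v, 'D_v F (z + h) = 0) ->
  forall h : plane, `|h| <= r -> F (z + h) = F z.
Proof.
move=> H h hr; apply/eqP; rewrite -subr_eq0.
have := @MVT_line F z h 1 ltr01; rewrite scale1r => -[].
  move=> t /andP[t0 t1]; apply: (H _ _).1.
  by rewrite normrZ ger0_norm // (le_trans _ hr) // ler_piMl.
move=> t /andP[t0 t1] ->; rewrite (H _ _).2 ?mul0r //.
by rewrite normrZ gtr0_norm // (le_trans _ hr) // ler_piMl // ltW.
Qed.

(** Along a ray, F (z + t h) exp (- K t) starts at 0 and has a nonpositive derivative, while F is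
    nonnegative. *)
Lemma gronwall_ray F z (r K : R) :
  (forall h : plane, `|h| <= r -> differentiable F (z + h) /\ 0 <= F (z + h)) ->
  (forall h k : plane, `|h| <= r -> `|k| <= r ->
     'D_k F (z + h) <= K * F (z + h)) ->
  F z = 0 -> forall h : plane, `|h| <= r -> F (z + h) = 0.
Proof.
move=> dF KF F0 h hr; apply/eqP; rewrite eq_le (dF h hr).2 andbT.
have sr (t : R) : 0 <= t <= 1 -> `|t *: h| <= r.
  move=> /andP[t0 t1].
  by rewrite normrZ ger0_norm // (le_trans _ hr) // ler_piMl.
pose phi (t : R) := F (z + t *: h) * expR (- K * t).
pose dphi (t : R) := ('D_h F (z + t *: h) - K * F (z + t *: h)) * expR (- K * t).
have dp (t : R) : 0 <= t <= 1 -> is_derive t 1 phi (dphi t).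
  move=> /sr th; have i1 := is_derive_line (dF _ th).1.
  have i2 : is_derive t 1 (fun t : R => expR (- K * t)) (- K * expR (- K * t)).
    have : is_derive t 1 (fun t : R => - K * t) (- K).
      by apply: is_derive_eq; rewrite [_ *: _]mulr1.
    by move/(is_derive1_comp (is_derive_expR (- K * t))); rewrite mulrC.
  by apply: (is_derive_eq (is_deriveM i1 i2)); rewrite /dphi /GRing.scale /=; ring.
have [||t] := @MVT R phi dphi 0 1 ltr01.
- by move=> t; rewrite in_itv /= => /andP[t0 t1]; apply: dp; rewrite !ltW.
- apply: derivable_within_continuous => t; rewrite in_itv /= => th.
  by case: (dp t th).
rewrite in_itv /= => /andP[t0 t1].
rewrite /phi scale1r scale0r addr0 F0 mul0r !subr0 mulr1 => E.
have : F (z + h) * expR (- K * 1) <= 0.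
  rewrite E /dphi pmulr_lle0 ?expR_gt0 // subr_le0 KF // sr // !ltW //.
by rewrite pmulr_lle0 // expR_gt0.
Qed.

End PlaneAnalysis.

(** * Zeros of almost log-subharmonic functions *)

Section Laplacian.
Variable R : realType.
Local Notation plane := (R * R)%type.
Implicit Types (D : set plane) (F G q : plane -> R) (z v w a : plane) (n : nat).

Definition nsq z : R := z.1 ^+ 2 + z.2 ^+ 2.

Lemma nsq_ge0 z : 0 <= nsq z.
Proof. by rewrite addr_ge0 // sqr_ge0. Qed.

Lemma nsq_eq0 z : (nsq z == 0) = (z == 0).
Proof.
by rewrite /nsq paddr_eq0 ?sqr_ge0 // !sqrf_eq0; case: z.
Qed.

Lemma nsq_gt0 z : (0 < nsq z) = (z != 0).
Proof. by rewrite lt_neqAle nsq_ge0 andbT eq_sym nsq_eq0. Qed.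

Lemma norm_planeE z : `|z| = Num.max `|z.1| `|z.2|.
Proof. by []. Qed.

Lemma nsq_le z (r : R) : `|z| <= r -> nsq z <= 2 * r ^+ 2.
Proof.
rewrite norm_planeE ge_max => /andP[h1 h2].
have H (x : R) : `|x| <= r -> x ^+ 2 <= r ^+ 2.
  move=> xr; rewrite -real_normK ?num_real // lerXn2r ?nnegrE //.
  exact: le_trans xr.
by rewrite mulr_natl mulr2n lerD // H.
Qed.

Lemma nsq_ge z : `|z| ^+ 2 <= nsq z.
Proof.
rewrite norm_planeE /nsq maxEle; case: ifP => _; rewrite real_normK ?num_real //.
  by rewrite lerDr sqr_ge0.
by rewrite lerDl sqr_ge0.
Qed.

Let fst_cont : continuous (fst : plane -> R).
Proof. by move=> z; exact: cvg_fst. Qed.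

Let snd_cont : continuous (snd : plane -> R).
Proof. by move=> z; exact: cvg_snd. Qed.

Lemma ndiff_fst n D : ndiff n D fst.
Proof.
case: n => // n; split=> [z _|v].
  by apply: linear_differentiable; exact: fst_cont.
rewrite (_ : (fun z => _) = cst v.1); first exact: ndiff_cst.
apply/funext => z; rewrite deriveE.
  exact: (congr1 (fun h => h v) (diff_lin (f := fst) _ fst_cont)).
by apply: linear_differentiable; exact: fst_cont.
Qed.

Lemma ndiff_snd n D : ndiff n D snd.
Proof.
case: n => // n; split=> [z _|v].
  by apply: linear_differentiable; exact: snd_cont.
rewrite (_ : (fun z => _) = cst v.2); first exact: ndiff_cst.
apply/funext => z; rewrite deriveE.
  exact: (congr1 (fun h => h v) (diff_lin (f := snd) _ snd_cont)).
by apply: linear_differentiable; exact: snd_cont.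
Qed.

Lemma differentiable_fst z : differentiable (fst : plane -> R) z.
Proof. by apply: linear_differentiable; exact: fst_cont. Qed.

Lemma differentiable_snd z : differentiable (snd : plane -> R) z.
Proof. by apply: linear_differentiable; exact: snd_cont. Qed.

Lemma derive_fst z v : 'D_v (fst : plane -> R) z = v.1.
Proof.
rewrite deriveE.
  exact: (congr1 (fun h => h v) (diff_lin (f := fst) _ fst_cont)).
by apply: linear_differentiable; exact: fst_cont.
Qed.

Lemma derive_snd z v : 'D_v (snd : plane -> R) z = v.2.
Proof.
rewrite deriveE.
  exact: (congr1 (fun h => h v) (diff_lin (f := snd) _ snd_cont)).
by apply: linear_differentiable; exact: snd_cont.
Qed.

Lemma ndiff_nsq n D a : open D -> ndiff n D (fun z => nsq (z - a)).
Proof.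
move=> oD; rewrite /nsq.
have n1 : ndiff n D (fun z => z.1 - a.1).
  by apply: ndiffB => //; [exact: ndiff_fst | exact: ndiff_cst].
have n2 : ndiff n D (fun z => z.2 - a.2).
  by apply: ndiffB => //; [exact: ndiff_snd | exact: ndiff_cst].
by apply: ndiffD => //; apply: ndiffM.
Qed.

Lemma differentiable_ln q z : differentiable q z -> 0 < q z ->
  differentiable (fun y => ln (q y)) z.
Proof.
move=> dq q0; apply: (differentiable_comp (g := @ln R)) => //.
by apply/derivable1_diffP; case: (is_derive1_ln q0).
Qed.

Lemma derive_ln q z v : differentiable q z -> 0 < q z ->
  'D_v (fun y => ln (q y)) z = (q z)^-1 * 'D_v q z.
Proof.
move=> dq q0; have dl : differentiable (@ln R) (q z).
  by apply/derivable1_diffP; case: (is_derive1_ln q0).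
rewrite (deriveE _ (differentiable_ln dq q0)) (deriveE _ dq).
have -> : 'd (fun y => ln (q y)) z v = 'd (@ln R) (q z) ('d q z v).
  exact: (congr1 (fun h => h v) (diff_comp dq dl)).
rewrite deriv1E; last by case: (is_derive1_ln q0).
rewrite derive1E; have [_ ->] := is_derive1_ln q0.
by rewrite mulrC.
Qed.

Lemma ndiff_ln n D q : open D -> (forall z, D z -> 0 < q z) -> ndiff n D q ->
  ndiff n D (fun z => ln (q z)).
Proof.
move=> oD q0; case: n => // n nq; have /ndiffS[dq nq'] := nq.
split=> [z Dz|v]; first by apply: differentiable_ln; [exact: dq|exact: q0].
apply: (@ndiff_ext _ _ _ (fun z => (q z)^-1 * 'D_v q z)) => //.
  by move=> z Dz; rewrite derive_ln //; [exact: dq|exact: q0].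
apply: (ndiffM oD _ (nq' v)).
by apply: ndiffV => //; [move=> z /q0/gt_eqF ->|exact: ndiffW].
Qed.

Definition lap F z : R := 'D_(e1 R) ('D_(e1 R) F) z + 'D_(e2 R) ('D_(e2 R) F) z.

Lemma derive2D D F G v z : open D -> D z -> ndiff 2 D F -> ndiff 2 D G ->
  'D_v ('D_v (fun y => F y + G y)) z = 'D_v ('D_v F) z + 'D_v ('D_v G) z.
Proof.
move=> oD Dz /ndiffS[dF /(_ v)/ndiffS[dF' _]] /ndiffS[dG /(_ v)/ndiffS[dG' _]].
rewrite -deriveD; last 2 first.
- by apply: diff_derivable; exact: dF'.
- by apply: diff_derivable; exact: dG'.
apply: near_eq_derive; apply: (near_open oD Dz) => y Dy.
by rewrite deriveD //; apply: diff_derivable; [exact: dF|exact: dG].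
Qed.

Lemma derive2Z D F (k : R) v z : open D -> D z -> ndiff 2 D F ->
  'D_v ('D_v (fun y => k * F y)) z = k * 'D_v ('D_v F) z.
Proof.
move=> oD Dz /ndiffS[dF /(_ v)/ndiffS[dF' _]].
have -> : k * 'D_v ('D_v F) z = 'D_v (k \*: 'D_v F) z.
  by rewrite deriveZ //; apply: diff_derivable; exact: dF'.
apply: near_eq_derive; apply: (near_open oD Dz) => y Dy.
by rewrite (deriveZ k (f := F)) //; apply: diff_derivable; exact: dF.
Qed.

Lemma lapD D F G z : open D -> D z -> ndiff 2 D F -> ndiff 2 D G ->
  lap (fun y => F y + G y) z = lap F z + lap G z.
Proof.
move=> oD Dz nF nG; rewrite /lap; move: (e1 R) (e2 R) => v w.
by rewrite (derive2D v oD Dz nF nG) (derive2D w oD Dz nF nG); exact: addrACA.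
Qed.

Lemma lapZ D F (k : R) z : open D -> D z -> ndiff 2 D F ->
  lap (fun y => k * F y) z = k * lap F z.
Proof.
move=> oD Dz nF; rewrite /lap; move: (e1 R) (e2 R) => v w.
by rewrite (derive2Z k v oD Dz nF) (derive2Z k w oD Dz nF) mulrDr.
Qed.

Lemma derive2_ln D q v z : open D -> D z -> ndiff 2 D q ->
  (forall y, D y -> 0 < q y) ->
  'D_v ('D_v (fun y => ln (q y))) z
  = (q z * 'D_v ('D_v q) z - ('D_v q z) ^+ 2) / q z ^+ 2.
Proof.
move=> oD Dz /ndiffS[dq /(_ v)/ndiffS[dq' _]] q0.
have -> : 'D_v ('D_v (fun y => ln (q y))) z = 'D_v (fun y => (q y)^-1 * 'D_v q y) z.
  apply: near_eq_derive; apply: (near_open oD Dz) => y Dy.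
  by rewrite derive_ln //; [exact: dq|exact: q0].
have qz : q z != 0 by rewrite gt_eqF // q0.
have d1 : derivable q z v by apply: diff_derivable; exact: dq.
have d2 : derivable ('D_v q) z v by apply: diff_derivable; exact: dq'.
have dV : derivable (fun y => (q y)^-1) z v by exact: derivableV.
rewrite (deriveM dV d2) (deriveV qz d1) /GRing.scale /=.
by field.
Qed.

Lemma lap_ln D q z : open D -> D z -> ndiff 2 D q ->
  (forall y, D y -> 0 < q y) ->
  lap (fun y => ln (q y)) z
  = (q z * lap q z - (('D_(e1 R) q z) ^+ 2 + ('D_(e2 R) q z) ^+ 2)) / q z ^+ 2.
Proof.
move=> oD Dz nq q0; rewrite /lap; move: (e1 R) (e2 R) => v w.
rewrite (derive2_ln v oD Dz nq q0) (derive2_ln w oD Dz nq q0) -mulrDl.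
by congr (_ / _); rewrite mulrDr opprD addrACA.
Qed.

Lemma derive_nsq a z v :
  'D_v (fun y => nsq (y - a)) z = 2 * ((z.1 - a.1) * v.1 + (z.2 - a.2) * v.2).
Proof.
have f1 : derivable (fst : plane -> R) z v by exact: diff_derivable (differentiable_fst z).
have f2 : derivable (snd : plane -> R) z v by exact: diff_derivable (differentiable_snd z).
have [d1 E1] := is_deriveB (derivableP f1) (is_derive_cst a.1 z v).
have [d2 E2] := is_deriveB (derivableP f2) (is_derive_cst a.2 z v).
rewrite derive_fst subr0 in E1; rewrite derive_snd subr0 in E2.
have -> : (fun y => nsq (y - a)) = (fst - cst a.1) * (fst - cst a.1)
    + (snd - cst a.2) * (snd - cst a.2) by [].
rewrite (deriveD (derivableM d1 d1) (derivableM d2 d2)).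
rewrite (deriveM d1 d1) (deriveM d2 d2) E1 E2 !fctE /GRing.scale /=; ring.
Qed.

Lemma lap_nsq a z : lap (fun y => nsq (y - a)) z = 4.
Proof.
have H v : 'D_v ('D_v (fun y => nsq (y - a))) z = 2 * nsq v.
  have -> : 'D_v (fun y => nsq (y - a))
      = (fun y => 2 * v.1 * y.1 + (2 * v.2 * y.2 + - (2 * (a.1 * v.1 + a.2 * v.2)))).
    by apply/funext => y; rewrite derive_nsq; ring.
  have f1 : derivable (fst : plane -> R) z v.
    exact: diff_derivable (differentiable_fst z).
  have f2 : derivable (snd : plane -> R) z v.
    exact: diff_derivable (differentiable_snd z).
  have i1 := is_deriveZ (2 * v.1) (derivableP f1).
  have i2 := is_deriveZ (2 * v.2) (derivableP f2).
  have i3 := is_derive_cst (- (2 * (a.1 * v.1 + a.2 * v.2))) z v.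
  have [_ ->] := is_deriveD i1 (is_deriveD i2 i3).
  by rewrite derive_fst derive_snd /GRing.scale /= /nsq; ring.
by rewrite /lap !H /nsq /=; ring.
Qed.

End Laplacian.

(** * The barrier function attached to finitely many zeros, and the maximum principle for it *)

Section ZeroAccumulation.
Variable R : realType.
Local Notation plane := (R * R)%type.
Implicit Types (D : set plane) (s : plane -> R) (z a : plane) (zs : seq plane).

Definition prod_nsq zs z : R := \prod_(a <- zs) nsq (z - a).
Definition sum_ln_nsq zs z : R := \sum_(a <- zs) ln (nsq (z - a)).

Lemma prod_nsq_ge0 zs z : 0 <= prod_nsq zs z.
Proof. by apply: prodr_ge0 => a _; exact: nsq_ge0. Qed.

Lemma prod_nsq_gt0 zs z : z \notin zs -> 0 < prod_nsq zs z.
Proof.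
elim: zs => [|a zs IH]; first by rewrite /prod_nsq big_nil.
rewrite inE negb_or => /andP[za /IH p0].
by rewrite /prod_nsq big_cons mulr_gt0 // nsq_gt0 subr_eq0.
Qed.

Lemma prod_nsq0 zs z : z \in zs -> prod_nsq zs z = 0.
Proof.
elim: zs => // a zs IH; rewrite inE /prod_nsq big_cons => /orP[/eqP->|/IH].
  by rewrite subrr /nsq /= expr0n addr0 mul0r.
by rewrite /prod_nsq => ->; rewrite mulr0.
Qed.

Lemma sum_ln_nsqE zs z : z \notin zs -> expR (sum_ln_nsq zs z) = prod_nsq zs z.
Proof.
elim: zs => [|a zs IH]; first by rewrite /sum_ln_nsq /prod_nsq !big_nil expR0.
rewrite inE negb_or => /andP[za /IH p0].
rewrite /sum_ln_nsq /prod_nsq !big_cons expRD -/(sum_ln_nsq zs z) p0.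
by rewrite lnK // posrE nsq_gt0 subr_eq0.
Qed.

(** For q = |z - a|^2 one has q lap q = 4 q = |grad q|^2, so that ln q is harmonic off a. *)
Lemma sum_ln_nsq_harmonic zs D : open D -> (forall z, D z -> z \notin zs) ->
  ndiff 2 D (sum_ln_nsq zs) /\ forall z, D z -> lap (sum_ln_nsq zs) z = 0.
Proof.
move=> oD; elim: zs => [|a zs IH] Dzs.
  have E : sum_ln_nsq [::] = cst 0 by apply/funext => z; rewrite /sum_ln_nsq big_nil.
  rewrite E; split=> [|z _]; first exact: ndiff_cst.
  have C v : 'D_v (cst 0 : plane -> R) = cst 0.
    by apply/funext => y; rewrite derive_cst.
  by rewrite /lap !C !derive_cst addr0.
have E : sum_ln_nsq (a :: zs) = (fun z => ln (nsq (z - a)) + sum_ln_nsq zs z).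
  by apply/funext => z; rewrite /sum_ln_nsq big_cons.
have [n1 l1] : ndiff 2 D (sum_ln_nsq zs) /\ forall z, D z -> lap (sum_ln_nsq zs) z = 0.
  by apply: IH => z /Dzs; rewrite inE negb_or => /andP[].
have q0 z : D z -> 0 < nsq (z - a).
  by move=> /Dzs; rewrite inE negb_or nsq_gt0 subr_eq0 => /andP[].
have n2 : ndiff 2 D (fun z => ln (nsq (z - a))).
  by apply: ndiff_ln => //; exact: ndiff_nsq.
rewrite E; split=> [|z Dz]; first exact: ndiffD.
rewrite (lapD oD Dz n2 n1) (l1 z Dz) addr0.
rewrite (lap_ln oD Dz (ndiff_nsq _ _ oD) q0) lap_nsq !derive_nsq /=.
have := q0 z Dz; rewrite /nsq /= => /lt0r_neq0 h.
by apply/eqP; rewrite mulf_eq0; apply/orP; left; apply/eqP; ring.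
Qed.

(** Its logarithm is 2 ln s minus a harmonic function plus K |z - z0|^2, whose Laplacian 4 K
    outweighs the lower bound - 2 K available for 2 ln s. The square on s allows a division by the
    full squared distance to each zero when only ds = 0 is known there. *)
Definition barrier (K : R) zs s z0 z : R :=
  s z ^+ 2 / prod_nsq zs z * expR (K * nsq (z - z0)).

(** Since ds vanishes at a, s = o(|z - a|) and the quotient tends to 0, which is its value at a by
    the convention 0^-1 = 0. *)
Lemma square_quotient_cvg s a : differentiable s a -> s a = 0 ->
  (forall v, 'D_v s a = 0) -> {for a, continuous (fun z : plane => s z ^+ 2 / nsq (z - a))}.
Proof.
move=> ds sa ds0; rewrite /prop_for /continuous_at subrr.
have -> : nsq (0 : plane) = 0 by rewrite /nsq /= expr0n addr0.
rewrite invr0 mulr0; apply/cvgr0Pnorm_le => e e0.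
pose d := Num.min 1 e; have d0 : 0 < d by rewrite lt_min ltr01.
have := diff_eps ds d0; rewrite (near_shift a) => H.
have {}H : \forall z \near a, `|s z| <= d * `|z - a|.
  apply: filterS H => z /=; rewrite sa ds0 !subr0 sub0r.
  by rewrite [a + _]addrC subrK.
apply: filterS H => z H.
have [->|za] := eqVneq z a.
  by rewrite subrr /nsq /= expr0n addr0 invr0 mulr0 normr0 ltW.
have n0 : 0 < nsq (z - a) by rewrite nsq_gt0 subr_eq0.
rewrite ger0_norm ?divr_ge0 ?sqr_ge0 ?nsq_ge0 // ler_pdivrMr //.
have h1 : s z ^+ 2 <= (d * `|z - a|) ^+ 2.
  by rewrite -(real_normK (num_real (s z))) lerXn2r // nnegrE // mulr_ge0 // ltW.
apply: le_trans h1 _; rewrite exprMn.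
have h2 : d ^+ 2 <= e.
  rewrite expr2; apply: (@le_trans _ _ (1 * e)); last by rewrite mul1r.
  by apply: ler_pM; rewrite ?(ltW d0) // ge_min lexx ?orbT.
by apply: ler_pM; rewrite ?sqr_ge0 // nsq_ge.
Qed.

Lemma zero_min_derive s a v : (\forall z \near a, differentiable s z) ->
  (\forall z \near a, 0 <= s z) -> s a = 0 -> 'D_v s a = 0.
Proof.
move=> ds s0 sa.
have : 'D_v (- s) a = 0.
  apply: local_max_derive; first by apply: filterS ds => z dz; exact: differentiableN.
  by apply: filterS s0 => z sz; rewrite !fctE sa oppr0 oppr_le0.
rewrite deriveN; last by apply: diff_derivable; exact: nbhs_singleton ds.
by move=> /eqP; rewrite oppr_eq0 => /eqP.
Qed.

Lemma prod_nsq_continuous zs z : {for z, continuous (prod_nsq zs)}.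
Proof.
have nd : ndiff 1 setT (prod_nsq zs).
  elim: zs => [|a zs IH].
    have -> : prod_nsq [::] = cst 1 by apply/funext => y; rewrite /prod_nsq big_nil.
    exact: ndiff_cst.
  have -> : prod_nsq (a :: zs) = (fun y => nsq (y - a) * prod_nsq zs y).
    by apply/funext => y; rewrite /prod_nsq big_cons.
  by apply: ndiffM => //; [exact: openT|apply: ndiff_nsq; exact: openT].
have [d _] := (ndiffS 0 setT _).1 nd.
exact: differentiable_continuous (d z I).
Qed.

Lemma nsq_continuous a z : {for z, continuous (fun y : plane => nsq (y - a))}.
Proof.
have [d _] := (ndiffS 0 setT _).1 (ndiff_nsq 1 a (@openT _)).
exact: differentiable_continuous (d z I).
Qed.

Lemma barrier_continuous D K zs s z0 z : open D -> D z -> ndiff 1 D s ->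
  (forall y, D y -> 0 <= s y) -> uniq zs -> (forall a, a \in zs -> s a = 0) ->
  {for z, continuous (barrier K zs s z0)}.
Proof.
move=> oD Dz /ndiffS[ds _] s0 uzs zs0.
have cE : {for z, continuous (fun y : plane => expR (K * nsq (y - z0)))}.
  apply: continuous_comp; last exact: continuous_expR.
  by apply: cvgM; [exact: cvg_cst|exact: nsq_continuous].
have cs : {for z, continuous s} by exact: differentiable_continuous (ds z Dz).
have [zin|zout] := boolP (z \in zs); last first.
  apply: cvgM => //; apply: cvgM; first exact: cvgM.
  by apply: cvgV; [rewrite gt_eqF // prod_nsq_gt0|exact: prod_nsq_continuous].
(* The factor of the zero z itself is split off; as [zs] has no repetition, the remaining product
   does not vanish at z. *)
have E : barrier K zs s z0 = (fun y => (s y ^+ 2 / nsq (y - z)) *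
    (prod_nsq (rem z zs) y)^-1 * expR (K * nsq (y - z0))).
  apply/funext => y; rewrite /barrier; congr (_ * _).
  rewrite -mulrA -invfM; congr (_ / _); rewrite /prod_nsq.
  by rewrite (perm_big _ (perm_to_rem zin)) /= big_cons.
have cE' := open_nbhs_nbhs (conj oD Dz).
rewrite E; apply: cvgM => //; apply: cvgM.
  apply: square_quotient_cvg; [exact: ds|exact: zs0|] => v.
  apply: zero_min_derive; last exact: zs0.
    by apply: filterS cE' => y /ds.
  by apply: filterS cE' => y /s0.
apply: cvgV; last exact: prod_nsq_continuous.
by rewrite gt_eqF // prod_nsq_gt0 // mem_rem_uniq // inE eqxx.
Qed.

(* On the set where the barrier is positive its logarithm is strictly
   subharmonic, hence it has no interior maximum. *)
Lemma barrier_no_local_max D K zs s z0 z : open D -> D z -> 0 < K -> ndiff 2 D s ->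
  (forall y, D y -> 0 <= s y) ->
  (forall y, D y -> - K * s y ^+ 2 <=
     s y * lap s y - (('D_(e1 R) s y) ^+ 2 + ('D_(e2 R) s y) ^+ 2)) ->
  0 < barrier K zs s z0 z ->
  ~ (\forall y \near z, barrier K zs s z0 y <= barrier K zs s z0 z).
Proof.
move=> oD Dz K0 ns s0 sK bz bmax.
have /ndiffS[ds _] := ns.
pose D' := [set y | D y /\ 0 < s y /\ y \notin zs].
have cl y : D y -> 0 < s y -> \forall x \near y, 0 < s x.
  move=> Dy sy; have cs : {for y, continuous s}.
    exact: differentiable_continuous (ds y Dy).
  exact: (cvgr_gt (s y) cs _ sy).
have oD' : open D'.
  rewrite openE => y [Dy [sy yzs]].
  apply: filterS3 (open_nbhs_nbhs (conj oD Dy)) (cl y Dy sy)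
    (cvgr_gt _ (@prod_nsq_continuous zs y) _ (prod_nsq_gt0 yzs)) => x Dx sx px.
  split=> //; split=> //; apply: contraTN px => xzs.
  by rewrite prod_nsq0 // ltxx.
have zzs : z \notin zs.
  by apply: contraTN bz => zzs; rewrite /barrier prod_nsq0 // invr0 mulr0 mul0r ltxx.
have sz : 0 < s z.
  rewrite lt_neqAle s0 // andbT eq_sym; apply: contraTN bz => /eqP sz.
  by rewrite /barrier sz expr0n mul0r mul0r ltxx.
have D'z : D' z by [].
pose w y := 2 * ln (s y) + (-1 * sum_ln_nsq zs y + K * nsq (y - z0)).
have wE y : D' y -> expR (w y) = barrier K zs s z0 y.
  move=> [_ [sy yzs]]; rewrite /w !expRD mulN1r expRN sum_ln_nsqE // mulrA.
  by rewrite mulr_natl mulr2n expRD lnK.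
have ns' : ndiff 2 D' s by apply: ndiff_sub ns => y [].
have q0 y : D' y -> 0 < s y by case=> _ [].
have nl : ndiff 2 D' (fun y => ln (s y)) by exact: ndiff_ln.
have [nS lS] : ndiff 2 D' (sum_ln_nsq zs) /\ forall y, D' y -> lap (sum_ln_nsq zs) y = 0.
  by apply: sum_ln_nsq_harmonic => // y [_ []].
have nN : ndiff 2 D' (fun y => nsq (y - z0)) by exact: ndiff_nsq.
have c2 : ndiff 2 D' (cst 2) by exact: ndiff_cst.
have c1 : ndiff 2 D' (cst (-1)) by exact: ndiff_cst.
have cK : ndiff 2 D' (cst K) by exact: ndiff_cst.
have n1 := ndiffM oD' c2 nl; have n2 := ndiffM oD' c1 nS; have n3 := ndiffM oD' cK nN.
have n4 := ndiffD oD' n2 n3.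
have nw : ndiff 2 D' w := ndiffD oD' n1 n4.
have wmax : \forall y \near z, w y <= w z.
  apply: filterS2 bmax (open_nbhs_nbhs (conj oD' D'z)) => y h D'y.
  by rewrite -ler_expR !wE.
have : lap w z <= 0.
  rewrite -[leRHS]addr0 /lap; apply: lerD.
    exact: local_max_derive2 oD' D'z nw wmax.
  exact: local_max_derive2 oD' D'z nw wmax.
apply/negP; rewrite -ltNge /w.
rewrite (lapD oD' D'z n1 n4) (lapD oD' D'z n2 n3).
rewrite (lapZ 2 oD' D'z nl) (lapZ (-1) oD' D'z nS) (lapZ K oD' D'z nN).
rewrite lap_nsq (lS z D'z) mulr0 add0r (lap_ln oD' D'z ns' q0).
have s2 : 0 < s z ^+ 2 by rewrite exprn_gt0.
have : - K <= (s z * lap s z - (('D_(e1 R) s z) ^+ 2 + ('D_(e2 R) s z) ^+ 2)) / s z ^+ 2.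
  by rewrite ler_pdivlMr // sK.
(* The Laplacian of w is 2 X + 4 K with X >= - K, hence at least 2 K. *)
move: (_ / _) => X; move: K0; lra.
Qed.

End ZeroAccumulation.

Section ClusteringZeros.
Variable R : realType.
Local Notation plane := (R * R)%type.
Implicit Types (D : set plane) (s : plane -> R) (z a : plane) (zs : seq plane).

(** Each further zero is taken strictly closer to z0 than the previous one, which makes them
    distinct. *)
Lemma clustering_zeros s z0 (r : R) m : 0 < r ->
  (forall e : R, 0 < e -> exists a, [/\ a != z0, `|a - z0| < e & s a = 0]) ->
  exists zs, [/\ size zs = m, uniq zs &
    forall a, a \in zs -> s a = 0 /\ `|a - z0| < r].
Proof.
move=> + H; elim: m r => [|m IH] r r0; first by exists [::].
have [a [az ar sa]] := H _ r0.
have a0 : 0 < `|a - z0| by rewrite normr_gt0 subr_eq0.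
have [zs [szs uzs hzs]] := IH _ a0.
exists (a :: zs); split=> /=.
- by rewrite szs.
- by rewrite uzs andbT; apply/negP => /hzs[_]; rewrite ltxx.
- move=> b; rewrite inE => /orP[/eqP->//|/hzs[sb ba]]; split=> //.
  exact: lt_trans ba ar.
Qed.

Lemma square_compact z0 (r : R) : compact [set z : plane | `|z - z0| <= r].
Proof.
have -> : [set z : plane | `|z - z0| <= r] =
    `[z0.1 - r, z0.1 + r] `*` `[z0.2 - r, z0.2 + r].
  apply/seteqP; split=> z /=; rewrite norm_planeE ge_max /= !in_itv /= !ler_distl.
    by move=> /andP[-> ->].
  by move=> [-> ->].
by apply: compact_setX; exact: segment_compact.
Qed.

Lemma prod_nsq_le zs z (c : R) : 0 <= c -> (forall a, a \in zs -> nsq (z - a) <= c) ->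
  prod_nsq zs z <= c ^+ size zs.
Proof.
move=> c0; elim: zs => [|a zs IH] H; first by rewrite /prod_nsq big_nil.
rewrite /prod_nsq big_cons /= exprS; apply: ler_pM.
- exact: nsq_ge0.
- exact: prod_nsq_ge0.
- by apply: H; rewrite mem_head.
- by apply: IH => b bzs; apply: H; rewrite inE bzs orbT.
Qed.

Lemma prod_nsq_ge zs z (c : R) : 0 <= c -> (forall a, a \in zs -> c <= nsq (z - a)) ->
  c ^+ size zs <= prod_nsq zs z.
Proof.
move=> c0; elim: zs => [|a zs IH] H; first by rewrite /prod_nsq big_nil.
rewrite /prod_nsq big_cons /= exprS; apply: ler_pM => //.
- exact: exprn_ge0.
- by apply: H; rewrite mem_head.
- by apply: IH => b bzs; apply: H; rewrite inE bzs orbT.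
Qed.

(** A positive maximum over the closed square cannot lie in the interior, so it is attained where |z
    - z0| = rho. There every zero in [zs] is at distance at least 7 rho / 8, whose square exceeds
    rho^2 / 2. The plane carries the maximum norm, hence |z|^2 <= [nsq z] <= 2 |z|^2 and the 2 in
    the exponential. *)
Lemma barrier_bound D K zs s z0 (rho M : R) : open D -> 0 < K -> ndiff 2 D s ->
  (forall y, D y -> 0 <= s y) ->
  (forall y, D y -> - K * s y ^+ 2 <=
     s y * lap s y - (('D_(e1 R) s y) ^+ 2 + ('D_(e2 R) s y) ^+ 2)) ->
  0 < rho -> (forall z, `|z - z0| <= rho -> D z /\ s z <= M) ->
  uniq zs -> (forall a, a \in zs -> s a = 0 /\ `|a - z0| < rho / 8) ->
  forall z, `|z - z0| <= rho ->
    barrier K zs s z0 z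
    <= M ^+ 2 / (rho ^+ 2 / 2) ^+ size zs * expR (K * (2 * rho ^+ 2)).
Proof.
move=> oD K0 ns s0 sK rho0 HD uzs hzs.
set B := M ^+ 2 / (rho ^+ 2 / 2) ^+ size zs * expR (K * (2 * rho ^+ 2)).
have [Dz0 M0] : D z0 /\ s z0 <= M by apply: HD; rewrite subrr normr0 ltW.
have {}M0 : 0 <= M by apply: le_trans M0; exact: s0.
have B0 : 0 <= B by rewrite /B mulr_ge0 ?expR_ge0 // divr_ge0 ?sqr_ge0 // exprn_ge0 // divr_ge0 ?sqr_ge0.
pose Q := [set z : plane | `|z - z0| <= rho].
have Qz0 : Q z0 by rewrite /Q /= subrr normr0 ltW.
have cQ : {within Q, continuous (barrier K zs s z0)}.
  apply: continuous_in_subspaceT => z; rewrite inE => /HD[Dz _].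
  have zs0 a : a \in zs -> s a = 0 by case/hzs.
  exact: (barrier_continuous oD Dz (ndiffW ns) s0 uzs zs0).
have [z1 Qz1 mz1] := compact_EVT_max (ex_intro _ z0 Qz0) (@square_compact z0 rho) cQ.
suff b1 : barrier K zs s z0 z1 <= B.
  by move=> z Qz; apply: le_trans b1; apply: mz1; rewrite inE.
rewrite inE in Qz1.
have [|bz1] := leP (barrier K zs s z0 z1) 0; first by move=> /le_trans; apply.
have [Dz1 sM] := HD _ Qz1.
have r1 : rho <= `|z1 - z0|.
  rewrite leNgt; apply/negP => zr.
  apply: (barrier_no_local_max oD Dz1 K0 ns s0 sK bz1).
  have cn : {for z1, continuous (fun y : plane => `|y - z0|)}.
    apply: (@continuous_comp _ _ _ (fun y : plane => y - z0)); last exact: norm_continuous.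
    by apply: cvgB; [exact: cvg_id|exact: cvg_cst].
  apply: filterS (cvgr_lt _ cn _ zr) => y yr; apply: mz1.
  by rewrite inE /Q /= ltW.
rewrite /barrier /B; apply: ler_pM.
- by rewrite divr_ge0 ?sqr_ge0 ?prod_nsq_ge0.
- exact: expR_ge0.
- have c0 : 0 < (rho ^+ 2 / 2) ^+ size zs by rewrite exprn_gt0 // divr_gt0 // exprn_gt0.
  have cp : (rho ^+ 2 / 2) ^+ size zs <= prod_nsq zs z1.
    apply: prod_nsq_ge; first by rewrite divr_ge0 ?sqr_ge0.
    move=> a /hzs[_ ar]; apply: le_trans (nsq_ge _).
    have h : rho * 7 / 8 <= `|z1 - a|.
      have : `|z1 - z0| <= `|z1 - a| + `|a - z0|.
        by rewrite -[z1 - z0](subrKA a); exact: ler_normD.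
      by move: r1 ar; lra.
    apply: (@le_trans _ _ ((rho * 7 / 8) ^+ 2)).
      by have := sqr_ge0 rho; rewrite !exprMn !exprVn; lra.
    by rewrite lerXn2r // nnegrE //; move: rho0; lra.
  apply: ler_pM.
  + exact: sqr_ge0.
  + by rewrite invr_ge0 prod_nsq_ge0.
  + by rewrite lerXn2r // nnegrE // s0.
  + by rewrite lef_pV2 // posrE // (lt_le_trans c0).
- by rewrite ler_expR ler_pM2l //; exact: nsq_le.
Qed.

(* Zeros of s accumulating at z0 make s vanish near z0: dividing s^2 by the
   squared distances to m of them, the maximum principle bounds s^2 near z0 by
   a constant times 4^-m. *)
Lemma vanishing_of_clustering_zeros D s z0 (K : R) : open D -> D z0 -> ndiff 2 D s ->
  (forall y, D y -> 0 <= s y) ->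
  (forall y, D y -> - K * s y ^+ 2 <=
     s y * lap s y - (('D_(e1 R) s y) ^+ 2 + ('D_(e2 R) s y) ^+ 2)) ->
  (forall e : R, 0 < e -> exists a, [/\ a != z0, `|a - z0| < e & s a = 0]) ->
  \forall z \near z0, s z = 0.
Proof.
move=> oD Dz0 ns s0 sK acc.
wlog K0 : K sK / 0 < K.
  move=> H; apply: (H (Num.max K 1)); last by rewrite lt_max ltr01 orbT.
  move=> y Dy; apply: le_trans (sK y Dy); rewrite !mulNr lerN2 ler_wpM2r ?sqr_ge0 //.
  by rewrite le_max lexx.
have [rho rho0 hrho] := near_plane oD Dz0.
have {}hrho z : `|z - z0| <= rho -> D z by move=> /hrho; rewrite addrC subrK.
have /ndiffS[ds _] := ns.
pose Q := [set z : plane | `|z - z0| <= rho].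
have Qz0 : Q z0 by rewrite /Q /= subrr normr0 ltW.
have cQ : {within Q, continuous s}.
  apply: continuous_in_subspaceT => z; rewrite inE => /hrho Dz.
  exact: differentiable_continuous (ds z Dz).
have [z1 _ mz1] := compact_EVT_max (ex_intro _ z0 Qz0) (@square_compact z0 rho) cQ.
set M := s z1 in mz1.
have HD z : `|z - z0| <= rho -> D z /\ s z <= M.
  by move=> zr; split; [exact: hrho|apply: mz1; rewrite inE].
have r8 : 0 < rho / 8 by rewrite divr_gt0.
pose C := M ^+ 2 * expR (K * (2 * rho ^+ 2)).
have C0 : 0 <= C by rewrite mulr_ge0 ?sqr_ge0 ?expR_ge0.
have key m z : `|z - z0| < rho / 8 -> s z ^+ 2 * 4 ^+ m <= C.
  move=> zr.
  have [zs [szs uzs hzs]] := clustering_zeros m r8 acc.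
  have zrho : `|z - z0| <= rho by move: zr rho0; lra.
  have [zin|zout] := boolP (z \in zs).
    by have [-> _] := hzs _ zin; rewrite expr0n mul0r.
  have := barrier_bound oD K0 ns s0 sK rho0 HD uzs hzs zrho.
  have p0 : 0 < rho ^+ 2 / 2 by rewrite divr_gt0 // exprn_gt0.
  have e1 : 1 <= expR (K * nsq (z - z0)).
    by rewrite -expR0 ler_expR mulr_ge0 ?nsq_ge0 // ltW.
  have pz := prod_nsq_gt0 zout.
  (* In the small square each zero is within rho / 4 in maximum norm, so each factor is at most
     rho^2 / 8, against rho^2 / 2 on the boundary: every zero gains a factor 4, while C does not
     depend on m. *)
  have pl : prod_nsq zs z <= (rho ^+ 2 / 8) ^+ m.
    rewrite -szs; apply: prod_nsq_le; first by rewrite divr_ge0 ?sqr_ge0.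
    move=> a /hzs[_ ar]; apply: (@le_trans _ _ (2 * (rho / 4) ^+ 2)).
      apply: nsq_le; rewrite -(subrKA z0); apply: le_trans (ler_normD _ _) _.
      by rewrite (distrC z0); move: ar zr; lra.
    by rewrite exprMn exprVn; lra.
  rewrite szs /barrier [leRHS]mulrAC => h.
  have {}h : s z ^+ 2 / prod_nsq zs z <= C / (rho ^+ 2 / 2) ^+ m.
    apply: le_trans h; rewrite -[leLHS]mulr1.
    by apply: ler_wpM2l => //; rewrite divr_ge0 ?sqr_ge0 // ltW.
  rewrite ler_pdivrMr // in h.
  have E : (rho ^+ 2 / 8) ^+ m * 4 ^+ m = (rho ^+ 2 / 2) ^+ m.
    by rewrite -exprMn; congr (_ ^+ _); field.
  have pm : 0 < (rho ^+ 2 / 2) ^+ m by rewrite exprn_gt0.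
  apply: le_trans (ler_wpM2r _ h) _; first by rewrite exprn_ge0.
  rewrite -mulrA; apply: (@le_trans _ _ (C / (rho ^+ 2 / 2) ^+ m * (rho ^+ 2 / 2) ^+ m)).
    apply: ler_wpM2l; first by rewrite divr_ge0 // ltW.
    by rewrite -E ler_wpM2r // exprn_ge0.
  by rewrite divfK // gt_eqF.
have cn : {for z0, continuous (fun y : plane => `|y - z0|)}.
  apply: (@continuous_comp _ _ _ (fun y : plane => y - z0)); last exact: norm_continuous.
  by apply: cvgB; [exact: cvg_id|exact: cvg_cst].
have zr : `|z0 - z0| < rho / 8 by rewrite subrr normr0.
apply: filterS (cvgr_lt _ cn _ zr) => z hz.
apply/eqP; apply: contraT => sz.
have sz0 : 0 < s z ^+ 2 by rewrite lt_neqAle sqr_ge0 eq_sym sqrf_eq0 sz.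
have CS : 0 <= C / s z ^+ 2 by rewrite divr_ge0 // ltW.
(* Choosing m above C / s^2 contradicts the bound, because m < 4^m. *)
have := key (Num.bound (C / s z ^+ 2)) z hz.
rewrite mulrC -ler_pdivlMr // leNgt => /negP[].
apply: lt_le_trans (archi_boundP CS) _.
by rewrite -natrX ler_nat ltnW // ltn_expl.
Qed.

End ClusteringZeros.

(** * Noncommutative ring identities modulo oriented relations *)

Inductive ncexpr :=
  NcVar of nat | Nc0 | Nc1 | NcAdd of ncexpr & ncexpr | NcOpp of ncexpr
| NcMul of ncexpr & ncexpr.

Inductive ncrules :=
  NcNil | NcRule of ncexpr & ncexpr | NcRules of ncrules & ncrules.

(* A polynomial is a list of signed words; (false, w) stands for - w. *)
Definition ncpoly := seq (bool * seq nat).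

Fixpoint nc_poly (e : ncexpr) : ncpoly :=
  match e with
  | NcVar i => [:: (true, [:: i])]
  | Nc0 => [::]
  | Nc1 => [:: (true, [::])]
  | NcAdd e1 e2 => nc_poly e1 ++ nc_poly e2
  | NcOpp e1 => [seq (~~ m.1, m.2) | m <- nc_poly e1]
  | NcMul e1 e2 =>
      [seq (m1.1 == m2.1, m1.2 ++ m2.2) | m1 <- nc_poly e1, m2 <- nc_poly e2]
  end.

Fixpoint nc_find (w u : seq nat) : option (seq nat * seq nat) :=
  if prefix w u then Some ([::], drop (size w) u) else
  if u is x :: u' then
    if nc_find w u' is Some (p, q) then Some (x :: p, q) else None
  else None.

Fixpoint nc_step (t : ncrules) (u : seq nat) : option ncpoly :=
  match t with
  | NcNil => None
  | NcRule l r =>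
      if nc_poly l is [:: (true, w)] then
        if nc_find w u is Some (p, q) then
          Some [seq (m.1, p ++ m.2 ++ q) | m <- nc_poly r]
        else None
      else None
  | NcRules t1 t2 => if nc_step t1 u is Some p then Some p else nc_step t2 u
  end.

(** [n] is fuel. Irreducible words are collected in [acc] and cancelled against opposite ones as
    they appear. Only soundness is proved: the relations may be neither terminating nor
    confluent. *)
Fixpoint nc_normal (n : nat) (t : ncrules) (todo acc : ncpoly) : bool :=
  if n is n'.+1 then
    if todo is (b, w) :: todo' then
      if nc_step t w is Some p then
        nc_normal n' t ([seq (b == m.1, m.2) | m <- p] ++ todo') acc
      else if (~~ b, w) \in acc then nc_normal n' t todo' (rem (~~ b, w) acc)
      else nc_normal n' t todo' ((b, w) :: acc)
    else nilp acc
  else false.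

Section NcCorrect.
Variables (V : pzRingType) (env : seq V).
Implicit Types (e : ncexpr) (p q : ncpoly) (t : ncrules).

Fixpoint nc_eval e : V :=
  match e with
  | NcVar i => nth 0 env i
  | Nc0 => 0
  | Nc1 => 1
  | NcAdd e1 e2 => nc_eval e1 + nc_eval e2
  | NcOpp e1 => - nc_eval e1
  | NcMul e1 e2 => nc_eval e1 * nc_eval e2
  end.

(** A product in [Type], so that a tuple of equations is itself, by conversion, a proof of
    [nc_holds]; the proof [I] stands for the absence of relations. *)
Fixpoint nc_holds t : Type :=
  match t with
  | NcNil => True
  | NcRule l r => nc_eval l = nc_eval r
  | NcRules t1 t2 => (nc_holds t1 * nc_holds t2)%type
  end.

Definition nc_word (w : seq nat) : V := \prod_(i <- w) nth 0 env i.
Definition nc_mono (m : bool * seq nat) : V :=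
  if m.1 then nc_word m.2 else - nc_word m.2.
Definition nc_sum p : V := \sum_(m <- p) nc_mono m.

Lemma nc_mono_mul b m : nc_mono (b == m.1, m.2) = if b then nc_mono m else - nc_mono m.
Proof. by case: b m => [] [[] w] //=; rewrite /nc_mono /= ?opprK. Qed.

Lemma nc_polyE e : nc_sum (nc_poly e) = nc_eval e.
Proof.
rewrite /nc_sum; elim: e => [i|||e1 IH1 e2 IH2|e1 IH1|e1 IH1 e2 IH2] /=.
- by rewrite big_seq1 /nc_mono /nc_word /= big_seq1.
- by rewrite big_nil.
- by rewrite big_seq1 /nc_mono /nc_word /= big_nil.
- by rewrite big_cat /= IH1 IH2.
- rewrite big_map -IH1 -sumrN; apply: eq_bigr => -[[] w] _ //.
  by rewrite /nc_mono /= opprK.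
- rewrite -IH1 -IH2 big_distrl big_allpairs_dep /=; apply: eq_bigr => -[b w] _.
  rewrite big_distrr /=; apply: eq_bigr => -[b' w'] _.
  by case: b b' => [] []; rewrite /nc_mono /= /nc_word big_cat /= ?mulrNN ?mulrN ?mulNr.
Qed.

Lemma nc_findP w u : if nc_find w u is Some (p, q) then u = p ++ w ++ q else True.
Proof.
have nc_findE v : nc_find w v = if prefix w v then Some ([::], drop (size w) v) else
    if v is x :: v' then
      if nc_find w v' is Some (p, q) then Some (x :: p, q) else None
    else None by case: v.
elim: u => [|x u IH]; rewrite nc_findE; case: ifP => //.
- by case: (w).
- by move=> /prefixP[s ->]; rewrite drop_size_cat.
- by move=> _; case: (nc_find w u) IH => [[p q] ->|].
Qed.

Lemma nc_stepP t u : nc_holds t ->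
  if nc_step t u is Some p then nc_sum p = nc_word u else True.
Proof.
elim: t => [//|l r|t1 IH1 t2 IH2] /=; last first.
  by move=> [/IH1 h1 /IH2 h2]; case: (nc_step t1 u) h1.
rewrite -!nc_polyE; case: (nc_poly l) => // -[[] w] [] //.
rewrite {1}/nc_sum big_seq1 /nc_mono /= => E.
have := nc_findP w u; case: (nc_find w u) => // -[p q] ->.
rewrite /nc_word !big_cat /= -/(nc_word w) E /nc_sum big_map.
rewrite mulr_suml mulr_sumr; apply: eq_bigr => -[[] v] _; rewrite /nc_mono /=.
  by rewrite /nc_word !big_cat.
by rewrite /nc_word !big_cat /= mulNr mulrN.
Qed.

(** The invariant is the sum of the values of the two lists: rewriting, moving and cancelling a word
    all preserve it. *)
Lemma nc_normalP n t p q : nc_holds t -> nc_normal n t p q ->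
  nc_sum p + nc_sum q = 0.
Proof.
move=> ht; elim: n p q => // n IH [|[b w] p] q /=.
  by move=> /nilP->; rewrite /nc_sum !big_nil addr0.
have := nc_stepP w ht; case: (nc_step t w) => [r hr /IH h|_].
  apply: etrans h; rewrite /nc_sum big_cat /= big_map big_cons.
  congr (_ + _ + _); rewrite {1}/nc_mono /= -hr /nc_sum; case: b => /=.
    by apply: eq_bigr => m _; rewrite nc_mono_mul.
  by rewrite -sumrN; apply: eq_bigr => m _; rewrite nc_mono_mul.
case: ifP => [mq /IH h|_ /IH h]; apply: etrans h; rewrite /nc_sum !big_cons; last first.
  by rewrite addrCA addrA.
rewrite (perm_big _ (perm_to_rem mq)) /= big_cons.
have E : nc_mono (b, w) + nc_mono (~~ b, w) = 0.
  by rewrite /nc_mono /=; case: b {mq} => /=; rewrite ?subrr ?addNr.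
by rewrite (addrC (nc_mono (b, w))) -addrA (addrA (nc_mono (b, w))) E add0r.
Qed.

Lemma nc_correct t l r : nc_holds t ->
  nc_normal 20000 t (nc_poly (NcAdd l (NcOpp r))) [::] = true ->
  nc_eval l = nc_eval r.
Proof.
move=> ht /(nc_normalP ht); rewrite nc_polyE /nc_sum big_nil addr0 /=.
exact: subr0_eq.
Qed.

End NcCorrect.

Ltac nc_member x l :=
  match l with
  | nil => constr:(false)
  | x :: _ => constr:(true)
  | _ :: ?l' => nc_member x l'
  end.
Ltac nc_index x l :=
  match l with
  | x :: _ => constr:(0%N)
  | _ :: ?l' => let n := nc_index x l' in constr:(S n)
  end.
Ltac nc_vars x l :=
  match x with
  | (?a + ?b)%R => let l := nc_vars a l in nc_vars b l
  | (?a * ?b)%R => let l := nc_vars a l in nc_vars b l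
  | (- ?a)%R => nc_vars a l
  | 0%R => l
  | 1%R => l
  | _ => match nc_member x l with
         | true => l
         | false => constr:(x :: l)
         end
  end.
Ltac nc_vars_rules T l :=
  match T with
  | (?a = ?b) => let l := nc_vars a l in nc_vars b l
  | (?T1 * ?T2)%type => let l := nc_vars_rules T1 l in nc_vars_rules T2 l
  | _ => l
  end.
Ltac nc_reify x l :=
  match x with
  | (?a + ?b)%R =>
      let a := nc_reify a l in let b := nc_reify b l in constr:(NcAdd a b)
  | (?a * ?b)%R =>
      let a := nc_reify a l in let b := nc_reify b l in constr:(NcMul a b)
  | (- ?a)%R => let a := nc_reify a l in constr:(NcOpp a)
  | 0%R => constr:(Nc0)
  | 1%R => constr:(Nc1)
  | _ => let n := nc_index x l in constr:(NcVar n)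
  end.
Ltac nc_reify_rules T l :=
  match T with
  | (?a = ?b) =>
      let a := nc_reify a l in let b := nc_reify b l in constr:(NcRule a b)
  | (?T1 * ?T2)%type =>
      let t1 := nc_reify_rules T1 l in let t2 := nc_reify_rules T2 l in
      constr:(NcRules t1 t2)
  | _ => constr:(NcNil)
  end.

(* [ncring (h1, h2, ...)] proves an equation by rewriting each word of both
   sides with the relations h1, h2, ..., oriented from left to right. *)
Ltac ncring h :=
  let T := type of h in
  match goal with
  | |- @eq ?V ?a ?b =>
      let l := constr:(@nil V) in
      let l := nc_vars a l in
      let l := nc_vars b l in
      let l := nc_vars_rules T l in
      let ea := nc_reify a l in
      let eb := nc_reify b l in
      let t := nc_reify_rules T l in
      exact (@nc_correct _ l t ea eb h (erefl true <: nc_normal 20000 t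
        (nc_poly (NcAdd ea (NcOpp eb))) [::] = true))
  end.

(** * Quaternion-valued functions *)

Section QuaternionCalculus.
Variable R : realType.
Local Notation plane := (R * R)%type.
Local Notation H := (quat R).
Implicit Types (D E : set plane) (F G : plane -> R) (u w : plane -> H) (z v : plane).

Definition realq (a : R) : H := Quat a 0 0 0.

Lemma quat_eqP (x y : H) : qre x = qre y -> qim1 x = qim1 y -> qim2 x = qim2 y ->
  qim3 x = qim3 y -> x = y.
Proof. by case: x y => [? ? ? ?] [? ? ? ?] /= -> -> -> ->. Qed.

Lemma qreD (x y : H) : qre (x + y) = qre x + qre y. Proof. by []. Qed.
Lemma qim1D (x y : H) : qim1 (x + y) = qim1 x + qim1 y. Proof. by []. Qed.
Lemma qim2D (x y : H) : qim2 (x + y) = qim2 x + qim2 y. Proof. by []. Qed.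
Lemma qim3D (x y : H) : qim3 (x + y) = qim3 x + qim3 y. Proof. by []. Qed.
Lemma qreN (x : H) : qre (- x) = - qre x. Proof. by []. Qed.
Lemma qim1N (x : H) : qim1 (- x) = - qim1 x. Proof. by []. Qed.
Lemma qim2N (x : H) : qim2 (- x) = - qim2 x. Proof. by []. Qed.
Lemma qim3N (x : H) : qim3 (- x) = - qim3 x. Proof. by []. Qed.
Lemma qreM (x y : H) : qre (x * y)
  = qre x * qre y - qim1 x * qim1 y - qim2 x * qim2 y - qim3 x * qim3 y.
Proof. by case: x y => [? ? ? ?] [? ? ? ?]. Qed.
Lemma qim1M (x y : H) : qim1 (x * y)
  = qre x * qim1 y + qim1 x * qre y + qim2 x * qim3 y - qim3 x * qim2 y.
Proof. by case: x y => [? ? ? ?] [? ? ? ?]. Qed.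
Lemma qim2M (x y : H) : qim2 (x * y)
  = qre x * qim2 y - qim1 x * qim3 y + qim2 x * qre y + qim3 x * qim1 y.
Proof. by case: x y => [? ? ? ?] [? ? ? ?]. Qed.
Lemma qim3M (x y : H) : qim3 (x * y)
  = qre x * qim3 y + qim1 x * qim2 y - qim2 x * qim1 y + qim3 x * qre y.
Proof. by case: x y => [? ? ? ?] [? ? ? ?]. Qed.
Definition quatE := (qreD, qim1D, qim2D, qim3D, qreN, qim1N, qim2N, qim3N,
  qreM, qim1M, qim2M, qim3M).

Lemma quat_unit (x : H) : x != 0 -> x \is a GRing.unit.
Proof. by []. Qed.

Lemma quat_invE (x : H) : x != 0 -> x^-1 = Defs.invq x.
Proof. by move=> x0; rewrite /GRing.inv /= /totinvq x0. Qed.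

Lemma quat_mulfV (x : H) : x != 0 -> x * x^-1 = 1.
Proof. by move=> /quat_unit; exact: mulrV. Qed.

Lemma quat_mulVf (x : H) : x != 0 -> x^-1 * x = 1.
Proof. by move=> /quat_unit; exact: mulVr. Qed.

Lemma quat_mulf_eq0 (x y : H) : (x * y == 0) = (x == 0) || (y == 0).
Proof.
have [->|x0] /= := eqVneq x 0; first by rewrite mul0r eqxx.
by rewrite -[in RHS](inj_eq (mulrI (quat_unit x0))) mulr0.
Qed.

Lemma quat_invr_neq0 (x : H) : x != 0 -> x^-1 != 0.
Proof.
by move=> x0; apply: contraTneq isT => e; have := quat_mulfV x0;
  rewrite e mulr0 => /esym/eqP; rewrite oner_eq0.
Qed.

Lemma sqnqM (x y : H) : sqnq (x * y) = sqnq x * sqnq y.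
Proof. by rewrite /sqnq !quatE; ring. Qed.

Lemma smoothR_ext D F G : open D -> (forall z, D z -> F z = G z) ->
  smoothR D F -> smoothR D G.
Proof. by move=> oD FG sF n; exact: ndiff_ext FG (sF n). Qed.

Lemma smoothRD D F G : open D -> smoothR D F -> smoothR D G ->
  smoothR D (fun z => F z + G z).
Proof. by move=> oD sF sG n; exact: ndiffD. Qed.

Lemma smoothRN D F : open D -> smoothR D F -> smoothR D (fun z => - F z).
Proof. by move=> oD sF n; exact: ndiffN. Qed.

Lemma smoothRM D F G : open D -> smoothR D F -> smoothR D G ->
  smoothR D (fun z => F z * G z).
Proof. by move=> oD sF sG n; exact: ndiffM. Qed.

Lemma smoothRV D F : open D -> (forall z, D z -> F z != 0) -> smoothR D F ->
  smoothR D (fun z => (F z)^-1).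
Proof. by move=> oD F0 sF n; exact: ndiffV. Qed.

Lemma smoothR_cst D (a : R) : smoothR D (fun=> a).
Proof. by move=> n; exact: ndiff_cst. Qed.

Lemma smoothR_derive D F v : smoothR D F -> smoothR D ('D_v F).
Proof. by move=> sF n; have /ndiffS[_] := sF n.+1; exact. Qed.

Lemma smoothR_differentiable D F z : smoothR D F -> D z -> differentiable F z.
Proof. by move=> sF; have /ndiffS[+ _] := sF 1%N; exact. Qed.

Lemma smoothq_ext D u w : open D -> (forall z, D z -> u z = w z) ->
  smoothq D u -> smoothq D w.
Proof.
move=> oD uw [s0 s1 s2 s3].
by split; [apply: smoothR_ext s0|apply: smoothR_ext s1|apply: smoothR_ext s2|
  apply: smoothR_ext s3] => // z /uw ->.
Qed.

Lemma smoothq_sub D E u : E `<=` D -> smoothq D u -> smoothq E u.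
Proof.
by move=> ED [s0 s1 s2 s3]; split=> n; apply: ndiff_sub ED _.
Qed.

Lemma smoothq_local D u :
  (forall z, D z -> exists2 E, E z & smoothq E u) -> smoothq D u.
Proof.
by move=> h; split=> n; apply: ndiff_local => z /h[E Ez [s0 s1 s2 s3]]; exists E.
Qed.

Lemma smoothqD D u w : open D -> smoothq D u -> smoothq D w ->
  smoothq D (fun z => u z + w z).
Proof. by move=> oD [? ? ? ?] [? ? ? ?]; split; exact: smoothRD. Qed.

Lemma smoothqN D u : open D -> smoothq D u -> smoothq D (fun z => - u z).
Proof. by move=> oD [? ? ? ?]; split; exact: smoothRN. Qed.

Lemma smoothqB D u w : open D -> smoothq D u -> smoothq D w ->
  smoothq D (fun z => u z - w z).
Proof. by move=> oD su sw; apply: smoothqD => //; exact: smoothqN. Qed.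

Lemma smoothq_cst D (x : H) : smoothq D (fun=> x).
Proof. by split; exact: smoothR_cst. Qed.

Lemma smoothqM D u w : open D -> smoothq D u -> smoothq D w ->
  smoothq D (fun z => u z * w z).
Proof.
move=> oD [u0 u1 u2 u3] [w0 w1 w2 w3].
have P F G := @smoothRM D F G oD; have S F G := @smoothRD D F G oD.
have N F := @smoothRN D F oD.
split.
- rewrite (_ : (fun z => _) = fun z => qre (u z) * qre (w z) + - (qim1 (u z) * qim1 (w z))
    + - (qim2 (u z) * qim2 (w z)) + - (qim3 (u z) * qim3 (w z))).
    by apply: (S _ _ (S _ _ (S _ _ _ (N _ _)) (N _ _)) (N _ _)); exact: P.
  by apply/funext => z; rewrite qreM.
- rewrite (_ : (fun z => _) = fun z => qre (u z) * qim1 (w z) + qim1 (u z) * qre (w z)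
    + qim2 (u z) * qim3 (w z) + - (qim3 (u z) * qim2 (w z))).
    by apply: (S _ _ (S _ _ (S _ _ _ _) _) (N _ _)); exact: P.
  by apply/funext => z; rewrite qim1M.
- rewrite (_ : (fun z => _) = fun z => qre (u z) * qim2 (w z) + - (qim1 (u z) * qim3 (w z))
    + qim2 (u z) * qre (w z) + qim3 (u z) * qim1 (w z)).
    by apply: (S _ _ (S _ _ (S _ _ _ (N _ _)) _) _); exact: P.
  by apply/funext => z; rewrite qim2M.
- rewrite (_ : (fun z => _) = fun z => qre (u z) * qim3 (w z) + qim1 (u z) * qim2 (w z)
    + - (qim2 (u z) * qim1 (w z)) + qim3 (u z) * qre (w z)).
    by apply: (S _ _ (S _ _ (S _ _ _ _) (N _ _)) _); exact: P.
  by apply/funext => z; rewrite qim3M.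
Qed.

Lemma smoothR_sqnq D u : open D -> smoothq D u -> smoothR D (fun z => sqnq (u z)).
Proof.
move=> oD [u0 u1 u2 u3].
have P F G := @smoothRM D F G oD; have S F G := @smoothRD D F G oD.
by apply: (S _ _ (S _ _ (S _ _ _ _) _) _); exact: P.
Qed.

Lemma smoothqV D u : open D -> (forall z, D z -> u z != 0) -> smoothq D u ->
  smoothq D (fun z => (u z)^-1).
Proof.
move=> oD u0 su; apply: (@smoothq_ext _ (fun z => Defs.invq (u z))) => //.
  by move=> z /u0/quat_invE ->.
have sV : smoothR D (fun z => (sqnq (u z))^-1).
  apply: smoothRV => //; last exact: smoothR_sqnq.
  by move=> z /u0; rewrite sqnq_eq0.
have [s0 s1 s2 s3] := su.
by split; apply: smoothRM => //; exact: smoothRN.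
Qed.

Lemma smoothq_dirq D u v : smoothq D u -> smoothq D (fun z => dirq u z v).
Proof. by case=> s0 s1 s2 s3; split; exact: smoothR_derive. Qed.

Lemma smoothq_comp D E u (Phi : plane -> plane) : open D -> open E ->
  (forall z, D z -> E (Phi z)) ->
  smoothR D (fun x => (Phi x).1) -> smoothR D (fun x => (Phi x).2) ->
  smoothq E u -> smoothq D (u \o Phi).
Proof.
move=> oD oE DE s1 s2 [u0 u1 u2 u3].
by split=> n; [apply: (ndiff_comp oD oE DE (s1 n) (s2 n) (u0 n))
  | apply: (ndiff_comp oD oE DE (s1 n) (s2 n) (u1 n))
  | apply: (ndiff_comp oD oE DE (s1 n) (s2 n) (u2 n))
  | apply: (ndiff_comp oD oE DE (s1 n) (s2 n) (u3 n))].
Qed.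

Lemma dirq_near u w z v : (\forall y \near z, u y = w y) -> dirq u z v = dirq w z v.
Proof.
move=> uw; congr Quat; apply: near_eq_derive; apply: filterS uw => y /= -> //.
Qed.

Lemma dirq_ext D u w z v : open D -> D z -> (forall y, D y -> u y = w y) ->
  dirq u z v = dirq w z v.
Proof.
move=> oD Dz uw; apply: dirq_near.
by apply: filterS (open_nbhs_nbhs (conj oD Dz)); exact: uw.
Qed.

Lemma dirq_cst (x : H) z v : dirq (fun=> x) z v = 0.
Proof. by congr Quat; exact: derive_cst. Qed.

Lemma dirqD D u w z v : D z -> smoothq D u -> smoothq D w ->
  dirq (fun y => u y + w y) z v = dirq u z v + dirq w z v.
Proof.
move=> Dz [u0 u1 u2 u3] [w0 w1 w2 w3].
have d F : smoothR D F -> derivable F z v.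
  by move=> sF; apply: diff_derivable; exact: smoothR_differentiable sF Dz.
by congr Quat; apply: deriveD; exact: d.
Qed.

Lemma dirqN D u z v : D z -> smoothq D u ->
  dirq (fun y => - u y) z v = - dirq u z v.
Proof.
move=> Dz [u0 u1 u2 u3].
have d F : smoothR D F -> derivable F z v.
  by move=> sF; apply: diff_derivable; exact: smoothR_differentiable sF Dz.
by congr Quat; apply: deriveN; exact: d.
Qed.

Lemma dirqB D u w z v : open D -> D z -> smoothq D u -> smoothq D w ->
  dirq (fun y => u y - w y) z v = dirq u z v - dirq w z v.
Proof.
move=> oD Dz su sw; rewrite (dirqD v Dz su (smoothqN oD sw)).
by rewrite (dirqN v Dz sw).
Qed.

(** The common shape of the four coordinates of a quaternionic product, with a, b, c as signs, and
    of the squared norm. *)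
Lemma derive_dot (F1 F2 F3 F4 G1 G2 G3 G4 : plane -> R) (a b c : R) z v :
  derivable F1 z v -> derivable F2 z v -> derivable F3 z v -> derivable F4 z v ->
  derivable G1 z v -> derivable G2 z v -> derivable G3 z v -> derivable G4 z v ->
  'D_v (fun y => F1 y * G1 y + a * (F2 y * G2 y) + b * (F3 y * G3 y)
    + c * (F4 y * G4 y)) z
  = (F1 z * 'D_v G1 z + 'D_v F1 z * G1 z)
    + a * (F2 z * 'D_v G2 z + 'D_v F2 z * G2 z)
    + b * (F3 z * 'D_v G3 z + 'D_v F3 z * G3 z)
    + c * (F4 z * 'D_v G4 z + 'D_v F4 z * G4 z).
Proof.
move=> /derivableP f1 /derivableP f2 /derivableP f3 /derivableP f4.
move=> /derivableP g1 /derivableP g2 /derivableP g3 /derivableP g4.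
have i1 := is_deriveM f1 g1; have i2 := is_deriveZ a (is_deriveM f2 g2).
have i3 := is_deriveZ b (is_deriveM f3 g3); have i4 := is_deriveZ c (is_deriveM f4 g4).
have [_ ->] := is_deriveD (is_deriveD (is_deriveD i1 i2) i3) i4.
by rewrite /GRing.scale /=; move: ('D_v _ _) ('D_v _ _) ('D_v _ _) ('D_v _ _)
  ('D_v _ _) ('D_v _ _) ('D_v _ _) ('D_v _ _) => *; ring.
Qed.

Lemma dirqM D u w z v : D z -> smoothq D u -> smoothq D w ->
  dirq (fun y => u y * w y) z v = dirq u z v * w z + u z * dirq w z v.
Proof.
move=> Dz [u0 u1 u2 u3] [w0 w1 w2 w3].
have d F : smoothR D F -> derivable F z v.
  by move=> sF; apply: diff_derivable; exact: smoothR_differentiable sF Dz.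
move: (d _ u0) (d _ u1) (d _ u2) (d _ u3) (d _ w0) (d _ w1) (d _ w2) (d _ w3).
move=> {}u0 {}u1 {}u2 {}u3 {}w0 {}w1 {}w2 {}w3.
apply: quat_eqP; rewrite !quatE /dirq /=.
- rewrite (_ : (fun y => _) = fun y => qre (u y) * qre (w y)
    + -1 * (qim1 (u y) * qim1 (w y)) + -1 * (qim2 (u y) * qim2 (w y))
    + -1 * (qim3 (u y) * qim3 (w y))); last first.
    by apply/funext => y; rewrite qreM !mulN1r.
  rewrite (derive_dot _ _ _ u0 u1 u2 u3 w0 w1 w2 w3); move: ('D_v _ _) ('D_v _ _) ('D_v _ _) ('D_v _ _)
    ('D_v _ _) ('D_v _ _) ('D_v _ _) ('D_v _ _) => *; ring.
- rewrite (_ : (fun y => _) = fun y => qre (u y) * qim1 (w y)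
    + 1 * (qim1 (u y) * qre (w y)) + 1 * (qim2 (u y) * qim3 (w y))
    + -1 * (qim3 (u y) * qim2 (w y))); last first.
    by apply/funext => y; rewrite qim1M !mulN1r !mul1r.
  rewrite (derive_dot _ _ _ u0 u1 u2 u3 w1 w0 w3 w2); move: ('D_v _ _) ('D_v _ _) ('D_v _ _) ('D_v _ _)
    ('D_v _ _) ('D_v _ _) ('D_v _ _) ('D_v _ _) => *; ring.
- rewrite (_ : (fun y => _) = fun y => qre (u y) * qim2 (w y)
    + -1 * (qim1 (u y) * qim3 (w y)) + 1 * (qim2 (u y) * qre (w y))
    + 1 * (qim3 (u y) * qim1 (w y))); last first.
    by apply/funext => y; rewrite qim2M !mulN1r !mul1r.
  rewrite (derive_dot _ _ _ u0 u1 u2 u3 w2 w3 w0 w1); move: ('D_v _ _) ('D_v _ _) ('D_v _ _) ('D_v _ _)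
    ('D_v _ _) ('D_v _ _) ('D_v _ _) ('D_v _ _) => *; ring.
- rewrite (_ : (fun y => _) = fun y => qre (u y) * qim3 (w y)
    + 1 * (qim1 (u y) * qim2 (w y)) + -1 * (qim2 (u y) * qim1 (w y))
    + 1 * (qim3 (u y) * qre (w y))); last first.
    by apply/funext => y; rewrite qim3M !mulN1r !mul1r.
  rewrite (derive_dot _ _ _ u0 u1 u2 u3 w3 w2 w1 w0); move: ('D_v _ _) ('D_v _ _) ('D_v _ _) ('D_v _ _)
    ('D_v _ _) ('D_v _ _) ('D_v _ _) ('D_v _ _) => *; ring.
Qed.

Lemma dirqV D u z v : open D -> D z -> (forall y, D y -> u y != 0) -> smoothq D u ->
  dirq (fun y => (u y)^-1) z v = - ((u z)^-1 * dirq u z v * (u z)^-1).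
Proof.
move=> oD Dz u0 su; have sV := smoothqV oD u0 su.
have e : dirq u z v * (u z)^-1 + u z * dirq (fun y => (u y)^-1) z v = 0.
  rewrite -(dirqM v Dz su sV) -(dirq_cst 1 z v).
  by apply: (dirq_ext v oD Dz) => y /u0/quat_mulfV.
apply: (mulrI (quat_unit (u0 z Dz))); rewrite mulrN !mulrA quat_mulfV ?u0 // mul1r.
by apply/eqP; rewrite -addr_eq0 addrC e.
Qed.

Lemma dirq_lin D u z (a : R) v x : D z -> smoothq D u ->
  dirq u z (a *: v + x) = realq a * dirq u z v + dirq u z x.
Proof.
move=> Dz [u0 u1 u2 u3].
have d F : smoothR D F -> 'D_(a *: v + x) F z = a * 'D_v F z + 'D_x F z.
  by move=> sF; apply: derive_lin; exact: smoothR_differentiable sF Dz.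
rewrite /dirq /realq !d //; apply: quat_eqP; rewrite !quatE /=;
  move: ('D_v _ _) ('D_v _ _) ('D_v _ _) ('D_v _ _) => *; ring.
Qed.

Lemma dirqC D u z v x : open D -> D z -> smoothq D u ->
  dirq (fun y => dirq u y v) z x = dirq (fun y => dirq u y x) z v.
Proof.
move=> oD Dz [u0 u1 u2 u3]; rewrite /dirq /=.
by rewrite (schwarz v x oD Dz (u0 2%N)) (schwarz v x oD Dz (u1 2%N))
  (schwarz v x oD Dz (u2 2%N)) (schwarz v x oD Dz (u3 2%N)).
Qed.

Lemma smoothq_near_neq0 D u z : smoothq D u -> D z -> u z != 0 ->
  \forall y \near z, u y != 0.
Proof.
move=> [s0 s1 s2 s3] Dz uz.
have c F : smoothR D F -> {for z, continuous F}.
  by move=> sF; apply: differentiable_continuous; exact: smoothR_differentiable sF Dz.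
have [/eqP a0|a0] := boolP (qre (u z) == 0); last first.
  apply: filterS (cvgr_neq0 _ (c _ s0) a0) => y; apply: contraNneq => ->; by [].
have [/eqP a1|a1] := boolP (qim1 (u z) == 0); last first.
  apply: filterS (cvgr_neq0 _ (c _ s1) a1) => y; apply: contraNneq => ->; by [].
have [/eqP a2|a2] := boolP (qim2 (u z) == 0); last first.
  apply: filterS (cvgr_neq0 _ (c _ s2) a2) => y; apply: contraNneq => ->; by [].
have a3 : qim3 (u z) != 0.
  by apply: contraNneq uz => a3; apply/eqP; exact: quat_eqP.
by apply: filterS (cvgr_neq0 _ (c _ s3) a3) => y; apply: contraNneq => ->.
Qed.

Lemma dirq_comp D E u (Phi : plane -> plane) z v : D z ->
  smoothR D (fun x => (Phi x).1) -> smoothR D (fun x => (Phi x).2) ->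
  E (Phi z) -> smoothq E u ->
  dirq (u \o Phi) z v = dirq u (Phi z) (jac Phi z v).
Proof.
move=> Dz s1 s2 EP [u0 u1 u2 u3].
have d1 := smoothR_differentiable s1 Dz; have d2 := smoothR_differentiable s2 Dz.
have d F : smoothR E F -> 'D_v (F \o Phi) z = 'D_(jac Phi z v) F (Phi z).
  move=> sF; have dF := smoothR_differentiable sF EP.
  by have [] := derive_comp_plane v d1 d2 dF.
by congr Quat; [exact: d u0|exact: d u1|exact: d u2|exact: d u3].
Qed.

End QuaternionCalculus.

(** * Darboux transforms in a chart *)

Section ConstantConjugates.
Variable R : realType.
Local Notation H := (quat R).
Implicit Types x y c b k : H.

Lemma quat_addrr_eq0 x : x + x = 0 -> x = 0.
Proof.
move=> e; have h (a : R) : a + a = 0 -> a = 0 by lra.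
by apply: quat_eqP; apply: h; [have := congr1 (@qre R) e|have := congr1 (@qim1 R) e
  |have := congr1 (@qim2 R) e|have := congr1 (@qim3 R) e].
Qed.

Lemma quat_half2 : (2^-1 : H) + 2^-1 = 1.
Proof.
rewrite -[X in X + X]mul1r -mulrDl; apply: quat_mulfV.
by apply/eqP => /quat_addrr_eq0/eqP; rewrite oner_eq0.
Qed.

Lemma quat_halfC x : 2^-1 * x = x * 2^-1.
Proof.
have u : (1 + 1 : H) != 0.
  by apply/eqP => /quat_addrr_eq0/eqP; rewrite oner_eq0.
apply: (mulrI (quat_unit u)); rewrite !mulrA quat_mulfV // mul1r.
have -> : (1 + 1) * x = x * (1 + 1) by ncring I.
by rewrite -mulrA quat_mulfV // mulr1.
Qed.

Lemma quat_half_add x : 2^-1 * x + 2^-1 * x = x.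
Proof. by rewrite -mulrDl quat_half2 mul1r. Qed.

End ConstantConjugates.

(* A section beta with d beta = G (N beta c - beta b) gauges the constants c, b:
   with C = beta c beta^-1 and B = beta b beta^-1 everything is expressed by
   r = N C - B, E = B C^-1 and R = E - 2 r^-1. The CMC hypotheses enter twice,
   once with (2G, P) = (dg, df) and once with (2G, P, N) replaced by
   (df, dg, -N). *)
Section GaugedConstants.
Variable R : realType.
Local Notation plane := (R * R)%type.
Local Notation H := (quat R).

Section Formulas.
Variables (X : Type) (N beta : X -> H) (c b : H).
(** The domain [X] of these formulas is arbitrary, so that composing with the inverse of a chart
    commutes with them by conversion and results in the plane transfer to the surface. *)
Definition gconj (k : H) (p : X) : H := beta p * k * (beta p)^-1.
Definition grho (p : X) : H := (N p * beta p * c - beta p * b) * (beta p)^-1.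
Definition gE (p : X) : H := gconj (b * c^-1) p.
Definition gR (p : X) : H := gE p - (grho p)^-1 - (grho p)^-1.
End Formulas.

(** For c = a - 1 the relation [gauged_ccbb] is a^2 + b^2 = 1; it makes the gauge equation
    compatible with N^2 = -1. *)
Record gauged (D : set plane) (N beta : plane -> H) (G P : plane -> plane -> H)
    (c b : H) : Prop := Gauged {
  gauged_open : open D;
  gauged_smoothN : smoothq D N;
  gauged_smooth : smoothq D beta;
  gauged_NN : forall z, D z -> N z * N z = -1;
  gauged_dN : forall z v, D z -> dirq N z v = G v z + G v z - P v z;
  gauged_GN : forall z v, D z -> G v z * N z = - (N z * G v z);
  gauged_d : forall z v, D z ->
    dirq beta z v = G v z * (N z * beta z * c - beta z * b);
  gauged_neq0 : forall z, D z -> beta z != 0;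
  gauged_c_neq0 : c != 0;
  gauged_comm : b * c = c * b;
  gauged_ccbb : c * c + b * b = - (c + c) }.

Variables (D : set plane) (N beta : plane -> H) (G P : plane -> plane -> H) (c b : H).
Hypothesis HG : gauged D N beta G P c b.
Let oD : open D := gauged_open HG.
Let sN : smoothq D N := gauged_smoothN HG.
Let sbeta : smoothq D beta := gauged_smooth HG.
Let NN := gauged_NN HG.
Let dN := gauged_dN HG.
Let GN := gauged_GN HG.
Let dbeta := gauged_d HG.
Let beta0 := gauged_neq0 HG.
Let c0 : c != 0 := gauged_c_neq0 HG.
Let bc : b * c = c * b := gauged_comm HG.

Local Notation rho := (grho N beta c b).
Local Notation E := (gE beta c b).
Local Notation Rh := (gR N beta c b).
Local Notation C := (gconj beta c).
Local Notation B := (gconj beta b).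

Let bb : b * b = - (c + c) - c * c.
Proof. by rewrite -(gauged_ccbb HG) [c * c + _]addrC addrK. Qed.

Lemma gauged_mulfV z : D z -> beta z * (beta z)^-1 = 1.
Proof. by move=> Dz; exact: quat_mulfV (beta0 Dz). Qed.

Lemma gauged_mulVf z : D z -> (beta z)^-1 * beta z = 1.
Proof. by move=> Dz; exact: quat_mulVf (beta0 Dz). Qed.

(** If N beta c = beta b, multiplying by N and by b and using N^2 = -1 gives beta (c^2 + b^2) = 0,
    that is beta (c + c) = 0. *)
Lemma grho_neq0 z : D z -> rho z != 0.
Proof.
move=> Dz; rewrite /grho quat_mulf_eq0 negb_or quat_invr_neq0 ?beta0 // andbT.
apply: contraNneq c0 => e0.
have e : N z * beta z * c = beta z * b by apply/eqP; rewrite -subr_eq0 e0.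
have e2 : beta z * (c * c + b * b) = 0.
  have -> : beta z * (c * c + b * b)
    = - (N z * (N z * beta z * c - beta z * b) * c)
      - (N z * beta z * c - beta z * b) * b.
    by ncring (NN Dz, bc, bb).
  by rewrite e0 !(mulr0, mul0r) oppr0 addr0.
move: e2; rewrite (gauged_ccbb HG) mulrN => /eqP; rewrite oppr_eq0 quat_mulf_eq0.
by rewrite (negPf (beta0 Dz)) /= => /eqP/quat_addrr_eq0 ->.
Qed.

Lemma grho_mulfV z : D z -> rho z * (rho z)^-1 = 1.
Proof. by move=> Dz; exact: quat_mulfV (grho_neq0 Dz). Qed.

Lemma grho_mulVf z : D z -> (rho z)^-1 * rho z = 1.
Proof. by move=> Dz; exact: quat_mulVf (grho_neq0 Dz). Qed.

Lemma smoothq_gconj k : smoothq D (gconj beta k).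
Proof.
apply: smoothqM => //; last exact: smoothqV.
by apply: smoothqM => //; exact: smoothq_cst.
Qed.

Lemma smoothq_grho : smoothq D rho.
Proof.
apply: smoothqM => //; last exact: smoothqV.
apply: smoothqB => //; apply: smoothqM => //; try exact: smoothq_cst.
exact: smoothqM.
Qed.

Lemma smoothq_grhoV : smoothq D (fun z => (rho z)^-1).
Proof. apply: smoothqV => //; [exact: grho_neq0|exact: smoothq_grho]. Qed.

Lemma smoothq_gR : smoothq D Rh.
Proof.
by apply: smoothqB => //; [apply: smoothqB => //; [exact: smoothq_gconj|]|];
  exact: smoothq_grhoV.
Qed.

Lemma grhoE z : D z -> rho z = N z * C z - B z.
Proof. by move=> Dz; rewrite /grho /gconj; ncring I. Qed.

Lemma dbetaE z v : D z -> dirq beta z v = G v z * rho z * beta z.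
Proof. by move=> Dz; rewrite dbeta // /grho; ncring (gauged_mulVf Dz). Qed.

Lemma dirq_gconj k z v : D z -> dirq (gconj beta k) z v
  = G v z * rho z * gconj beta k z - gconj beta k z * G v z * rho z.
Proof.
move=> Dz; rewrite /gconj.
rewrite (dirqM v Dz (smoothqM oD sbeta (smoothq_cst D k)) (smoothqV oD beta0 sbeta)).
rewrite (dirqM v Dz sbeta (smoothq_cst D k)) dirq_cst.
rewrite (dirqV v oD Dz beta0 sbeta) !dbetaE //.
by ncring (gauged_mulfV Dz, gauged_mulVf Dz).
Qed.

Lemma gconj_comm z : D z -> B z * C z = C z * B z.
Proof. by move=> Dz; rewrite /gconj; ncring (gauged_mulVf Dz, bc). Qed.

Lemma gconj_sqr z : D z -> B z * B z = - (C z + C z) - C z * C z.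
Proof. by move=> Dz; rewrite /gconj; ncring (gauged_mulVf Dz, bb). Qed.

Lemma gconj_gE z : D z -> C z * E z = B z.
Proof.
move=> Dz; rewrite /gE /gconj; have cV := quat_mulfV c0.
have cb' : c * b = b * c by rewrite bc.
by ncring (gauged_mulVf Dz, cb', cV).
Qed.

Lemma gconj_gE2 z : D z -> B z * E z = - (1 + 1) - C z.
Proof.
move=> Dz; rewrite /gE /gconj; have cV := quat_mulfV c0.
by ncring (gauged_mulVf Dz, bb, cV, gauged_mulfV Dz).
Qed.

(** From C E = B and B E = - 2 - C follows rho E = N B + C + 2, and the two terms rho^-1 in R remove
    the 2. Thus R = - rho^-1 N rho, from which R^2 = -1 is immediate. *)
Lemma grho_gR z : D z -> rho z * Rh z = - (N z * rho z).
Proof.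
move=> Dz; rewrite /gR.
have -> : rho z * (E z - (rho z)^-1 - (rho z)^-1)
    = rho z * E z - rho z * (rho z)^-1 - rho z * (rho z)^-1 by ncring I.
rewrite grho_mulfV // grhoE //.
by ncring (NN Dz, gconj_gE Dz, gconj_gE2 Dz).
Qed.

Lemma gR_grhoV z : D z -> Rh z * (rho z)^-1 = - ((rho z)^-1 * N z).
Proof.
move=> Dz; have h := grho_gR Dz; have h1 := grho_mulfV Dz; have h2 := grho_mulVf Dz.
have -> : Rh z * (rho z)^-1 = (rho z)^-1 * (rho z * Rh z) * (rho z)^-1.
  by ncring h2.
by rewrite h; ncring h1.
Qed.

Lemma gR_sqr z : D z -> Rh z * Rh z = -1.
Proof.
move=> Dz; have h := grho_gR Dz; have h1 := grho_mulfV Dz; have h2 := grho_mulVf Dz.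
have -> : Rh z * Rh z = (rho z)^-1 * (rho z * Rh z) * Rh z by ncring h2.
by rewrite h; ncring (h, h2, NN Dz).
Qed.

(** By [gR_plus], - 4 tau is the form dR + R *dR. *)
Definition gtau (v z : plane) : H := (rho z)^-1 * P v z * C z * (rho z)^-1.

(** rho solves the Riccati equation d rho = - P C - rho G rho. Consequently, if 2 G is the
    differential of a map, subtracting 2 rho^-1 from that map leaves the differential - 2 tau; this
    is used for [parf]. *)
Lemma dirq_grhoV z v : D z ->
  dirq (fun y => (rho y)^-1) z v = G v z + gtau v z.
Proof.
move=> Dz; rewrite (dirqV v oD Dz grho_neq0 smoothq_grho).
have -> : dirq rho z v = dirq (fun y => N y * C y - B y) z v.
  by apply: (dirq_ext v oD Dz) => y Dy; exact: grhoE.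
have sC := smoothq_gconj c; have sB := smoothq_gconj b.
rewrite (dirqB v oD Dz (smoothqM oD sN sC) sB) (dirqM v Dz sN sC).
rewrite !dirq_gconj // dN //.
have -> : (G v z + G v z - P v z) * C z + N z * (G v z * rho z * C z - C z * G v z * rho z)
    - (G v z * rho z * B z - B z * G v z * rho z)
    = - (P v z * C z) - rho z * G v z * rho z.
  by rewrite grhoE //; ncring (NN Dz, GN v Dz, gconj_comm Dz, gconj_sqr Dz).
by rewrite /gtau; ncring (grho_mulfV Dz, grho_mulVf Dz).
Qed.

Lemma gE_E z : E z = Rh z + (rho z)^-1 + (rho z)^-1.
Proof. by rewrite /gR !subrK. Qed.

Lemma dirq_gR z v : D z -> dirq Rh z v
  = N z * G v z * rho z - Rh z * G v z * rho z
    - (rho z)^-1 * G v z * rho z - (rho z)^-1 * G v z * rho z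
    - gtau v z - gtau v z.
Proof.
move=> Dz; have sE : smoothq D E by exact: smoothq_gconj.
rewrite (dirqB v oD Dz (smoothqB oD sE smoothq_grhoV) smoothq_grhoV).
rewrite (dirqB v oD Dz sE smoothq_grhoV) dirq_grhoV // dirq_gconj // -/(E z) gE_E.
by ncring (grho_gR Dz, grho_mulfV Dz, GN v Dz).
Qed.

Section Star.
Variables (z v v' : plane).
Hypotheses (Dz : D z) (GJ : G v' z = - (N z * G v z)) (PJ : P v' z = N z * P v z).

Lemma gtauJ : gtau v' z = - (Rh z * gtau v z).
Proof. by rewrite /gtau PJ; ncring (gR_grhoV Dz). Qed.

(** dR is the sum of - 2 tau and (N - E) G rho. As *tau = - R tau, the first summand is doubled; the
    second one satisfies the opposite rule and cancels. In [gR_minus] the roles are exchanged. *)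
Lemma gR_plus : dirq Rh z v + Rh z * dirq Rh z v'
  = - (gtau v z + gtau v z + gtau v z + gtau v z).
Proof.
rewrite !dirq_gR // gtauJ GJ.
by ncring (NN Dz, grho_gR Dz, gR_grhoV Dz, gR_sqr Dz, grho_mulfV Dz, grho_mulVf Dz, GN v Dz).
Qed.

Lemma gR_minus : dirq Rh z v - Rh z * dirq Rh z v'
  = (N z - E z) * G v z * rho z + (N z - E z) * G v z * rho z.
Proof.
rewrite !dirq_gR // gtauJ GJ gE_E.
by ncring (NN Dz, grho_gR Dz, gR_grhoV Dz, gR_sqr Dz, grho_mulfV Dz, grho_mulVf Dz, GN v Dz).
Qed.

End Star.

End GaugedConstants.

(** * CMC surfaces in a chart, and the differentials of fh, its normals and its H *)

Section DarbouxTransform.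
Variable R : realType.
Local Notation plane := (R * R)%type.
Local Notation H := (quat R).

(* T = nu beta^-1 and darf = f + T; darN is the left normal of darf, its right
   normal is gR, and darH satisfies d darf * darH = (d darN - darN *d darN) / 2. *)
Section Formulas.
Variables (X : Type) (f N nu beta : X -> H) (c b : H).
Definition darT (p : X) : H := nu p * (beta p)^-1.
Definition darf (p : X) : H := f p + darT p.
Definition darN (p : X) : H := - (darT p * N p * (darT p)^-1).
Definition darH (p : X) : H := (gE beta c b p - N p) * (darT p)^-1.
End Formulas.

Lemma imaginary_sqr (x : H) : x * x = -1 -> imaginary x.
Proof.
case: x => a p q r [E0 E1 E2 E3]; rewrite /imaginary /=.
apply/eqP; apply: contraT => a0.
have h (t : R) : a * t + t * a = 0 -> t = 0.
  by move=> e; apply: (mulfI a0); rewrite mulr0; move: e; lra.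
have p0 : p = 0 by apply: h; move: E1; lra.
have q0 : q = 0 by apply: h; move: E2; lra.
have r0 : r = 0 by apply: h; move: E3; lra.
have := sqr_ge0 a; rewrite p0 q0 r0 in E0; move: E0; rewrite expr2; lra.
Qed.

(** The imaginary part of n x + x n is 2 Re(x) n when n is imaginary, and |n| = 1. *)
Lemma anticommute_imaginary (n x : H) : n * n = -1 -> n * x = - (x * n) -> imaginary x.
Proof.
move=> nn nx; have ni := imaginary_sqr nn.
have e : qre x * sqnq n = 0.
  have e1 : n * x * n + x * n * n = 0 by rewrite nx mulNr addNr.
  have := congr1 (@qre R) nx; have := congr1 (@qim1 R) nx.
  have := congr1 (@qim2 R) nx; have := congr1 (@qim3 R) nx.
  rewrite !quatE /sqnq ni => a3 a2 a1 a0.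
  have b1 : qre x * qim1 n = 0 by move: a1; lra.
  have b2 : qre x * qim2 n = 0 by move: a2; lra.
  have b3 : qre x * qim3 n = 0 by move: a3; lra.
  by rewrite expr0n add0r !mulrDr !expr2 !mulrA b1 b2 b3 !mul0r !addr0.
have s1 : sqnq n = 1.
  have q1 : qre (1 : H) = 1 by [].
  by have := congr1 (@qre R) nn; rewrite !quatE ni /sqnq ni q1; lra.
by move: e; rewrite s1 mulr1.
Qed.

Record cmc_plane (D : set plane) (f N : plane -> H) : Prop := CmcPlane {
  cmc_open : open D;
  cmc_smoothf : smoothq D f;
  cmc_smoothN : smoothq D N;
  cmc_NN : forall z, D z -> N z * N z = -1;
  cmc_fJ : forall z v, D z -> dirq f z (Jp v) = N z * dirq f z v;
  cmc_fN : forall z v, D z -> dirq f z (Jp v) = - (dirq f z v * N z);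
  cmc_eq : forall z v, D z ->
    dirq f z v = - (2^-1 * (dirq N z v - N z * dirq N z (Jp v))) }.

Definition gauG (f N : plane -> H) (v z : plane) : H :=
  2^-1 * dirq (fun q => f q + N q) z v.

Section CmcPlaneTheory.
Variables (D : set plane) (f N : plane -> H).
Hypothesis HC : cmc_plane D f N.
Let oD : open D := cmc_open HC.
Let sf : smoothq D f := cmc_smoothf HC.
Let sN : smoothq D N := cmc_smoothN HC.
Local Notation G := (gauG f N).

Lemma cmc_PN z v : D z -> dirq f z v * N z = - (N z * dirq f z v).
Proof. by move=> Dz; rewrite -(cmc_fJ HC) // (cmc_fN HC) // opprK. Qed.

Lemma cmc_dN_anti z v : D z -> dirq N z v * N z = - (N z * dirq N z v).
Proof.
move=> Dz; apply/eqP; rewrite -addr_eq0 -(dirqM v Dz sN sN).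
rewrite (dirq_ext (w := fun=> -1) v oD Dz) ?dirq_cst //; exact: cmc_NN HC.
Qed.

Lemma gauG_half z v : D z -> G v z + G v z = dirq f z v + dirq N z v.
Proof. by move=> Dz; rewrite /gauG quat_half_add (dirqD v Dz sf sN). Qed.

Lemma cmc_dN z v : D z -> dirq N z v = G v z + G v z - dirq f z v.
Proof. by move=> Dz; rewrite gauG_half // addrC addKr. Qed.

Lemma gauG_N z v : D z -> G v z * N z = - (N z * G v z).
Proof.
move=> Dz; apply/eqP; rewrite -subr_eq0 opprK; apply/eqP/quat_addrr_eq0.
have -> : G v z * N z + N z * G v z + (G v z * N z + N z * G v z)
    = (G v z + G v z) * N z + N z * (G v z + G v z) by ncring I.
by rewrite gauG_half //; ncring (cmc_PN v Dz, cmc_dN_anti v Dz).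
Qed.

Lemma cmc_dNJ z v : D z -> dirq N z (Jp v)
  = - (N z * dirq N z v) - N z * dirq f z v - N z * dirq f z v.
Proof.
move=> Dz; have e : dirq f z v + dirq f z v = - dirq N z v + N z * dirq N z (Jp v).
  by rewrite {1 2}(cmc_eq HC) // -opprD quat_half_add opprB addrC.
have -> : - (N z * dirq N z v) - N z * dirq f z v - N z * dirq f z v
    = - (N z * dirq N z v) - N z * (dirq f z v + dirq f z v) by ncring I.
by rewrite e; ncring (cmc_NN HC Dz).
Qed.

(** The CMC equation reads *dN = - N dN - 2 N df; adding *df = N df gives *dg = - N dg, so that the
    parallel surface is conformal with left normal - N. *)
Lemma gauG_J z v : D z -> G (Jp v) z = - (N z * G v z).
Proof.
move=> Dz; apply/eqP; rewrite -subr_eq0 opprK; apply/eqP/quat_addrr_eq0.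
have -> : G (Jp v) z + N z * G v z + (G (Jp v) z + N z * G v z)
    = (G (Jp v) z + G (Jp v) z) + N z * (G v z + G v z) by ncring I.
by rewrite !gauG_half // cmc_dNJ // (cmc_fJ HC) //; ncring I.
Qed.

Lemma smoothq_gauG v : smoothq D (G v).
Proof.
apply: smoothqM => //; first exact: smoothq_cst.
by apply: smoothq_dirq; exact: smoothqD.
Qed.

(* Replacing f by its parallel surface f + N and N by -N exchanges the roles of
   df and d(f + N). *)
Lemma gauged_parallel alpha c b : smoothq D alpha ->
  (forall z v, D z -> dirq alpha z v
     = - (2^-1 * dirq f z v * (N z * alpha z * c + alpha z * b))) ->
  (forall z, D z -> alpha z != 0) -> c != 0 -> b * c = c * b ->
  c * c + b * b = - (c + c) ->
  gauged D (fun z => - N z) alpha (fun v z => 2^-1 * dirq f z v)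
    (fun v z => G v z + G v z) c b.
Proof.
move=> sa da a0 c0 bc ccbb; split=> //.
- exact: smoothqN.
- by move=> z Dz; rewrite mulrNN (cmc_NN HC).
- by move=> z v Dz; rewrite (dirqN v Dz sN) cmc_dN // opprB; congr (_ - _);
    rewrite quat_half_add.
- move=> z v Dz; rewrite mulrN -mulrA cmc_PN // mulrN opprK mulNr mulrA.
  by rewrite (quat_halfC (N z)) -mulrA opprK.
- by move=> z v Dz; rewrite da // mulNr -!mulrN; congr (_ * _); ncring I.
Qed.

End CmcPlaneTheory.

Record darboux_plane (D : set plane) (f N nu beta : plane -> H) (c b : H) : Prop :=
 DarbouxPlane {
  darboux_cmc : cmc_plane D f N;
  darboux_smooth_nu : smoothq D nu;
  darboux_smooth_beta : smoothq D beta;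
  darboux_dnu : forall z v, D z -> dirq nu z v = - (dirq f z v * beta z);
  darboux_dbeta : forall z v, D z ->
    dirq beta z v = gauG f N v z * (N z * beta z * c - beta z * b);
  darboux_nu0 : forall z, D z -> nu z != 0;
  darboux_beta0 : forall z, D z -> beta z != 0;
  darboux_c0 : c != 0;
  darboux_bc : b * c = c * b;
  darboux_ccbb : c * c + b * b = - (c + c) }.

Section DarbouxPlaneTheory.
Variables (D : set plane) (f N nu beta : plane -> H) (c b : H).
Hypothesis HD : darboux_plane D f N nu beta c b.
Let HC := darboux_cmc HD.
Let oD : open D := cmc_open HC.
Let sf : smoothq D f := cmc_smoothf HC.
Let sN : smoothq D N := cmc_smoothN HC.
Let snu : smoothq D nu := darboux_smooth_nu HD.
Let sbeta : smoothq D beta := darboux_smooth_beta HD.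
Let nu0 := darboux_nu0 HD.
Let beta0 := darboux_beta0 HD.

Lemma darboux_gauged : gauged D N beta (gauG f N) (fun v z => dirq f z v) c b.
Proof.
split=> //; [exact: cmc_NN HC|exact: cmc_dN HC|exact: gauG_N HC|
  exact: darboux_dbeta HD|exact: darboux_c0 HD|exact: darboux_bc HD|
  exact: darboux_ccbb HD].
Qed.
Let HG := darboux_gauged.

Local Notation T := (darT nu beta).
Local Notation fh := (darf f nu beta).
Local Notation Nh := (darN N nu beta).
Local Notation Hh := (darH N nu beta c b).
Local Notation r := (grho N beta c b).
Local Notation E := (gE beta c b).
Local Notation Rh := (gR N beta c b).
Local Notation tau := (gtau N beta (fun v z => dirq f z v) c b).
Local Notation G := (gauG f N).

Lemma darT_neq0 z : D z -> T z != 0.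
Proof.
by move=> Dz; rewrite quat_mulf_eq0 negb_or nu0 // quat_invr_neq0 // beta0.
Qed.

Lemma smoothq_darT : smoothq D T.
Proof. by apply: smoothqM => //; exact: smoothqV. Qed.

Lemma smoothq_darTV : smoothq D (fun z => (T z)^-1).
Proof. by apply: smoothqV => //; [exact: darT_neq0|exact: smoothq_darT]. Qed.

Lemma smoothq_darf : smoothq D fh.
Proof. by apply: smoothqD => //; exact: smoothq_darT. Qed.

Lemma smoothq_darN : smoothq D Nh.
Proof.
apply: smoothqN => //; apply: smoothqM => //; last exact: smoothq_darTV.
by apply: smoothqM => //; exact: smoothq_darT.
Qed.

Lemma smoothq_gEN : smoothq D (fun z => E z - N z).
Proof. by apply: smoothqB => //; exact: smoothq_gconj HG _. Qed.

Lemma smoothq_darH : smoothq D Hh.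
Proof. by apply: smoothqM => //; [exact: smoothq_gEN|exact: smoothq_darTV]. Qed.

Lemma darT_mulfV z : D z -> T z * (T z)^-1 = 1.
Proof. by move=> Dz; exact: quat_mulfV (darT_neq0 Dz). Qed.

Lemma darT_mulVf z : D z -> (T z)^-1 * T z = 1.
Proof. by move=> Dz; exact: quat_mulVf (darT_neq0 Dz). Qed.

Lemma dirq_darT z v : D z -> dirq T z v = - dirq f z v - T z * G v z * r z.
Proof.
move=> Dz; rewrite (dirqM v Dz snu (smoothqV oD beta0 sbeta)).
rewrite (dirqV v oD Dz beta0 sbeta) (darboux_dnu HD) // (dbetaE HG) // /darT.
by ncring (gauged_mulfV HG Dz, gauged_mulVf HG Dz).
Qed.

Lemma dirq_darf z v : D z -> dirq fh z v = - (T z * G v z * r z).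
Proof.
by move=> Dz; rewrite (dirqD v Dz sf smoothq_darT) dirq_darT // addrA subrr sub0r.
Qed.

Lemma dirq_darTV z v : D z ->
  dirq (fun y => (T y)^-1) z v = (T z)^-1 * dirq f z v * (T z)^-1 + G v z * r z * (T z)^-1.
Proof.
move=> Dz; rewrite (dirqV v oD Dz darT_neq0 smoothq_darT) dirq_darT //.
by ncring (darT_mulfV Dz, darT_mulVf Dz).
Qed.

Lemma darN_sqr z : D z -> Nh z * Nh z = -1.
Proof.
by move=> Dz; rewrite /darN; ncring (darT_mulfV Dz, darT_mulVf Dz, cmc_NN HC Dz).
Qed.

Lemma darf_left z v : D z -> dirq fh z (Jp v) = Nh z * dirq fh z v.
Proof.
move=> Dz; rewrite !dirq_darf // (gauG_J HC) // /darN.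
by ncring (darT_mulVf Dz).
Qed.

Lemma darf_right z v : D z -> dirq fh z (Jp v) = - (dirq fh z v * Rh z).
Proof.
move=> Dz; rewrite !dirq_darf // (gauG_J HC) //.
by ncring (grho_gR HG Dz, gauG_N HC v Dz).
Qed.

Lemma darf_zero z v : D z -> dirq fh z v = 0 -> G v z = 0.
Proof.
move=> Dz; rewrite dirq_darf // => /eqP; rewrite oppr_eq0 quat_mulf_eq0.
by rewrite (negPf (grho_neq0 HG Dz)) orbF quat_mulf_eq0 (negPf (darT_neq0 Dz)) => /eqP.
Qed.

Lemma darH_left z : D z -> Hh z * Nh z = Rh z * Hh z.
Proof.
move=> Dz; rewrite /darH /darN (gE_E N beta c b z).
by ncring (darT_mulVf Dz, gR_grhoV HG Dz, gR_sqr HG Dz, cmc_NN HC Dz).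
Qed.

Lemma darH_darf z v : D z ->
  Hh z * dirq fh z v = - ((E z - N z) * G v z * r z).
Proof.
by move=> Dz; rewrite dirq_darf // /darH; ncring (darT_mulVf Dz).
Qed.

Lemma gR_minus_darf z v : D z ->
  dirq Rh z v - Rh z * dirq Rh z (Jp v) = Hh z * dirq fh z v + Hh z * dirq fh z v.
Proof.
move=> Dz; rewrite (gR_minus HG Dz (gauG_J HC v Dz) (cmc_fJ HC v Dz)) darH_darf //.
by ncring I.
Qed.

Lemma gR_plus_tau z v : D z ->
  dirq Rh z v + Rh z * dirq Rh z (Jp v) = - (tau v z + tau v z + tau v z + tau v z).
Proof.
by move=> Dz; rewrite (gR_plus HG Dz (gauG_J HC v Dz) (cmc_fJ HC v Dz)).
Qed.

Lemma dirq_darN z v : D z -> dirq Nh z v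
  = - (dirq T z v * N z * (T z)^-1 + T z * dirq N z v * (T z)^-1
       + T z * N z * dirq (fun y => (T y)^-1) z v).
Proof.
move=> Dz; have sTN := smoothqM oD smoothq_darT sN.
rewrite (dirqN v Dz (smoothqM oD sTN smoothq_darTV)).
rewrite (dirqM v Dz sTN smoothq_darTV) (dirqM v Dz smoothq_darT sN).
by ncring I.
Qed.

Lemma darN_minus z v : D z -> dirq Nh z v - Nh z * dirq Nh z (Jp v)
  = dirq fh z v * Hh z + dirq fh z v * Hh z.
Proof.
move=> Dz; rewrite !dirq_darN // !dirq_darTV // !dirq_darT // dirq_darf //.
rewrite !(cmc_dN HC) // (gauG_J HC) // (cmc_fJ HC) // /darN /darH (gE_E N beta c b z).
by ncring (darT_mulVf Dz, darT_mulfV Dz, gR_grhoV HG Dz, grho_gR HG Dz,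
  grho_mulfV HG Dz, grho_mulVf HG Dz, gauG_N HC v Dz, cmc_PN HC v Dz, cmc_NN HC Dz).
Qed.

Lemma dirq_darH z v : D z -> dirq Hh z v
  = (G v z * r z * E z - E z * G v z * r z - dirq N z v) * (T z)^-1
    + (E z - N z) * dirq (fun y => (T y)^-1) z v.
Proof.
move=> Dz; have sE : smoothq D E := smoothq_gconj HG _.
rewrite (dirqM v Dz smoothq_gEN smoothq_darTV) (dirqB v oD Dz sE sN).
by rewrite (dirq_gconj HG).
Qed.

Lemma darH_J z v : D z -> dirq Hh z (Jp v) = dirq Hh z v * Nh z.
Proof.
move=> Dz; rewrite !dirq_darH // !dirq_darTV //.
rewrite !(cmc_dN HC) // (gauG_J HC) // (cmc_fJ HC) // /darN (gE_E N beta c b z).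
by ncring (darT_mulVf Dz, darT_mulfV Dz, gR_grhoV HG Dz, grho_gR HG Dz,
  grho_mulfV HG Dz, grho_mulVf HG Dz, gauG_N HC v Dz, cmc_PN HC v Dz, cmc_NN HC Dz,
  gR_sqr HG Dz).
Qed.

End DarbouxPlaneTheory.

End DarbouxTransform.

(** * Closed forms, harmonicity of the right normal, and the relations behind the Willmore
    condition *)

Section DarbouxPlaneForms.
Variable R : realType.
Local Notation plane := (R * R)%type.
Local Notation H := (quat R).

Lemma realqD (a b : R) : realq (a + b) = realq a + realq b.
Proof. by apply: quat_eqP; rewrite !quatE /= ?addr0. Qed.

Lemma Jp_e1 : Jp (e1 R) = e2 R.
Proof. by rewrite /Jp /= oppr0. Qed.

Lemma JpJp (v : plane) : Jp (Jp v) = -1 *: v + 0.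
Proof.
rewrite addr0; case: v => x y; apply: injective_projections => /=.
  by rewrite [_ *: _]mulN1r.
by rewrite [_ *: _]mulN1r.
Qed.

Lemma dirq_JpJp (D : set plane) u z v : D z -> smoothq D u ->
  dirq u z (Jp (Jp v)) = - dirq u z v.
Proof.
move=> Dz su; rewrite JpJp (dirq_lin _ _ _ Dz su).
have -> : dirq u z 0 = 0 by rewrite /dirq !derive0.
have -> : realq (-1 : R) = -1 by apply: quat_eqP; rewrite ?qreN ?qim1N ?qim2N ?qim3N /= ?oppr0.
by rewrite addr0 mulN1r.
Qed.

(** The last hypothesis is the closedness of dR + R *dR in coordinates, with Q = R; a prime marks a
    value at J J v, which is minus the value at v. The mixed derivatives cancel, leaving R lap R = -
    R_x^2 - R_y^2, which is then multiplied by - R. *)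
Lemma harmonic_algebra (Q R1 R2 R1' R11 R11' R12 R21 R22 S : H) :
  Q * Q = -1 -> R1 * Q = - (Q * R1) -> R2 * Q = - (Q * R2) ->
  S = - (R1 * R1) - R2 * R2 -> R1' = - R1 -> R11' = - R11 -> R12 = R21 ->
  R12 + (R1 * R1' + Q * R11') = R21 + (R2 * R2 + Q * R22) ->
  - (R11' - R22) + S * Q = 0.
Proof.
move=> QQ a1 a2 -> -> -> -> e.
have e' : Q * (R11 + R22) = - (R1 * R1) - R2 * R2.
  apply/eqP; rewrite -subr_eq0; apply/eqP; move/eqP: e; rewrite -subr_eq0 => /eqP e.
  have -> : Q * (R11 + R22) - (- (R1 * R1) - R2 * R2)
    = - (R21 + (R1 * - R1 + Q * - R11) - (R21 + (R2 * R2 + Q * R22))) by ncring I.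
  by rewrite e oppr0.
have e2 : R11 + R22 = Q * (R1 * R1) + Q * (R2 * R2).
  have -> : R11 + R22 = - (Q * (Q * (R11 + R22))) by ncring QQ.
  by rewrite e'; ncring I.
have -> : - (- R11 - R22) = R11 + R22 by ncring I.
by rewrite e2; ncring (a1, a2).
Qed.

Local Opaque dirq gR darf darN darH grho.

Variables (D : set plane) (f N nu beta : plane -> H) (c b : H).
Hypothesis HD : darboux_plane D f N nu beta c b.
Let HC := darboux_cmc HD.
Let HG := darboux_gauged HD.
Let oD : open D := cmc_open HC.
Local Notation fh := (darf f nu beta).
Local Notation Nh := (darN N nu beta).
Local Notation Hh := (darH N nu beta c b).
Local Notation Rh := (gR N beta c b).
Let sR : smoothq D Rh := smoothq_gR HG.
Let sH : smoothq D Hh := smoothq_darH HD.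
Let sfh : smoothq D fh := smoothq_darf HD.

Definition darq (z v : plane) : H := dirq Rh z v + Rh z * dirq Rh z (Jp v).

Lemma smoothq_darq v : smoothq D (fun z => darq z v).
Proof.
apply: smoothqD => //; first exact: smoothq_dirq.
by apply: smoothqM => //; exact: smoothq_dirq.
Qed.

Lemma dirq_darq z x w : D z -> dirq (fun y => darq y x) z w
  = dirq (fun y => dirq Rh y x) z w
    + (dirq Rh z w * dirq Rh z (Jp x) + Rh z * dirq (fun y => dirq Rh y (Jp x)) z w).
Proof.
move=> Dz; have s1 v : smoothq D (fun y => dirq Rh y v) by exact: smoothq_dirq.
apply: (etrans (dirqD w Dz (s1 x) (smoothqM oD sR (s1 (Jp x))))).
by congr (_ + _); exact: (dirqM w Dz sR (s1 (Jp x))).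
Qed.

(* q = dR + R *dR = 2 dR - 2 H df, and dH /\ df = 0 because *dH = dH N. *)
Lemma darq_closed z v : D z ->
  dirq (fun y => darq y (Jp v)) z v = dirq (fun y => darq y v) z (Jp v).
Proof.
move=> Dz.
have qE x y : D y -> darq y x = dirq Rh y x + dirq Rh y x
    - (Hh y * dirq fh y x + Hh y * dirq fh y x).
  move=> Dy; rewrite -(gR_minus_darf HD x Dy) /darq; ncring I.
have s1 x : smoothq D (fun y => dirq Rh y x) by exact: smoothq_dirq.
have s2 x : smoothq D (fun y => dirq fh y x) by exact: smoothq_dirq.
have s3 x : smoothq D (fun y => Hh y * dirq fh y x) by exact: smoothqM.
have L x w : dirq (fun y => darq y x) z w
    = dirq (fun y => dirq Rh y x) z w + dirq (fun y => dirq Rh y x) z w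
      - ((dirq Hh z w * dirq fh z x + Hh z * dirq (fun y => dirq fh y x) z w)
       + (dirq Hh z w * dirq fh z x + Hh z * dirq (fun y => dirq fh y x) z w)).
  apply: (etrans (dirq_ext w oD Dz (qE x))).
  apply: (etrans (dirqB w oD Dz (smoothqD oD (s1 x) (s1 x)) (smoothqD oD (s3 x) (s3 x)))).
  congr (_ - _); first exact: (dirqD w Dz (s1 x) (s1 x)).
  apply: (etrans (dirqD w Dz (s3 x) (s3 x))).
  by congr (_ + _); exact: (dirqM w Dz sH (s2 x)).
have c1 := dirqC (Jp v) v oD Dz sR; have c2 := dirqC (Jp v) v oD Dz sfh.
have hJ := darH_J HD v Dz; have fJ := darf_left HD v Dz.
apply: (etrans (L (Jp v) v)); apply: (etrans _ (esym (L v (Jp v)))).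
by ncring (c1, c2, hJ, fJ).
Qed.

Lemma gR_harmonic z v : D z ->
  - (dirq (fun y => dirq Rh y (Jp (Jp v))) z v
     - dirq (fun y => dirq Rh y (Jp v)) z (Jp v))
  + realq (sqnq (dirq Rh z v) + sqnq (dirq Rh z (Jp v))) * Rh z = 0.
Proof.
move=> Dz; have s1 x : smoothq D (fun y => dirq Rh y x) by exact: smoothq_dirq.
have JJ y : D y -> dirq Rh y (Jp (Jp v)) = - dirq Rh y v.
  by move=> Dy; exact: dirq_JpJp Dy sR.
have dJJ : dirq (fun y => dirq Rh y (Jp (Jp v))) z v = - dirq (fun y => dirq Rh y v) z v.
  by apply: (etrans (dirq_ext v oD Dz JJ)); exact: (dirqN v Dz (s1 v)).
have e := etrans (esym (dirq_darq (Jp v) v Dz))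
  (etrans (darq_closed v Dz) (dirq_darq v (Jp v) Dz)).
have c1 := dirqC (Jp v) v oD Dz sR.
have RR := gR_sqr HG Dz.
have anti x : dirq Rh z x * Rh z = - (Rh z * dirq Rh z x).
  apply/eqP; rewrite -addr_eq0 -(dirqM x Dz sR sR); apply/eqP.
  apply: (etrans (dirq_ext (w := fun=> -1) x oD Dz _)); last exact: dirq_cst.
  by move=> y Dy; exact: (gR_sqr HG Dy).
(* dR anticommutes with R, so it is imaginary and its square is minus its squared norm. *)
have sq x : realq (sqnq (dirq Rh z x)) = - (dirq Rh z x * dirq Rh z x).
  have im : imaginary (dirq Rh z x).
    by apply: (anticommute_imaginary RR); rewrite anti opprK.
  by apply: quat_eqP; rewrite !quatE im /sqnq /realq /= ?im; ring.
have sq2 : realq (sqnq (dirq Rh z v) + sqnq (dirq Rh z (Jp v)))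
    = - (dirq Rh z v * dirq Rh z v) - dirq Rh z (Jp v) * dirq Rh z (Jp v).
  by apply: (etrans (realqD _ _)); ncring (sq v, sq (Jp v)).
exact: (harmonic_algebra RR (anti v) (anti (Jp v)) sq2 (JJ z Dz) dJJ c1 e).
Qed.

(** *q = - R q and *d fh = - d fh R give d fh /\ q = 0, hence d(fh q) = fh dq, which vanishes. *)
Lemma darf_darq_closed z v : D z ->
  dirq (fun y => fh y * darq y (Jp v)) z v
  = dirq (fun y => fh y * darq y v) z (Jp v).
Proof.
move=> Dz.
apply: (etrans (dirqM v Dz sfh (smoothq_darq (Jp v)))).
apply: (etrans _ (esym (dirqM (Jp v) Dz sfh (smoothq_darq v)))).
have h : dirq fh z v * darq z (Jp v) = dirq fh z (Jp v) * darq z v.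
  rewrite /darq; have h1 := darf_right HD v Dz; have h2 := dirq_JpJp v Dz sR.
  by ncring (h1, h2, gR_sqr HG Dz).
by ncring (h, darq_closed v Dz).
Qed.

(* The remaining identities are stated for X = v and X' = J v. *)
Section Willmore.
Variables (z v : plane).
Hypothesis Dz : D z.
Let F := dirq fh z v.
Let F' := dirq fh z (Jp v).
Let dN := dirq Nh z v.
Let dN' := dirq Nh z (Jp v).
Let dH := dirq Hh z v.
Let dH' := dirq Hh z (Jp v).
Let dR := dirq Rh z v.
Let dR' := dirq Rh z (Jp v).
Let t := gtau N beta (fun v z => dirq f z v) c b v z.

(** A rewriting system for the matrix computations: primed values are eliminated in favour of values
    at v, and H F in favour of dR and tau. The last relation is the derivative of H N = R H combined
    with *dH = dH N. *)
Lemma willmore_relations :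
  [/\ F * Rh z = - (Nh z * F), F' = Nh z * F, Nh z * Nh z = -1, Rh z * Rh z = -1
    & Hh z * Nh z = Rh z * Hh z]
  /\ [/\ dN' = - (Nh z * dN) + Nh z * F * Hh z + Nh z * F * Hh z,
         dR' = Rh z * dR + Rh z * t + Rh z * t + Rh z * t + Rh z * t,
         Hh z * F = dR + t + t,
         dR * Rh z = - (Rh z * dR)
       & dH' = dR * Hh z + Rh z * dH - Hh z * dN].
Proof.
have NN := darN_sqr HD Dz; have RR := gR_sqr HG Dz.
have FJ := darf_left HD v Dz; have FR := darf_right HD v Dz.
have HN := darH_left HD Dz; have HJ := darH_J HD v Dz.
have Np := darN_minus HD v Dz; have Rp := gR_plus_tau HD v Dz.
have Rm := gR_minus_darf HD v Dz.
rewrite -/F -/F' -/dN -/dN' -/dH -/dH' -/dR -/dR' -/t in FJ FR HJ Np Rp Rm.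
have eR : dR' = Rh z * dR + Rh z * t + Rh z * t + Rh z * t + Rh z * t.
  have -> : dR' = - (Rh z * ((dR + Rh z * dR') - dR)) by ncring RR.
  by rewrite Rp; ncring I.
split; split=> //.
- by rewrite -FJ FR opprK.
- have -> : dN' = Nh z * ((dN - Nh z * dN') - dN) by ncring NN.
  by rewrite Np; ncring I.
- apply/eqP; rewrite -subr_eq0; apply/eqP/quat_addrr_eq0.
  have -> : Hh z * F - (dR + t + t) + (Hh z * F - (dR + t + t))
    = (Hh z * F + Hh z * F) - (dR + t + t) - (dR + t + t) by ncring I.
  by rewrite -Rm eR; ncring RR.
- apply/eqP; rewrite -addr_eq0 -(dirqM v Dz sR sR).
  by rewrite (dirq_ext (w := fun=> -1) v oD Dz) ?dirq_cst //; exact: gR_sqr HG.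
- have sN := smoothq_darN HD.
  have e : dH * Nh z + Hh z * dN = dR * Hh z + Rh z * dH.
    rewrite -(dirqM v Dz sH sN) -(dirqM v Dz sR sH).
    by apply: (dirq_ext v oD Dz) => y Dy; exact: (darH_left HD Dy).
  by rewrite HJ -e addrK.
Qed.

End Willmore.
End DarbouxPlaneForms.

(** * Conformal Gauss maps *)

Section GaussMapMatrices.
Variable R : realType.
Local Notation plane := (R * R)%type.
Local Notation H := (quat R).
Implicit Types (x y : H).

Lemma ord2P (P : 'I_2 -> Prop) : P 0 -> P 1 -> forall i, P i.
Proof.
move=> P0 P1 i; have [->//|->//] : i = 0 \/ i = 1.
by case: i => [[|[|//]] Hi]; [left|right]; apply: val_inj.
Qed.

Lemma mulmx2 n m (A : 'M[H]_(n, 2)) (B : 'M[H]_(2, m)) i j :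
  (A *m B) i j = A i 0 * B 0 j + A i 1 * B 1 j.
Proof.
rewrite mxE big_ord_recl big_ord1; congr (_ + A i _ * B _ j); exact: val_inj.
Qed.

Lemma psiE x i j : psi x i j = if i == 0 then x else 1.
Proof. by rewrite mxE. Qed.

Lemma line_psi x (w : 'cV[H]_2) : w 0 0 = x * w 1 0 -> line (psi x) w.
Proof.
move=> e; exists (w 1 0) => //; apply/matrixP => i j; rewrite ord1 !mxE.
by move: i; apply: ord2P; rewrite //= ?e ?mul1r.
Qed.

Lemma quat_quarter4 : (4^-1 : H) + 4^-1 + 4^-1 + 4^-1 = 1.
Proof.
have E4 : (4 : H) = 1 + 1 + 1 + 1 by rewrite (natrD _ 2 2) (natrD _ 1 1) addrA.
have q1 : qre (1 : H) = 1 by []; have q0 : qre (0 : H) = 0 by [].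
have u : (4 : H) != 0.
  apply/eqP; rewrite E4 => e; have := congr1 (@qre R) e; rewrite !quatE q1 q0; lra.
have e := quat_mulfV u; rewrite {1}E4 !mulrDl !mul1r in e; exact: e.
Qed.

Lemma quat_quarterC x : x * 4^-1 = 4^-1 * x.
Proof.
have := quat_quarter4; move: (4^-1 : H) => k e.
have c (a : H) : k * (a + a + a + a) = a.
  have -> : k * (a + a + a + a) = (k + k + k + k) * a by ncring I.
  by rewrite e mul1r.
have h : x * k + x * k + x * k + x * k = x.
  have -> : x * k + x * k + x * k + x * k = x * (k + k + k + k) by ncring I.
  by rewrite e mulr1.
by rewrite -[LHS]c h.
Qed.

Lemma scale_mulmx2E (a : H) (A B C : 'M[H]_2) i j :
  (a *: (A *m B + C)) i j = a * (A i 0 * B 0 j + A i 1 * B 1 j + C i j).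
Proof. by rewrite 2!mxE mulmx2. Qed.

Section Formulas.
Variables (X : Type) (h n k r : X -> H).
(* gaussS is the conjugate of (n 0; -k -r) by (1 h; 0 1), and gausseta is the
   rank one matrix (h; 1) (r t k / 2) (1, -h). *)
Definition gaussS (p : X) : 'M[H]_2 := \matrix_(i, j)
  if i == 0 then
    if j == 0 then n p - h p * k p else - ((n p - h p * k p) * h p) - h p * r p
  else if j == 0 then - k p else k p * h p - r p.
Definition gausseta (t : X -> H) (p : X) : 'M[H]_2 := \matrix_(i, j)
  ((if i == 0 then h p else 1)
   * (4^-1 * (r p * t p * k p + r p * t p * k p))
   * (if j == 0 then 1 else - h p)).
End Formulas.

Lemma gaussSE (X : Type) (h n k r : X -> H) (p : X) :
  [/\ gaussS h n k r p 0 0 = n p - h p * k p,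
      gaussS h n k r p 0 1 = - ((n p - h p * k p) * h p) - h p * r p,
      gaussS h n k r p 1 0 = - k p
    & gaussS h n k r p 1 1 = k p * h p - r p].
Proof. by split; rewrite mxE. Qed.

Lemma gaussetaE (X : Type) (h k r t : X -> H) (p : X) :
  let y := 4^-1 * (r p * t p * k p + r p * t p * k p) in
  [/\ gausseta h k r t p 0 0 = h p * y, gausseta h k r t p 0 1 = - (h p * y * h p),
      gausseta h k r t p 1 0 = y & gausseta h k r t p 1 1 = - (y * h p)].
Proof. by split; rewrite mxE /= ?mulr1 ?mul1r ?mulrN. Qed.

Section Pointwise.
Variables (X : Type) (h n k r t : X -> H) (p : X).
Hypotheses (nn : n p * n p = -1) (rr : r p * r p = -1) (kn : k p * n p = r p * k p).
Local Notation S := (gaussS h n k r).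
Local Notation eta := (gausseta h k r).

Lemma gaussS_sqr : S p *m S p = - 1%:M.
Proof.
apply/matrixP => i j; rewrite mulmx2 !mxE.
by move: i j; apply: ord2P; apply: ord2P; rewrite /= ?mulr1n ?mulr0n;
  ncring (nn, rr, kn).
Qed.

Lemma gaussS_psi : S p *m psi (h p) = - rscale (psi (h p)) (r p).
Proof.
apply/matrixP => i j; rewrite mulmx2 !mxE.
by move: i; apply: ord2P; rewrite /=; ncring I.
Qed.

Lemma gausseta_psi : eta t p *m psi (h p) = 0.
Proof.
apply/matrixP => i j; rewrite mulmx2 !mxE.
by move: i; apply: ord2P; rewrite /=; ncring I.
Qed.

Lemma gausseta_line w : line (psi (h p)) (eta t p *m w).
Proof.
by apply: line_psi; rewrite !mulmx2 !mxE /=; ncring I.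
Qed.

Lemma gausseta_left t' : t' p = - (r p * t p) -> eta t' p = S p *m eta t p.
Proof.
move=> e; apply/matrixP => i j; rewrite mulmx2 !mxE e.
by move: i j; apply: ord2P; apply: ord2P; rewrite /=;
  ncring (nn, rr, kn, quat_quarterC (h p), quat_quarterC (r p),
          quat_quarterC (k p), quat_quarterC (n p)).
Qed.

Lemma gausseta_right t' : t' p = - (r p * t p) -> t p * r p = - (r p * t p) ->
  eta t' p = eta t p *m S p.
Proof.
move=> e tr; apply/matrixP => i j; rewrite mulmx2 !mxE e.
by move: i j; apply: ord2P; apply: ord2P; rewrite /=;
  ncring (nn, rr, kn, tr, quat_quarterC (h p), quat_quarterC (r p),
          quat_quarterC (k p), quat_quarterC (n p)).
Qed.

End Pointwise.

Section Plane.
Variables (D : set plane) (f N nu beta : plane -> H) (c b : H).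
Hypothesis HD : darboux_plane D f N nu beta c b.
Let HC := darboux_cmc HD.
Let HG := darboux_gauged HD.
Let oD : open D := cmc_open HC.
Local Notation fh := (darf f nu beta).
Local Notation Nh := (darN N nu beta).
Local Notation Hh := (darH N nu beta c b).
Local Notation Rh := (gR N beta c b).
Local Notation S := (gaussS fh Nh Hh Rh).
Local Notation tau := (gtau N beta (fun v z => dirq f z v) c b).
Let sR : smoothq D Rh := smoothq_gR HG.
Let sH : smoothq D Hh := smoothq_darH HD.
Let sN : smoothq D Nh := smoothq_darN HD.
Let sf : smoothq D fh := smoothq_darf HD.

Lemma smoothm_entry (F : plane -> 'M[H]_2) :
  smoothq D (fun z => F z 0 0) -> smoothq D (fun z => F z 0 1) ->
  smoothq D (fun z => F z 1 0) -> smoothq D (fun z => F z 1 1) -> smoothm D F.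
Proof. by move=> *; apply: ord2P; apply: ord2P. Qed.

Let s1 : smoothq D (fun z => Nh z - fh z * Hh z).
Proof. by apply: smoothqB => //; exact: smoothqM. Qed.
Let s2 : smoothq D (fun z => - ((Nh z - fh z * Hh z) * fh z)).
Proof. by apply: smoothqN => //; exact: smoothqM. Qed.
Let s3 : smoothq D (fun z => fh z * Rh z).
Proof. exact: smoothqM. Qed.
Let s4 : smoothq D (fun z => Hh z * fh z).
Proof. exact: smoothqM. Qed.

Let S00 : (fun z => S z 0 0) = (fun z => Nh z - fh z * Hh z).
Proof. by apply/funext => z; rewrite mxE. Qed.
Let S01 : (fun z => S z 0 1) = (fun z => - ((Nh z - fh z * Hh z) * fh z) - fh z * Rh z).
Proof. by apply/funext => z; rewrite mxE. Qed.
Let S10 : (fun z => S z 1 0) = (fun z => - Hh z).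
Proof. by apply/funext => z; rewrite mxE. Qed.
Let S11 : (fun z => S z 1 1) = (fun z => Hh z * fh z - Rh z).
Proof. by apply/funext => z; rewrite mxE. Qed.

Lemma smoothm_gaussS : smoothm D S.
Proof.
apply: smoothm_entry; rewrite ?S00 ?S01 ?S10 ?S11.
- exact: s1.
- exact: smoothqB.
- exact: smoothqN.
- exact: smoothqB.
Qed.

Lemma dirm_gaussS z v : D z ->
  [/\ dirm S z v 0 0 = dirq Nh z v - (dirq fh z v * Hh z + fh z * dirq Hh z v),
      dirm S z v 0 1
      = - ((dirq Nh z v - (dirq fh z v * Hh z + fh z * dirq Hh z v)) * fh z
           + (Nh z - fh z * Hh z) * dirq fh z v)
        - (dirq fh z v * Rh z + fh z * dirq Rh z v),
      dirm S z v 1 0 = - dirq Hh z v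
    & dirm S z v 1 1 = dirq Hh z v * fh z + Hh z * dirq fh z v - dirq Rh z v].
Proof.
move=> Dz; rewrite /dirm !mxE S00 S01 S10 S11.
have e1 : dirq (fun z => Nh z - fh z * Hh z) z v
    = dirq Nh z v - (dirq fh z v * Hh z + fh z * dirq Hh z v).
  apply: (etrans (dirqB v oD Dz sN (smoothqM oD sf sH))).
  by rewrite (dirqM v Dz sf sH).
split=> //.
- apply: (etrans (dirqB v oD Dz s2 s3)); rewrite (dirqM v Dz sf sR).
  rewrite (dirqN v Dz (smoothqM oD s1 sf)); congr (- _ - _).
  by apply: (etrans (dirqM v Dz s1 sf)); rewrite e1.
- exact: (dirqN v Dz sH).
- apply: (etrans (dirqB v oD Dz s4 sR)).
  by rewrite (dirqM v Dz sH sf).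
Qed.

Lemma gaussS_dir_psi z v : D z -> line (psi (fh z)) (dirm S z v *m psi (fh z)).
Proof.
move=> Dz; apply: line_psi; rewrite !mulmx2 !psiE /=.
have [-> -> -> ->] := dirm_gaussS v Dz.
have [[FR _ _ _ _] _] := willmore_relations HD v Dz.
by ncring FR.
Qed.

Definition darA (z v : plane) : 'M[H]_2 :=
  4^-1 *: (S z *m dirm S z v + dirm S z (Jp v)).

Lemma darA_line z v w : D z -> line (psi (fh z)) (darA z v *m w).
Proof.
move=> Dz; apply: line_psi; rewrite !mulmx2.
have H01 j : darA z v 0 j = fh z * darA z v 1 j; last by rewrite !H01; ncring I.
rewrite /darA !scale_mulmx2E; have q := quat_quarterC (fh z).
have [c1 c2 c3 c4] := gaussSE fh Nh Hh Rh z.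
have [a1 a2 a3 a4] := dirm_gaussS v Dz.
have [b1 b2 b3 b4] := dirm_gaussS (Jp v) Dz.
have [[FR FJ NN RR HN] [e1 e2 e3 e4 e5]] := willmore_relations HD v Dz.
move: j; apply: ord2P.
  by ncring (a1, a3, b1, b3, c1, c2, c3, c4, FR, FJ, NN, RR, HN, e1, e2, e3, e4, e5, q).
by ncring (a2, a4, b2, b4, c1, c2, c3, c4, FR, FJ, NN, RR, HN, e1, e2, e3, e4, e5, q).
Qed.

(** 2 tau = H d fh - dR, and both terms anticommute with R: the first because d fh R = - N d fh and
    H N = R H, with N the left normal of fh, the second because R^2 = -1. *)
Lemma gtau_anti z v : D z -> tau v z * Rh z = - (Rh z * tau v z).
Proof.
move=> Dz; have [[FR FJ NN RR HN] [e1 e2 e3 e4 e5]] := willmore_relations HD v Dz.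
apply/eqP; rewrite -subr_eq0 opprK; apply/eqP/quat_addrr_eq0.
have -> : tau v z * Rh z + Rh z * tau v z + (tau v z * Rh z + Rh z * tau v z)
    = (dirq Rh z v + tau v z + tau v z) * Rh z
      + Rh z * (dirq Rh z v + tau v z + tau v z) by ncring e4.
rewrite -e3.
by ncring (FR, HN).
Qed.

(** Both *A and [eta] take values in the line of psi, so the bottom row determines the top one. The
    scalar in [gausseta] is designed to cancel the first entry of that row; the second entry is then
    q / 4. *)
Lemma star_darA z v : D z ->
  let X := darA z (Jp v) + gausseta fh Hh Rh (tau v) z in
  let q := darq N beta c b z v in
  [/\ X 0 0 = 0, X 0 1 = 4^-1 * (fh z * q), X 1 0 = 0 & X 1 1 = 4^-1 * q].
Proof.
move=> Dz X q.
have XE i j : X i j = 4^-1 * (S z i 0 * dirm S z (Jp v) 0 j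
    + S z i 1 * dirm S z (Jp v) 1 j + dirm S z (Jp (Jp v)) i j)
    + gausseta fh Hh Rh (tau v) z i j.
  by rewrite [LHS]mxE scale_mulmx2E.
have [c1 c2 c3 c4] := gaussSE fh Nh Hh Rh z.
have [d1 d2 d3 d4] := gaussetaE fh Hh Rh (tau v) z.
have [a1 a2 a3 a4] := dirm_gaussS (Jp v) Dz.
have J (k l : 'I_2) : dirm S z (Jp (Jp v)) k l = - dirm S z v k l.
  rewrite [LHS]mxE [X in - X]mxE; exact: dirq_JpJp Dz (smoothm_gaussS k l).
have [b1 b2 b3 b4] := dirm_gaussS v Dz.
have [[FR FJ NN RR HN] [e1 e2 e3 e4 e5]] := willmore_relations HD v Dz.
have qE : q = dirq Rh z v + Rh z * dirq Rh z (Jp v) by [].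
have h := quat_quarterC (fh z).
split.
- apply: (etrans (XE 0 0)).
  by ncring (J 0 0, a1, a3, b1, c1, c2, d1, FR, FJ, NN, RR, HN, e1, e2, e3, e4, e5, h).
- apply: (etrans (XE 0 1)).
  by ncring (J 0 1, a2, a4, b2, c1, c2, d2, qE, FR, FJ, NN, RR, HN, e1, e2, e3, e4, e5, h).
- apply: (etrans (XE 1 0)).
  by ncring (J 1 0, a1, a3, b3, c3, c4, d3, FR, FJ, NN, RR, HN, e1, e2, e3, e4, e5, h).
- apply: (etrans (XE 1 1)).
  by ncring (J 1 1, a2, a4, b4, c3, c4, d4, qE, FR, FJ, NN, RR, HN, e1, e2, e3, e4, e5, h).
Qed.

(* The first column of *A + eta vanishes and the second one is (f q, q) / 4. *)
Lemma willmore_closed z v i j : D z ->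
  dirq (fun p : plane =>
    (darA p (Jp (Jp v)) + gausseta fh Hh Rh (tau (Jp v)) p) i j) z v
  = dirq (fun p : plane => (darA p (Jp v) + gausseta fh Hh Rh (tau v) p) i j) z (Jp v).
Proof.
move=> Dz.
have sq q : smoothq D (fun p => darq N beta c b p q) by exact: smoothq_darq HD q.
have q4 : smoothq D (fun=> 4^-1) by exact: smoothq_cst.
have K (u : plane -> plane -> H) (X : plane -> plane -> H) :
    (forall p q, D p -> X q p = 4^-1 * u q p) -> (forall q, smoothq D (u q)) ->
    dirq (u (Jp v)) z v = dirq (u v) z (Jp v) ->
    dirq (X (Jp v)) z v = dirq (X v) z (Jp v).
  move=> XE su e; have L q w : dirq (X q) z w = 4^-1 * dirq (u q) z w.
    apply: (etrans (dirq_ext w oD Dz (fun p Dy => XE p q Dy))).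
    by apply: (etrans (dirqM w Dz q4 (su q))); rewrite dirq_cst mul0r add0r.
  by rewrite (L (Jp v) v) (L v (Jp v)) e.
pose X i j q p := (darA p (Jp q) + gausseta fh Hh Rh (tau q) p) i j.
have Z i' : (forall p q, D p -> X i' 0 q p = 0) ->
    dirq (X i' 0 (Jp v)) z v = dirq (X i' 0 v) z (Jp v).
  move=> X0; apply: (etrans (dirq_ext v oD Dz (fun p Dy => X0 p (Jp v) Dy))).
  apply: (etrans (dirq_cst _ _ _)); apply: esym.
  apply: (etrans (dirq_ext (Jp v) oD Dz (fun p Dy => X0 p v Dy))).
  exact: dirq_cst.
move: i j; apply: ord2P; apply: ord2P.
- by apply: (Z 0) => p q Dy; case: (star_darA q Dy).
- apply: (K (fun q p => fh p * darq N beta c b p q) (X 0 1)).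
  + by move=> p q Dy; case: (star_darA q Dy).
  + by move=> q; exact: smoothqM.
  + exact: (darf_darq_closed HD v Dz).
- by apply: (Z 1) => p q Dy; case: (star_darA q Dy).
- apply: (K (fun q p => darq N beta c b p q) (X 1 1)).
  + by move=> p q Dy; case: (star_darA q Dy).
  + exact: sq.
  + exact: (darq_closed HD v Dz).
Qed.

End Plane.
End GaussMapMatrices.

(** * Umbilics *)

Section UmbilicIsolation.
Variable R : realType.
Local Notation plane := (R * R)%type.
Local Notation H := (quat R).

Lemma qre_mulC (x y : H) : qre (x * y) = qre (y * x).
Proof. by rewrite !qreM; ring. Qed.

Lemma imaginary_square (x : H) : imaginary x -> x * x = - realq (sqnq x).
Proof. by move=> ix; apply: quat_eqP; rewrite !quatE ix /sqnq /realq /= ?ix; ring. Qed.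

(* Gram determinant of the vectors n, u, a in R^3. *)
Lemma gram_identity (n1 n2 n3 u1 u2 u3 p1 p2 p3 a1 a2 a3 : R) :
  n1 * n1 + n2 * n2 + n3 * n3 = 1 -> u1 * n1 + u2 * n2 + u3 * n3 = 0 ->
  p1 * n1 + p2 * n2 + p3 * n3 = 0 ->
  a1 * n1 + a2 * n2 + a3 * n3 = - (u1 * p1 + u2 * p2 + u3 * p3) ->
  let s := u1 * u1 + u2 * u2 + u3 * u3 in
  let A := a1 * a1 + a2 * a2 + a3 * a3 in
  let m1 := p2 * u3 - p3 * u2 + (n2 * a3 - n3 * a2) in
  let m2 := p3 * u1 - p1 * u3 + (n3 * a1 - n1 * a3) in
  let m3 := p1 * u2 - p2 * u1 + (n1 * a2 - n2 * a1) in
  let k := u1 * a1 + u2 * a2 + u3 * a3 in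
  let t := u1 * (n2 * a3 - n3 * a2) + u2 * (n3 * a1 - n1 * a3) + u3 * (n1 * a2 - n2 * a1) in
  s * (2 * A + 2 * (m1 * m1 + m2 * m2 + m3 * m3)) - 4 * (k * k) - 4 * (t * t)
  = 2 * (p1 * p1 + p2 * p2 + p3 * p3) * (s * s).
Proof.
move=> nn un pn an s A m1 m2 m3 k t.
set P := p1 * p1 + p2 * p2 + p3 * p3.
set d := u1 * p1 + u2 * p2 + u3 * p3.
have E1 : m1 * m1 + m2 * m2 + m3 * m3 = P * s - d * d
    + (n1 * n1 + n2 * n2 + n3 * n3) * A
    - (a1 * n1 + a2 * n2 + a3 * n3) * (a1 * n1 + a2 * n2 + a3 * n3)
    + 2 * ((p1 * n1 + p2 * n2 + p3 * n3) * k
           - (p1 * a1 + p2 * a2 + p3 * a3) * (u1 * n1 + u2 * n2 + u3 * n3)).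
  by rewrite /m1 /m2 /m3 /P /s /d /A /k; ring.
have E2 : t * t = (n1 * n1 + n2 * n2 + n3 * n3) * (s * A - k * k)
    - (u1 * n1 + u2 * n2 + u3 * n3)
      * ((u1 * n1 + u2 * n2 + u3 * n3) * A - k * (a1 * n1 + a2 * n2 + a3 * n3))
    + (a1 * n1 + a2 * n2 + a3 * n3)
      * ((u1 * n1 + u2 * n2 + u3 * n3) * k - s * (a1 * n1 + a2 * n2 + a3 * n3)).
  by rewrite /t /s /A /k; ring.
rewrite -/d in an; rewrite E1 E2 nn un pn an; ring.
Qed.

(** Here n = N, p = N_x, q = N_y, u = g_x / 2, a = u_x, and w = - u u = |u|^2; further letters and
    digits record derivatives. Since g_y = - N g_x, equality of mixed derivatives gives u_y = - (N
    u)_x, which expresses all y-derivatives of u by x-derivatives of u and derivatives of N. *)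
Lemma laplacian_algebra (n p u a axx pxx pxy q uy uxy uyy w1 w2 w11 w22 : H) :
  n * n = -1 -> u * n = - (n * u) -> p * n = - (n * p) ->
  pxx * n + p * p + (p * p + n * pxx) = 0 ->
  a * n + u * p = - (p * u + n * a) ->
  imaginary u -> imaginary a -> imaginary p -> imaginary pxy ->
  q = n * p - n * (u + u + u + u) ->
  uy = - (p * u) - n * a ->
  uxy = - (pxx * u) - p * a - p * a - n * axx ->
  uyy = - (pxy * u) - p * uy - q * a - n * uxy ->
  w1 = - (a * u + u * a) -> w2 = - (uy * u + u * uy) ->
  w11 = - (axx * u + a * a + (a * a + u * axx)) ->
  w22 = - (uyy * u + uy * uy + (uy * uy + u * uyy)) ->
  sqnq u * (qre w11 + qre w22) - ((qre w1) ^+ 2 + (qre w2) ^+ 2)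
  = (2 * sqnq p + 8 * qre (u * p)) * sqnq u ^+ 2.
Proof.
move=> nn un pn nxx an iu ia ip ipxy qE uyE uxyE uyyE -> -> -> ->.
have inn := imaginary_sqr nn.
have qN (x : H) : qre (- x) = - qre x by [].
have qD (x y : H) : qre (x + y) = qre x + qre y by [].
have L : u * (axx + uyy) = u * (- pxy + p * p + n * pxx) * u
    + (n * (realq (sqnq u)) * a + n * realq (sqnq u) * a
       + n * realq (sqnq u) * a + n * realq (sqnq u) * a).
  have uu : realq (sqnq u) = - (u * u) by rewrite (imaginary_square iu) opprK.
  rewrite uu uyyE uxyE uyE qE; ncring (nn, un, pn).
have rS (x y : H) (e : R) : qre (x * realq e * y) = e * qre (x * y).
  by rewrite !quatE /realq /=; ring.
have L2 : qre (u * (axx + uyy)) = 4 * sqnq u * qre (n * a).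
  (* Re(u X u) = - |u|^2 Re(X), and X has no real part: [pxy] is imaginary, and [nxx] is the
     derivative of dN N + N dN = 0. *)
  rewrite L qD; have -> : qre (u * (- pxy + p * p + n * pxx) * u) = 0.
    rewrite qre_mulC mulrA (imaginary_square iu) mulNr qN.
    have -> : realq (sqnq u) * (- pxy + p * p + n * pxx)
      = 1 * realq (sqnq u) * (- pxy + p * p + n * pxx) by rewrite mul1r.
    rewrite rS mul1r !qD qN ipxy.
    have := congr1 (@qre R) nxx; rewrite !qD (qre_mulC pxx) => h.
    have q0 : qre (0 : H) = 0 by [].
    have z : qre (p * p) + qre (n * pxx) = 0 by move: h; rewrite q0; lra.
    by rewrite oppr0 add0r z mulr0 oppr0.
  by rewrite !qD !rS; ring.
have L3 : qre (n * a) = - qre (u * p).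
  have := congr1 (@qre R) an; rewrite !qD qN qD (qre_mulC a n) (qre_mulC p u); lra.
have e1 : qre (- (axx * u + a * a + (a * a + u * axx)))
    + qre (- (uyy * u + uy * uy + (uy * uy + u * uyy)))
    = - 2 * qre (u * (axx + uyy)) - 2 * qre (a * a) - 2 * qre (uy * uy).
  rewrite !qN !qD mulrDr qD (qre_mulC axx) (qre_mulC uyy); ring.
have e2 : qre (- (a * u + u * a)) = - 2 * qre (u * a).
  by rewrite qN qD (qre_mulC a); ring.
have e3 : qre (- (uy * u + u * uy)) = - 2 * qre (u * uy).
  by rewrite qN qD (qre_mulC uy); ring.
rewrite e1 e2 e3 L2 L3.
(* The second-order terms have produced 8 Re(u p) |u|^4; the first-order ones are left to the Gram
   identity. *)
suff key : sqnq u * (- 2 * qre (a * a) - 2 * qre (uy * uy))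
    - (4 * (qre (u * a) * qre (u * a)) + 4 * (qre (u * uy) * qre (u * uy)))
    = 2 * sqnq p * (sqnq u * sqnq u).
  move: key; move: (qre (u * p)) (qre (a * a)) (qre (uy * uy)) (qre (u * a))
    (qre (u * uy)) (sqnq u) (sqnq p) => x1 x2 x3 x4 x5 x6 x7 key.
  have -> : (2 * x7 + 8 * x1) * x6 ^+ 2 = 2 * x7 * (x6 * x6) + 8 * x1 * (x6 * x6) by ring.
  by rewrite -key; ring.
have c1 : qim1 n * qim1 n + qim2 n * qim2 n + qim3 n * qim3 n = 1.
  have q1 : qre (1 : H) = 1 by [].
  have := congr1 (@qre R) nn; rewrite qreM qN q1 inn; lra.
have c2 : qim1 u * qim1 n + qim2 u * qim2 n + qim3 u * qim3 n = 0.
  have := congr1 (@qre R) un; rewrite qN !qreM inn iu; lra.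
have c3 : qim1 p * qim1 n + qim2 p * qim2 n + qim3 p * qim3 n = 0.
  have := congr1 (@qre R) pn; rewrite qN !qreM inn ip; lra.
have c4 : qim1 a * qim1 n + qim2 a * qim2 n + qim3 a * qim3 n
    = - (qim1 u * qim1 p + qim2 u * qim2 p + qim3 u * qim3 p).
  move: L3; rewrite !qreM inn iu; lra.
have := gram_identity c1 c2 c3 c4; cbv zeta.
have f0 : qre uy = 0.
  rewrite uyE qD !qN !qreM ip iu inn ia; lra.
have f1 : qim1 uy = - (qim2 p * qim3 u - qim3 p * qim2 u + (qim2 n * qim3 a - qim3 n * qim2 a)).
  by rewrite uyE !quatE ip iu inn ia; ring.
have f2 : qim2 uy = - (qim3 p * qim1 u - qim1 p * qim3 u + (qim3 n * qim1 a - qim1 n * qim3 a)).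
  by rewrite uyE !quatE ip iu inn ia; ring.
have f3 : qim3 uy = - (qim1 p * qim2 u - qim2 p * qim1 u + (qim1 n * qim2 a - qim2 n * qim1 a)).
  by rewrite uyE !quatE ip iu inn ia; ring.
rewrite !qreM f0 f1 f2 f3 ia iu /sqnq iu ip => e.
move: e; rewrite !mulrNN; lra.
Qed.

(** This is 2 |p - 2 g|^2 >= 0. The literal zeros are the real parts of the imaginary quaternions p
    and g. *)
Lemma completed_square_ge (p1 p2 p3 g1 g2 g3 : R) :
  - (8 * (0 ^+ 2 + g1 ^+ 2 + g2 ^+ 2 + g3 ^+ 2))
  <= 2 * (0 ^+ 2 + p1 ^+ 2 + p2 ^+ 2 + p3 ^+ 2)
     + 8 * (0 * 0 - g1 * p1 - g2 * p2 - g3 * p3).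
Proof.
have := sqr_ge0 (p1 - 2 * g1); have := sqr_ge0 (p2 - 2 * g2).
have := sqr_ge0 (p3 - 2 * g3); rewrite !expr2; lra.
Qed.

Local Opaque dirq.

Section Isolation.
Variables (D : set plane) (f N : plane -> H).
Hypothesis HC : cmc_plane D f N.
Let oD : open D := cmc_open HC.
Let sN : smoothq D N := cmc_smoothN HC.
Local Notation G := (gauG f N).

Lemma cmc_dN_imaginary z v : D z -> imaginary (dirq N z v).
Proof.
move=> Dz; apply: (anticommute_imaginary (cmc_NN HC Dz)).
by rewrite (cmc_dN_anti HC) // opprK.
Qed.

Lemma gauG_imaginary z v : D z -> imaginary (G v z).
Proof.
move=> Dz; apply: (anticommute_imaginary (cmc_NN HC Dz)).
by rewrite (gauG_N HC) // opprK.
Qed.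

Lemma dirq_imaginary (u : plane -> H) z v : D z -> (forall y, D y -> imaginary (u y)) ->
  imaginary (dirq u z v).
Proof.
Transparent dirq.
move=> Dz iu; rewrite /imaginary /dirq /=.
have -> : 'D_v (fun x => qre (u x)) z = 'D_v (cst 0) z.
  by apply: near_eq_derive; apply: (near_open oD Dz).
exact: derive_cst.
Opaque dirq.
Qed.

Let sG v : smoothq D (G v) := smoothq_gauG HC v.

Lemma gauG_mixed z v w : D z -> dirq (G v) z w = dirq (G w) z v.
Proof.
move=> Dz; have sg := smoothqD oD (cmc_smoothf HC) sN.
have s1 x : smoothq D (fun y => dirq (fun q => f q + N q) y x) by exact: smoothq_dirq.
have q2 : smoothq D (fun=> 2^-1) by exact: smoothq_cst.
have L x y : dirq (G x) z y = 2^-1 * dirq (fun p => dirq (fun q => f q + N q) p x) z y.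
  by apply: (etrans (dirqM y Dz q2 (s1 x))); rewrite dirq_cst mul0r add0r.
apply: (etrans (L v w)); apply: (etrans _ (esym (L w v))).
exact: (congr1 (fun x => 2^-1 * x) (dirqC v w oD Dz sg)).
Qed.

(** As G is imaginary this is |G|^2, kept as a quaternion so that the quaternionic product rule
    differentiates it. *)
Let W v y := - (G v y * G v y).

Let sW v : smoothq D (W v).
Proof. by apply: smoothqN => //; exact: smoothqM. Qed.

Let dW v z w : D z -> dirq (W v) z w = - (dirq (G v) z w * G v z + G v z * dirq (G v) z w).
Proof.
move=> Dz; apply: (etrans (dirqN w Dz (smoothqM oD (sG v) (sG v)))).
by congr (- _); exact: (dirqM w Dz (sG v) (sG v)).
Qed.

Let ddW v z w : D z -> dirq (fun y => dirq (W v) y w) z w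
  = - (dirq (fun y => dirq (G v) y w) z w * G v z + dirq (G v) z w * dirq (G v) z w
       + (dirq (G v) z w * dirq (G v) z w + G v z * dirq (fun y => dirq (G v) y w) z w)).
Proof.
move=> Dz; have s1 : smoothq D (fun y => dirq (G v) y w) by exact: smoothq_dirq.
have s2 := smoothqM oD s1 (sG v); have s3 := smoothqM oD (sG v) s1.
apply: (etrans (dirq_ext w oD Dz (fun y Dy => dW v w Dy))).
apply: (etrans (dirqN w Dz (smoothqD oD s2 s3))); congr (- _).
apply: (etrans (dirqD w Dz s2 s3)).
by congr (_ + _); [exact: (dirqM w Dz s1 (sG v))|exact: (dirqM w Dz (sG v) s1)].
Qed.

(** Divided by the square of |G|^2, the left side is the Laplacian of ln |G|^2; the polynomial form
    holds at the zeros of G as well. *)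
Lemma gauG_laplacian z v : D z ->
  sqnq (G v z) * (qre (dirq (fun y => dirq (W v) y v) z v)
     + qre (dirq (fun y => dirq (W v) y (Jp v)) z (Jp v)))
  - ((qre (dirq (W v) z v)) ^+ 2 + (qre (dirq (W v) z (Jp v))) ^+ 2)
  = (2 * sqnq (dirq N z v) + 8 * qre (G v z * dirq N z v)) * sqnq (G v z) ^+ 2.
Proof.
move=> Dz; set w := Jp v.
have sNv x : smoothq D (fun y => dirq N y x) by exact: smoothq_dirq.
have sGx x : smoothq D (fun y => dirq (G v) y x) by exact: smoothq_dirq.
have uy y : D y -> dirq (G v) y w = - (dirq N y v * G v y) - N y * dirq (G v) y v.
  move=> Dy; apply: (etrans (gauG_mixed v w Dy)).
  apply: (etrans (dirq_ext v oD Dy (fun p Dp => gauG_J HC v Dp))).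
  apply: (etrans (dirqN v Dy (smoothqM oD sN (sG v)))).
  by rewrite (dirqM v Dy sN (sG v)) opprD.
have uyx x : dirq (fun y => dirq (G v) y w) z x
    = - (dirq (fun y => dirq N y v) z x * G v z) - dirq N z v * dirq (G v) z x
      - dirq N z x * dirq (G v) z v - N z * dirq (fun y => dirq (G v) y v) z x.
  have s2 := smoothqM oD (sNv v) (sG v); have s3 := smoothqM oD sN (sGx v).
  apply: (etrans (dirq_ext x oD Dz uy)).
  apply: (etrans (dirqB x oD Dz (smoothqN oD s2) s3)).
  rewrite (dirqN x Dz s2) (dirqM x Dz (sNv v) (sG v)) (dirqM x Dz sN (sGx v)).
  by ncring I.
have nxx : dirq (fun y => dirq N y v) z v * N z + dirq N z v * dirq N z v
    + (dirq N z v * dirq N z v + N z * dirq (fun y => dirq N y v) z v) = 0.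
  have s2 := smoothqM oD (sNv v) sN; have s3 := smoothqM oD sN (sNv v).
  rewrite -(dirqM v Dz (sNv v) sN) -(dirqM v Dz sN (sNv v)) -(dirqD v Dz s2 s3).
  apply: (etrans (dirq_ext (w := fun=> 0) v oD Dz _)); last exact: dirq_cst.
  by move=> y Dy; rewrite (cmc_dN_anti HC) // addNr.
have an : dirq (G v) z v * N z + G v z * dirq N z v
    = - (dirq N z v * G v z + N z * dirq (G v) z v).
  rewrite -(dirqM v Dz (sG v) sN) -(dirqM v Dz sN (sG v)).
  apply: (etrans (dirq_ext v oD Dz (fun y Dy => gauG_N HC v Dy))).
  exact: (dirqN v Dz (smoothqM oD sN (sG v))).
apply: (laplacian_algebra (cmc_NN HC Dz) (gauG_N HC v Dz) (cmc_dN_anti HC v Dz)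
  nxx an _ _ _ _ _ (uy z Dz) _ (uyx w)
  (dW v v Dz) (dW v w Dz) (ddW v v Dz) (ddW v w Dz)).
- exact: gauG_imaginary.
- by apply: dirq_imaginary => // y Dy; exact: gauG_imaginary.
- exact: cmc_dN_imaginary.
- by apply: (@dirq_imaginary (fun y => dirq N y v)) => // y Dy; exact: cmc_dN_imaginary.
- rewrite (cmc_dNJ HC) //.
  have h := gauG_half HC v Dz.
  have -> : N z * (G v z + G v z + G v z + G v z)
    = N z * ((G v z + G v z) + (G v z + G v z)) by ncring I.
  by rewrite h; ncring I.
- apply: (etrans (dirqC v w oD Dz (sG v))).
  exact: uyx v.
Qed.

Lemma gauG_isolated_zeros z0 : D z0 ->
  (\forall z \near z0, G (e1 R) z = 0) \/ (\forall z \near z0^', G (e1 R) z != 0).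
Proof.
Transparent dirq.
move=> Dz0; set v := e1 R.
pose s z := qre (W v z).
have sE z : D z -> s z = sqnq (G v z).
  by move=> Dz; rewrite /s /W (imaginary_square (gauG_imaginary v Dz)) opprK.
have s0 z : s z = 0 -> D z -> G v z = 0.
  by move=> + Dz; rewrite sE // => /eqP; rewrite sqnq_eq0 => /eqP.
have [w0 _ _ _] := sW v.
have cs : {for z0, continuous s}.
  exact: differentiable_continuous (smoothR_differentiable w0 Dz0).
(* The factor in [gauG_laplacian] is at least - 8 s; bounding s on [D0] turns this into the constant
   K = 8 (s z0 + 1). *)
pose D0 := [set z | D z /\ s z < s z0 + 1].
have oD0 : open D0.
  rewrite openE => z [Dz sz].
  have csz : {for z, continuous s}.
    exact: differentiable_continuous (smoothR_differentiable w0 Dz).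
  exact: filterS2 (open_nbhs_nbhs (conj oD Dz)) (cvgr_lt _ csz _ sz).
have D0z0 : D0 z0 by split=> //; rewrite ltrDl.
have [[e [e0 He]]|nacc] := pselect (exists e : R, 0 < e /\
    forall a, D a -> a != z0 -> `|a - z0| < e -> G v a != 0).
  right; rewrite /dnbhs /within /=.
  have cn : {for z0, continuous (fun y : plane => `|y - z0|)}.
    apply: (@continuous_comp _ _ _ (fun y : plane => y - z0)); last exact: norm_continuous.
    by apply: cvgB; [exact: cvg_id|exact: cvg_cst].
  have zr : `|z0 - z0| < e by rewrite subrr normr0.
  apply: filterS2 (open_nbhs_nbhs (conj oD Dz0)) (cvgr_lt _ cn _ zr) => z Dz ze zz0.
  exact: He.
left.
have van : \forall z \near z0, s z = 0.
  apply: (@vanishing_of_clustering_zeros _ D0 s z0 (8 * (s z0 + 1))) => //.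
  - by apply: ndiff_sub (w0 2%N) => z [].
  - by move=> z [Dz _]; rewrite sE // /sqnq !addr_ge0 // sqr_ge0.
  - move=> z [Dz sz].
    have := gauG_laplacian v Dz; rewrite {3 4}/v !Jp_e1 -/v.
    rewrite -(sE z Dz) => E; rewrite /lap.
    have -> : s z * ('D_(e1 R) ('D_(e1 R) s) z + 'D_(e2 R) ('D_(e2 R) s) z)
        - ('D_(e1 R) s z ^+ 2 + 'D_(e2 R) s z ^+ 2)
        = (2 * sqnq (dirq N z v) + 8 * qre (G v z * dirq N z v)) * s z ^+ 2.
      exact: E.
    have sz0 : 0 <= s z by rewrite sE // /sqnq !addr_ge0 // sqr_ge0.
    have key : - (8 * s z) <= 2 * sqnq (dirq N z v) + 8 * qre (G v z * dirq N z v).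
      rewrite sE // /sqnq qreM (gauG_imaginary v Dz) (cmc_dN_imaginary v Dz).
      exact: completed_square_ge.
    apply: ler_wpM2r; first exact: sqr_ge0.
    by apply: le_trans key; rewrite lerN2 ler_pM2l // ltW.
  - move=> e e0; apply: contrapT => h; apply: nacc; exists e; split=> // a Da az ae.
    apply/eqP => G0; apply: h; exists a; split=> //.
    by rewrite sE // G0 /sqnq /= expr0n /= !addr0.
apply: filterS2 van (open_nbhs_nbhs (conj oD Dz0)) => z sz Dz; exact: s0.
Opaque dirq.
Qed.

End Isolation.
End UmbilicIsolation.

(** * Riemann surfaces *)

Section SurfaceCalculus.
Variable R : realType.
Local Notation plane := (R * R)%type.
Local Notation H := (quat R).

Section Charts.
Variable X : riemannSurface R.
Implicit Types (c : chart R X) (p q : X) (z v : plane).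

Definition cimg c : set plane := cmap c @` cdom c.

Lemma cinvK c p : cdom c p -> cinv c (cmap c p) = p.
Proof. by move=> cp; apply: cmapK; rewrite inE. Qed.

Lemma cimgP c z : cimg c z -> cdom c (cinv c z) /\ cmap c (cinv c z) = z.
Proof. by move=> [p cp <-]; rewrite cinvK. Qed.

Lemma cimg_cmap c p : cdom c p -> cimg c (cmap c p).
Proof. by move=> cp; exists p. Qed.

Lemma near_cinv c p (Q : X -> Prop) : cdom c p ->
  (\forall q \near p, Q q) -> \forall z \near cmap c p, Q (cinv c z).
Proof.
move=> cp nQ.
have cont : {for cmap c p, continuous (cinv c)}.
  by apply: cinv_cont; rewrite inE; exact: cimg_cmap.
by apply: cont; rewrite cinvK.
Qed.

Lemma near_cmap c p (Q : plane -> Prop) : cdom c p ->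
  (\forall z \near cmap c p, Q z) -> \forall q \near p, Q (cmap c q).
Proof.
move=> cp nQ; have cont : {for p, continuous (cmap c)}.
  by apply: cmap_cont; rewrite inE.
exact: cont.
Qed.

Lemma near_cdom c p : cdom c p -> \forall q \near p, cdom c q.
Proof. by move=> cp; apply: open_nbhs_nbhs; split=> //; exact: cdom_open. Qed.

Lemma cimg_sub_open c (U : set X) : open U -> open (cmap c @` (cdom c `&` U)).
Proof.
move=> oU; rewrite openE => z [p [cp Up] <-].
have n1 := near_cinv cp (open_nbhs_nbhs (conj oU Up)).
have n2 := open_nbhs_nbhs (conj (@cimg_open _ _ c) (cimg_cmap cp)).
apply: filterS2 n1 n2 => y Uy /cimgP[cy e].
by exists (cinv c y).
Qed.

Lemma open_cimg c : open (cimg c).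
Proof. exact: cimg_open. Qed.

Lemma chart_exists p : exists c, chart_at c p.
Proof. by have [c ac cp] := @atlas_cover _ X p; exists c. Qed.

Lemma connected_constant (P : X -> Prop) :
  (forall p, P p -> \forall q \near p, P q) ->
  (forall p, ~ P p -> \forall q \near p, ~ P q) ->
  forall p q, P p -> P q.
Proof.
move=> oP oN p q Pp.
have cX := @carrier_connected _ X.
suff E : [set x | P x] = setT by have : [set: X] q by []; rewrite -E.
apply: cX.
- by exists p.
- by exists [set x | P x]; [rewrite openE => x /oP|rewrite setTI].
- exists [set x | P x]; last by rewrite setTI.
  rewrite -[X in closed X]setCK; apply: open_closedC.
  by rewrite openE => x /oN.
Qed.

Lemma smooth_on_cimg h c : smooth_on [set: X] h -> atlas c -> smoothq (cimg c) (h \o cinv c).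
Proof. by move=> sh ac; have := sh c ac; rewrite setIT. Qed.

Lemma dirq_cinv h c z v : cimg c z -> dirq (h \o cinv c) z v = d_ h c (cinv c z) v.
Proof. by move=> /cimgP[_ e]; rewrite /d_ e. Qed.

End Charts.

Section Pullback.
Variables (X Y : riemannSurface R) (k : X -> Y).
Hypothesis hk : holomorphic k.
Implicit Types (h : Y -> H).

Let Phi (c : chart R X) (c' : chart R Y) := cmap c' \o k \o cinv c.
Let dom (c : chart R X) (c' : chart R Y) := cmap c @` (cdom c `&` k @^-1` cdom c').

Lemma dom_open c c' : open (dom c c').
Proof.
apply: cimg_sub_open; apply: open_comp; last exact: cdom_open.
by move=> x _; exact: hk.1.
Qed.

Let domP c c' z : dom c c' z -> [/\ cimg c z, cdom c (cinv c z), cdom c' (k (cinv c z))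
  & cmap c (cinv c z) = z].
Proof. by move=> [p [cp kp] <-]; rewrite cinvK //; split=> //; exact: cimg_cmap. Qed.

Lemma pullback_smooth h : smooth_on setT h -> smooth_on setT (h \o k).
Proof.
move=> sh c ac; apply: smoothq_local => z; rewrite setIT => zc.
have [cz ez] := cimgP zc.
have [c' [ac' kc']] := chart_exists (k (cinv c z)).
exists (dom c c'); first by exists (cinv c z).
have [s1 s2 _] := hk.2 c c' ac ac'.
apply: (@smoothq_ext _ _ ((h \o cinv c') \o Phi c c')); first exact: dom_open.
  by move=> y /domP[_ _ ky _]; rewrite /Phi /= cinvK.
apply: (@smoothq_comp _ _ (cimg c')) => //.
- exact: dom_open.
- exact: open_cimg.
- by move=> y /domP[_ _ ky _]; exact: cimg_cmap.
- exact: smooth_on_cimg.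
Qed.

Lemma pullback_d h c c' p v : smooth_on setT h -> chart_at c p -> chart_at c' (k p) ->
  d_ (h \o k) c p v = d_ h c' (k p) (jac (cmap c' \o k \o cinv c) (cmap c p) v).
Proof.
move=> sh [ac cp] [ac' ckp].
have [s1 s2 _] := hk.2 c c' ac ac'.
have Dp : dom c c' (cmap c p) by exists p.
have e1 : dirq ((h \o k) \o cinv c) (cmap c p) v
    = dirq ((h \o cinv c') \o Phi c c') (cmap c p) v.
  apply: (dirq_ext v (@dom_open c c') Dp).
  by move=> y /domP[_ _ ky _]; rewrite /Phi /= cinvK.
rewrite /d_ e1.
have PE : Phi c c' (cmap c p) = cmap c' (k p) by rewrite /Phi /= cinvK.
rewrite -PE; apply: (dirq_comp v Dp s1 s2 (E := cimg c')); last exact: smooth_on_cimg.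
by rewrite /= cinvK //; exact: cimg_cmap.
Qed.

Lemma pullback_J c c' p v : chart_at c p -> chart_at c' (k p) ->
  jac (cmap c' \o k \o cinv c) (cmap c p) (Jp v)
  = Jp (jac (cmap c' \o k \o cinv c) (cmap c p) v).
Proof.
move=> [ac cp] [ac' ckp]; have [_ _ hJ] := hk.2 c c' ac ac'.
by apply: hJ; exists p.
Qed.

End Pullback.

Section OneSurface.
Variable X : riemannSurface R.
Implicit Types (c : chart R X) (p q : X) (z v : plane) (h : X -> H).

(** A change of charts becomes the pullback by the identity. *)
Lemma holomorphic_id : holomorphic (id : X -> X).
Proof. by split; [move=> x; exact: cvg_id|exact: (@atlas_compat _ X)]. Qed.

Lemma d_transition h c c' p v : smooth_on setT h -> chart_at c p -> chart_at c' p ->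
  d_ h c p v = d_ h c' p (jac (cmap c' \o cinv c) (cmap c p) v).
Proof. by move=> sh cp cp'; exact: (pullback_d holomorphic_id v sh cp cp'). Qed.

(** The coordinates of c are smooth functions of those of c', so their derivatives along v vanish if
    the Jacobian kills v; these derivatives are the components of v. *)
Lemma jac_transition_inj c c' p v : chart_at c p -> chart_at c' p ->
  jac (cmap c' \o cinv c) (cmap c p) v = 0 -> v = 0.
Proof.
move=> [ac cp] [ac' cp'] e.
have [s1 s2 _] := @atlas_compat _ X c c' ac ac'.
have [t1 t2 _] := @atlas_compat _ X c' c ac' ac.
have Dp : (cmap c @` (cdom c `&` cdom c')) (cmap c p) by exists p.
have Dp' : (cmap c' @` (cdom c' `&` cdom c)) (cmap c' p) by exists p.
have PE : (cmap c' \o cinv c) (cmap c p) = cmap c' p by rewrite /= cinvK.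
have oD : open (cmap c @` (cdom c `&` cdom c')).
  by apply: cimg_sub_open; exact: cdom_open.
have d1 := smoothR_differentiable s1 Dp; have d2 := smoothR_differentiable s2 Dp.
have K (F : plane -> R) : differentiable F (cmap c' p) ->
    'D_v (F \o (cmap c' \o cinv c)) (cmap c p) = 0.
  move=> dF; rewrite -PE in dF.
  have [_ ->] := derive_comp_plane v d1 d2 dF.
  by rewrite e derive0.
have L (F : plane -> R) (G : plane -> R) : (forall y, F y = G (cmap c (cinv c' y))) ->
    differentiable F (cmap c' p) -> 'D_v G (cmap c p) = 0.
  move=> FG dF; rewrite -(K F dF); apply: near_eq_derive.
  apply: (near_open oD Dp) => y [q [cq cq'] <-].
  by rewrite /= FG !cinvK.
have l1 := L (fun y => (cmap c (cinv c' y)).1) fst (fun=> erefl)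
  (smoothR_differentiable t1 Dp').
have l2 := L (fun y => (cmap c (cinv c' y)).2) snd (fun=> erefl)
  (smoothR_differentiable t2 Dp').
by rewrite derive_fst in l1; rewrite derive_snd in l2; apply: injective_projections.
Qed.

Lemma zero_d_constant h : smooth_on setT h ->
  (forall c p v, chart_at c p -> d_ h c p v = 0) -> forall p q, h p = h q.
Proof.
move=> sh dh.
have loc p : \forall q \near p, h q = h p.
  have [c [ac cp]] := chart_exists p.
  have [r r0 hr] := near_plane (@open_cimg _ c) (cimg_cmap cp).
  have [s0 s1 s2 s3] := smooth_on_cimg sh ac.
  have Z (F : H -> R) : smoothR (cimg c) (fun z => F (h (cinv c z))) ->
      (forall z v, cimg c z -> 'D_v (fun z => F (h (cinv c z))) z = 0) ->
      forall k : plane, `|k| <= r -> F (h (cinv c (cmap c p + k))) = F (h p).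
    move=> sF dF k kr.
    rewrite (@zero_gradient_const _ (fun z => F (h (cinv c z))) (cmap c p) r) //.
      by rewrite cinvK.
    move=> y yr; split; first exact: smoothR_differentiable sF (hr _ yr).
    by move=> v; apply: dF; exact: hr.
  have D0 z v : cimg c z -> dirq (h \o cinv c) z v = 0.
    by move=> zc; rewrite dirq_cinv //; apply: dh; split=> //; case: (cimgP zc).
  have eqh k : `|k| <= r -> h (cinv c (cmap c p + k)) = h p.
    move=> kr; apply: quat_eqP.
    - by apply: (Z (@qre R)) => // z v /D0; move=> /(_ v)/(congr1 (@qre R)).
    - by apply: (Z (@qim1 R)) => // z v /D0; move=> /(_ v)/(congr1 (@qim1 R)).
    - by apply: (Z (@qim2 R)) => // z v /D0; move=> /(_ v)/(congr1 (@qim2 R)).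
    - by apply: (Z (@qim3 R)) => // z v /D0; move=> /(_ v)/(congr1 (@qim3 R)).
  have nz : \forall z \near cmap c p, h (cinv c z) = h p.
    apply/nbhs_ballP; exists r => //= z; rewrite -ball_normE /= => zr.
    have := eqh (z - cmap c p); rewrite [cmap c p + _]addrC subrK; apply.
    by rewrite distrC ltW.
  apply: filterS2 (near_cmap cp nz) (near_cdom cp) => q + cq.
  by rewrite cinvK.
move=> p q; apply: (connected_constant (P := fun x => h p = h x)) => // [x e|x e].
  by apply: filterS (loc x) => y ->.
by apply: filterS (loc x) => y ->.
Qed.

End OneSurface.
End SurfaceCalculus.

(** * Zeros of dg, the transform by a section parallel for d^N, and zeros of such sections, in a
    chart *)

Section PlaneComplements.
Variable R : realType.
Local Notation plane := (R * R)%type.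
Local Notation H := (quat R).

Local Opaque dirq.

(** g_y = - N g_x, so that dg is determined by g_x and both have the same zeros. *)
Lemma gauG_linear (D : set plane) (f N : plane -> H) z w : cmc_plane D f N -> D z ->
  gauG f N w z = (realq w.1 - realq w.2 * N z) * gauG f N (e1 R) z.
Proof.
move=> HC Dz.
have sg := smoothqD (cmc_open HC) (cmc_smoothf HC) (cmc_smoothN HC).
have -> : gauG f N w z
    = realq w.1 * gauG f N (e1 R) z + realq w.2 * gauG f N (e2 R) z.
  have rC (a : R) (x : H) : realq a * (2^-1 * x) = 2^-1 * (realq a * x).
    rewrite !mulrA; congr (_ * _); exact: esym (quat_halfC _).
  rewrite /gauG !rC -mulrDr; congr (_ * _); rewrite {1}(planeE w).
  rewrite (dirq_lin _ _ _ Dz sg); congr (_ + _).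
  rewrite -[_ *: e2 R]addr0 (dirq_lin _ _ _ Dz sg).
  suff -> : dirq (fun q => f q + N q) z 0 = 0 by rewrite addr0.
  have := dirq_lin 0 0 0 Dz sg; rewrite scale0r addr0.
  have -> : realq (0 : R) = 0 by [].
  Transparent dirq. by rewrite /dirq !derive0. Opaque dirq.
by rewrite -Jp_e1 (gauG_J HC) // mulrN -mulNr; ncring I.
Qed.

Lemma gauG_inj (D : set plane) (f N : plane -> H) z w : cmc_plane D f N -> D z ->
  gauG f N (e1 R) z != 0 -> gauG f N w z = 0 -> w = 0.
Proof.
move=> HC Dz G0 e; have lin := gauG_linear w HC Dz.
have /eqP := etrans (esym lin) e; rewrite quat_mulf_eq0 (negPf G0) orbF => /eqP h.
have iN := imaginary_sqr (cmc_NN HC Dz).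
have w1 : w.1 = 0.
  have := congr1 (@qre R) h; rewrite qreD qreN qreM iN /realq /=.
  by rewrite mulr0 !mul0r !subr0.
have w2 : w.2 = 0.
  apply/eqP; apply: contraT => w20.
  have : realq w.2 * N z * N z = 0.
    move: h; rewrite w1 (_ : realq 0 = 0) // sub0r => /eqP; rewrite oppr_eq0 => /eqP ->.
    by rewrite mul0r.
  rewrite -mulrA (cmc_NN HC Dz) mulrN1 => /eqP; rewrite oppr_eq0 => /eqP.
  by move=> /(congr1 (@qre R)) /= /eqP; rewrite (negPf w20).
by apply: injective_projections.
Qed.

(* For a nowhere vanishing d^N-parallel section alpha, the paper's
   alpha beta^-1 is - 2 rho^-1 for the gauged data of the parallel surface. *)
Section Parallel.
Variables (D : set plane) (f N alpha : plane -> H) (c b : H).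
Hypothesis HC : cmc_plane D f N.
Hypothesis HA : gauged D (fun z => - N z) alpha (fun v z => 2^-1 * dirq f z v)
    (fun v z => gauG f N v z + gauG f N v z) c b.
Local Notation rho := (grho (fun z => - N z) alpha c b).
Local Notation Rt := (gR (fun z => - N z) alpha c b).

Definition parf (z : plane) : H := f z - (rho z)^-1 - (rho z)^-1.

Let tau v z := gtau (fun z => - N z) alpha
  (fun v z => gauG f N v z + gauG f N v z) c b v z.

Lemma smoothq_parf : smoothq D parf.
Proof.
have oD := cmc_open HC; have s := smoothq_grhoV HA.
by apply: smoothqB => //; apply: smoothqB => //; exact: (cmc_smoothf HC).
Qed.

Lemma dirq_parf z v : D z -> dirq parf z v = - (tau v z + tau v z).
Proof.
move=> Dz; have oD := cmc_open HC; have s := smoothq_grhoV HA.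
have sf := cmc_smoothf HC.
apply: (etrans (dirqB v oD Dz (smoothqB oD sf s) s)).
rewrite (dirqB v oD Dz sf s) (dirq_grhoV HA v Dz).
have h := quat_half_add (dirq f z v); rewrite -{1}h -/(tau v z); ncring I.
Qed.

(** For n = - R, [gR_plus] reads dn - n *dn = 4 tau, whereas the differential of [parf] is - 2 tau:
    this is the CMC equation. The types of the differential follow from *tau = - R tau and from tau
    R = - R tau. *)
Lemma parf_cmc z v : D z -> let n := fun z => - Rt z in
  [/\ dirq parf z (Jp v) = n z * dirq parf z v,
      dirq parf z (Jp v) = - (dirq parf z v * n z)
    & dirq parf z v = - (2^-1 * (dirq n z v - n z * dirq n z (Jp v)))].
Proof.
move=> Dz n; have oD := cmc_open HC.
have sR := smoothq_gR HA; have RR := gR_sqr HA Dz.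
have GJ : 2^-1 * dirq f z (Jp v) = - (- N z * (2^-1 * dirq f z v)).
  by rewrite (cmc_fJ HC) // mulNr opprK !mulrA quat_halfC.
have PJ : gauG f N (Jp v) z + gauG f N (Jp v) z
    = - N z * (gauG f N v z + gauG f N v z).
  by rewrite (gauG_J HC) //; ncring I.
have tJ : tau (Jp v) z = - (Rt z * tau v z) := gtauJ HA Dz PJ.
have plus := gR_plus HA Dz GJ PJ.
have e1 : dirq parf z (Jp v) = n z * dirq parf z v.
  have p1 := dirq_parf v Dz; have p2 := dirq_parf (Jp v) Dz.
  apply: (etrans p2); apply: (etrans _ (esym (congr1 (fun x => n z * x) p1))).
  by rewrite tJ /n; ncring I.
have e3 : dirq parf z v = - (2^-1 * (dirq n z v - n z * dirq n z (Jp v))).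
  have dn x : dirq n z x = - dirq Rt z x by exact: (dirqN x Dz sR).
  have E : dirq n z v - n z * dirq n z (Jp v)
      = (tau v z + tau v z) + (tau v z + tau v z).
    have -> : dirq n z v - n z * dirq n z (Jp v)
      = - (dirq Rt z v + Rt z * dirq Rt z (Jp v)) by rewrite !dn /n; ncring I.
    by rewrite plus; rewrite /tau; ncring I.
  by rewrite dirq_parf // E mulrDr quat_half_add.
split=> //; rewrite e1.
have anti : dirq Rt z v * Rt z = - (Rt z * dirq Rt z v).
  apply/eqP; rewrite -addr_eq0 -(dirqM v Dz sR sR); apply/eqP.
  apply: (etrans (dirq_ext (w := fun=> -1) v oD Dz _)); last exact: dirq_cst.
  by move=> y Dy; exact: (gR_sqr HA Dy).
have anti' : dirq Rt z (Jp v) * Rt z = - (Rt z * dirq Rt z (Jp v)).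
  apply/eqP; rewrite -addr_eq0 -(dirqM (Jp v) Dz sR sR); apply/eqP.
  apply: (etrans (dirq_ext (w := fun=> -1) (Jp v) oD Dz _)); last exact: dirq_cst.
  by move=> y Dy; exact: (gR_sqr HA Dy).
(* - 4 tau = dR + R *dR, where dR and *dR both anticommute with R; the factor 4 is removed by
   halving twice. *)
have tn : tau v z * Rt z = - (Rt z * tau v z).
  have t4 : tau v z + tau v z + tau v z + tau v z
      = - (dirq Rt z v + Rt z * dirq Rt z (Jp v)) by rewrite plus opprK.
  have h : (tau v z * Rt z + Rt z * tau v z) + (tau v z * Rt z + Rt z * tau v z)
      + ((tau v z * Rt z + Rt z * tau v z) + (tau v z * Rt z + Rt z * tau v z)) = 0.
    have -> : (tau v z * Rt z + Rt z * tau v z) + (tau v z * Rt z + Rt z * tau v z)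
      + ((tau v z * Rt z + Rt z * tau v z) + (tau v z * Rt z + Rt z * tau v z))
      = (tau v z + tau v z + tau v z + tau v z) * Rt z
        + Rt z * (tau v z + tau v z + tau v z + tau v z) by ncring I.
    by rewrite t4; ncring (anti, anti', RR).
  by apply/eqP; rewrite -addr_eq0; apply/eqP/quat_addrr_eq0/quat_addrr_eq0.
have p1 := dirq_parf v Dz.
apply: (etrans (congr1 (fun x => n z * x) p1)).
apply: (etrans _ (esym (congr1 (fun x => - (x * n z)) p1))).
by rewrite /n; ncring tn.
Qed.

End Parallel.

Lemma darboux_quotient (N alpha c b : H) : alpha != 0 ->
  N * alpha * c + alpha * b != 0 ->
  alpha * (2^-1 * (N * alpha * c + alpha * b))^-1
  = - ((- N * alpha * c - alpha * b) * alpha^-1)^-1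
    - ((- N * alpha * c - alpha * b) * alpha^-1)^-1.
Proof.
move=> a0 k0; set k := N * alpha * c + alpha * b in k0 *.
have -> : - N * alpha * c - alpha * b = - k by rewrite /k; ncring I.
have V : (- k * alpha^-1) * - (alpha * k^-1) = 1.
  by ncring (quat_mulVf a0, quat_mulfV k0).
have u1 : - k * alpha^-1 != 0.
  by apply/eqP => h; move: V; rewrite h mul0r => /eqP; rewrite eq_sym oner_eq0.
have -> : (- k * alpha^-1)^-1 = - (alpha * k^-1).
  by apply: (mulrI (quat_unit u1)); rewrite quat_mulfV.
have h2 := quat_half2 R.
have u2 : 2^-1 * k != 0.
  rewrite quat_mulf_eq0 negb_or k0 andbT; apply/eqP => h; move: h2.
  by rewrite h addr0 => /eqP; rewrite eq_sym oner_eq0.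
have -> : (2^-1 * k)^-1 = k^-1 + k^-1.
  apply: (mulrI (quat_unit u2)); rewrite quat_mulfV //.
  have -> : 2^-1 * k * (k^-1 + k^-1) = 2^-1 * (k * k^-1) + 2^-1 * (k * k^-1) by ncring I.
  by rewrite quat_mulfV // mulr1.
by ncring I.
Qed.

(* Along a ray from a zero of alpha, |alpha|^2 satisfies a Gronwall inequality. *)
Lemma parallel_zero_near (D : set plane) (f N alpha : plane -> H) (c b : H) z :
  cmc_plane D f N -> smoothq D alpha ->
  (forall y v, D y -> dirq alpha y v
     = - (2^-1 * dirq f y v * (N y * alpha y * c + alpha y * b))) ->
  D z -> alpha z = 0 -> \forall y \near z, alpha y = 0.
Proof.
move=> HC sa da Dz a0; have oD := cmc_open HC.
pose s y := sqnq (alpha y).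
have ss : smoothR D s by exact: smoothR_sqnq.
have sqD (x y : H) : sqnq (x + y) <= 2 * (sqnq x + sqnq y).
  rewrite /sqnq /=.
  have := sqr_ge0 (qre x - qre y); have := sqr_ge0 (qim1 x - qim1 y).
  have := sqr_ge0 (qim2 x - qim2 y); have := sqr_ge0 (qim3 x - qim3 y).
  rewrite !expr2; lra.
have sq_ge0 (x : H) : 0 <= sqnq x by rewrite /sqnq !addr_ge0 // sqr_ge0.
have ds y v : D y -> 'D_v s y <= sqnq (dirq alpha y v) + sqnq (alpha y).
  move=> Dy; have [w0 w1 w2 w3] := sa.
  have dd F : smoothR D F -> derivable F y v.
    by move=> sF; apply: diff_derivable; exact: smoothR_differentiable sF Dy.
  have -> : 'D_v s y = 2 * (qre (alpha y) * qre (dirq alpha y v)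
      + qim1 (alpha y) * qim1 (dirq alpha y v) + qim2 (alpha y) * qim2 (dirq alpha y v)
      + qim3 (alpha y) * qim3 (dirq alpha y v)).
    have -> : s = (fun x => qre (alpha x) * qre (alpha x) + 1 * (qim1 (alpha x) * qim1 (alpha x))
        + 1 * (qim2 (alpha x) * qim2 (alpha x)) + 1 * (qim3 (alpha x) * qim3 (alpha x))).
      by apply/funext => x; rewrite /s /sqnq !mul1r !expr2.
    rewrite (derive_dot _ _ _ (dd _ w0) (dd _ w1) (dd _ w2) (dd _ w3)
      (dd _ w0) (dd _ w1) (dd _ w2) (dd _ w3)).
    Transparent dirq. rewrite /dirq /=. Opaque dirq.
    move: ('D_v _ _) ('D_v _ _) ('D_v _ _) ('D_v _ _) => *; ring.
  move: (dirq alpha y v) (alpha y) => x a; rewrite /sqnq.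
  have := sqr_ge0 (qre x - qre a); have := sqr_ge0 (qim1 x - qim1 a).
  have := sqr_ge0 (qim2 x - qim2 a); have := sqr_ge0 (qim3 x - qim3 a).
  rewrite !expr2; lra.
(* |N alpha c + alpha b|^2 <= 2 (|c|^2 + |b|^2) |alpha|^2, because |N| = 1. *)
pose B : R := 2 * (sqnq c + sqnq b).
have B0 : 0 <= B by rewrite mulr_ge0 // addr_ge0.
have sqda y v : D y -> sqnq (dirq alpha y v) <= sqnq (2^-1 * dirq f y v) * (B * s y).
  move=> Dy; rewrite da // -mulrN sqnqM ler_wpM2l //.
  have sqN (x : H) : sqnq (- x) = sqnq x by rewrite /sqnq /= !sqrrN.
  rewrite sqN; apply: le_trans (sqD _ _) _; rewrite !sqnqM /s /B.
  have -> : sqnq (N y) = 1.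
    have := congr1 (@sqnq R) (cmc_NN HC Dy); rewrite sqnqM sqN.
    have -> : sqnq (1 : H) = 1 by rewrite /sqnq /= expr1n expr0n /= !addr0.
    by move=> h; have := sq_ge0 (N y); move: h; rewrite -expr2 => /eqP;
      rewrite sqrf_eq1 => /orP[/eqP->//|/eqP->]; lra.
  by rewrite mul1r; lra.
pose P (i : bool) y : R := sqnq (2^-1 * dirq f y (if i then e1 R else e2 R)).
have sP i : smoothR D (P i).
  apply: smoothR_sqnq => //; apply: smoothqM => //; first exact: smoothq_cst.
  by apply: smoothq_dirq; exact: cmc_smoothf HC.
have cP i : {for z, continuous (P i)}.
  exact: differentiable_continuous (smoothR_differentiable (sP i) Dz).
(* On [E] each coefficient of df / 2 has squared norm below its value at z plus 1; [K0] is the sum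
   of the two bounds. *)
pose K0 := P true z + P false z + 2.
pose E := [set y | D y /\ (P true y < P true z + 1 /\ P false y < P false z + 1)].
have nE : \forall y \near z, E y.
  have l1 : P true z < P true z + 1 by rewrite ltrDl.
  have l2 : P false z < P false z + 1 by rewrite ltrDl.
  have n0 : \forall y \near z, D y by exact: open_nbhs_nbhs.
  have n1 : \forall y \near z, P true y < P true z + 1 by apply: (cvgr_lt _ (cP true) _ l1).
  have n2 : \forall y \near z, P false y < P false z + 1 by apply: (cvgr_lt _ (cP false) _ l2).
  exact: (filterI n0 (filterI n1 n2)).
have /nbhs_ballP[r0 /= r00 hr0] := nE.
(* In [gronwall_ray] directions and displacements share the radius, so r <= 1 also bounds the
   coordinates of the direction. *)
pose r := Num.min (r0 / 2) 1.
have r1 : r <= 1 by rewrite /r ge_min lexx orbT.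
have rp : 0 < r by rewrite lt_min divr_gt0 // ltr01.
have hr (k : plane) : `|k| <= r -> E (z + k).
  move=> kr; apply: (hr0 (z + k)); rewrite -ball_normE /= opprD addNKr normrN.
  apply: le_lt_trans kr _; apply: (@le_lt_trans _ _ (r0 / 2)).
    by rewrite /r ge_min lexx.
  by rewrite ltr_pdivrMr // mulr_natr mulr2n ltrDl.
have bd y (v : plane) : E y -> `|v| <= r -> sqnq (2^-1 * dirq f y v) <= 2 * K0.
  move=> [Dy [y1 y2]] vr; have sf := cmc_smoothf HC.
  have v1 : `|v.1| <= 1.
    by apply: le_trans r1; apply: le_trans vr; rewrite norm_planeE le_max lexx.
  have v2 : `|v.2| <= 1.
    by apply: le_trans r1; apply: le_trans vr; rewrite norm_planeE le_max lexx orbT.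
  have -> : 2^-1 * dirq f y v = realq v.1 * (2^-1 * dirq f y (e1 R))
      + realq v.2 * (2^-1 * dirq f y (e2 R)).
    have rC (a : R) (x : H) : realq a * (2^-1 * x) = 2^-1 * (realq a * x).
      rewrite !mulrA; congr (_ * _); exact: esym (quat_halfC _).
    rewrite !rC -mulrDr; congr (_ * _); rewrite {1}(planeE v).
    rewrite (dirq_lin _ _ _ Dy sf); congr (_ + _).
    rewrite -[_ *: e2 R]addr0 (dirq_lin _ _ _ Dy sf).
    suff -> : dirq f y 0 = 0 by rewrite addr0.
    Transparent dirq. by rewrite /dirq !derive0. Opaque dirq.
  apply: le_trans (sqD _ _) _; rewrite !sqnqM.
  have sr (a : R) : `|a| <= 1 -> sqnq (realq a) <= 1.
    move=> a1; rewrite /sqnq /= expr0n /= !addr0.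
    by rewrite -(real_normK (num_real a)) exprn_ile1.
  rewrite ler_pM2l // /K0; apply: (@le_trans _ _ (P true y + P false y)).
    apply: lerD.
      rewrite [leRHS](sqnqM (2^-1) (dirq f y (e1 R))).
      by apply: ler_piMl; [rewrite mulr_ge0|exact: sr].
    rewrite [leRHS](sqnqM (2^-1) (dirq f y (e2 R))).
    by apply: ler_piMl; [rewrite mulr_ge0|exact: sr].
  move: y1 y2; move: (P true y) (P false y) (P true z) (P false z) => ? ? ? ?.
  by clear; lra.
have P0 i y : 0 <= P i y := sq_ge0 _.
have K00 : 0 <= K0 by rewrite /K0 addr_ge0 // addr_ge0.
have az : s z = 0 by rewrite /s a0 /sqnq /= expr0n /= !addr0.
have := @gronwall_ray R s z r (2 * K0 * B + 1) _ _ az.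
move=> G.
have {}G k : `|k| <= r -> s (z + k) = 0.
  apply: G => [h /hr[Dh _]|h v /hr Eh vr].
    by split; [exact: smoothR_differentiable ss Dh|exact: sq_ge0].
  have Dh : D (z + h) by case: Eh.
  apply: le_trans (ds _ v Dh) _; rewrite mulrDl mul1r lerD2r.
  apply: le_trans (sqda _ v Dh) _; rewrite -mulrA.
  by apply: ler_wpM2r; [rewrite mulr_ge0 // sq_ge0|exact: bd].
apply/nbhs_ballP; exists r => //= y; rewrite -ball_normE /= => yr.
have := G (y - z); rewrite [z + _]addrC subrK distrC => /(_ (ltW yr)) /eqP.
by rewrite sqnq_eq0 => /eqP.
Qed.

End PlaneComplements.

(** * The constants attached to the spectral parameter *)

Section SpectralParameter.
Variable R : realType.
Local Notation H := (quat R).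

(** mu is complex and so commutes with i, whence 4 (a^2 + b^2) = (mu + mu^-1)^2 - (mu^-1 - mu)^2 =
    4. Moreover a = 1 would mean mu + mu^-1 = 2, that is (mu - 1)^2 = 0. *)
Lemma spectral_constants (mu : H) : complexq mu -> mu != 0 -> mu != 1 ->
  [/\ a_ mu - 1 != 0, b_ mu * (a_ mu - 1) = (a_ mu - 1) * b_ mu
    & (a_ mu - 1) * (a_ mu - 1) + b_ mu * b_ mu
      = - ((a_ mu - 1) + (a_ mu - 1))].
Proof.
move=> [m2 m3] m0 m1; rewrite /a_ /b_.
have mw := quat_mulfV m0; have wm := quat_mulVf m0.
have ii : qi R * qi R = -1 by apply: quat_eqP; rewrite !quatE /=; ring.
have im : qi R * mu = mu * qi R by apply: quat_eqP; rewrite !quatE /= m2 m3; ring.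
have iw : qi R * mu^-1 = mu^-1 * qi R.
  apply: (mulrI (quat_unit m0)).
  by ncring (esym im, mw).
have hC (x : H) : x * 2^-1 = 2^-1 * x := esym (quat_halfC x).
have h2 := quat_half2 R.
move: (mu^-1) mw wm iw => w mw wm iw.
move: (qi R) ii im iw => i ii im iw.
have hm := hC mu; have hw := hC w; have hi := hC i.
move: (2^-1 : H) hm hw hi hC h2 => h hm hw hi hC h2.
have e (a b : H) : a * a + b * b = 1 ->
    (a - 1) * (a - 1) + b * b = - ((a - 1) + (a - 1)).
  move=> e; have -> : (a - 1) * (a - 1) + b * b = (a * a + b * b) - a - a + 1 by ncring I.
  by rewrite e; ncring I.
split.
- apply: contraNneq m1 => c0; rewrite -subr_eq0.
  have e1 : (mu + w) * h = 1 by apply/eqP; rewrite -subr_eq0 c0.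
  have e2 : mu + w = 1 + 1.
    have -> : mu + w = (mu + w) * (h + h) by rewrite h2 mulr1.
    by rewrite mulrDr e1.
  have : (mu - 1) * (mu - 1) = 0.
    have -> : (mu - 1) * (mu - 1) = mu * (mu + w) - mu - mu by ncring mw.
    by rewrite e2; ncring I.
  by move/eqP; rewrite quat_mulf_eq0 orbb.
- by ncring (im, iw, hm, hw, hi, mw, wm).
- apply: e.
  have -> : (mu + w) * h * ((mu + w) * h) + i * (w - mu) * h * (i * (w - mu) * h)
     = (h + h) * (h + h) by ncring (im, iw, hm, hw, hi, mw, wm, ii).
  by rewrite h2 mulr1.
Qed.

End SpectralParameter.

(** * From charts to the surface: gluing, and isolation of the umbilics *)

Section ChartwiseData.
Variables (R : realType) (X : riemannSurface R).
Local Notation plane := (R * R)%type.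
Local Notation H := (quat R).
Implicit Types (c : chart R X) (p q : X) (z v : plane) (h : X -> H).

(** At a point written [cinv c z], results about compositions with [cinv c] apply by conversion. *)
Lemma chartwise (Q : chart R X -> X -> Prop) :
  (forall c z, atlas c -> cimg c z -> Q c (cinv c z)) ->
  forall c p, chart_at c p -> Q c p.
Proof. by move=> h c p [ac cp]; rewrite -(cinvK cp); apply: h => //; exact: cimg_cmap. Qed.

Lemma pointwise (Q : X -> Prop) :
  (forall c z, atlas c -> cimg c z -> Q (cinv c z)) -> forall p, Q p.
Proof. by move=> h p; have [c cp] := chart_exists p; exact: (chartwise (Q := fun=> Q)) cp. Qed.

Lemma smooth_on_chartwise (U : set X) h :
  (forall c, atlas c -> smoothq (cimg c) (h \o cinv c)) -> smooth_on U h.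
Proof.
by move=> sh c ac; apply: smoothq_sub (sh c ac) => z [p [cp _] <-]; exact: cimg_cmap.
Qed.

Lemma near_cmap_dnbhs c p (Q : plane -> Prop) : cdom c p ->
  (\forall z \near (cmap c p)^', Q z) -> \forall q \near p^', Q (cmap c q).
Proof.
move=> cp nQ.
have n1 : \forall q \near p, cmap c q != cmap c p -> Q (cmap c q) := near_cmap cp nQ.
have n2 := near_cdom cp.
suff : \forall q \near p, q != p -> Q (cmap c q) by [].
apply: filterS2 n1 n2 => q h cq qp; apply: h.
by apply: contra qp => /eqP e; apply/eqP; rewrite -(cinvK cp) -(cinvK cq) e.
Qed.

Lemma d_addr h (t : H) c p v : smooth_on setT h -> chart_at c p ->
  d_ (fun q => h q + t) c p v = d_ h c p v.
Proof.
move=> sh [ac cp]; have sc := smooth_on_cimg sh ac.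
apply: (etrans (dirqD v (cimg_cmap cp) sc (smoothq_cst _ t))).
by rewrite dirq_cst addr0.
Qed.

Section Cmc.
Variables F N : X -> H.
Hypothesis HC : forall c, atlas c -> cmc_plane (cimg c) (F \o cinv c) (N \o cinv c).
Local Notation G c := (gauG (F \o cinv c) (N \o cinv c)).

Lemma smooth_on_gauss : smooth_on setT (fun p => F p + N p).
Proof.
apply: smooth_on_chartwise => c ac.
exact: smoothqD (cmc_open (HC ac)) (cmc_smoothf (HC ac)) (cmc_smoothN (HC ac)).
Qed.

Lemma gauGE c z v : gauG (F \o cinv c) (N \o cinv c) v z
  = 2^-1 * dirq ((fun p => F p + N p) \o cinv c) z v.
Proof. by []. Qed.

Lemma gauG_eq0 c z : atlas c -> cimg c z -> G c (e1 R) z = 0 -> forall v, G c v z = 0.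
Proof.
move=> ac zc g1 v.
have lin : G c v z = (realq v.1 - realq v.2 * N (cinv c z)) * G c (e1 R) z.
  exact: gauG_linear (HC ac) zc.
by rewrite lin g1 mulr0.
Qed.

(** The points near which dg = 0 form an open set, and so do the others, since the zeros of dg near
    such a point are isolated. By connectedness a nonempty set of the first kind is everything, and
    g would be constant. *)
Lemma isolated_umbilics : ~ (forall p q, F p + N p = F q + N q) ->
  forall c p, chart_at c p -> \forall z \near (cmap c p)^', G c (e1 R) z != 0.
Proof.
move=> nconst.
have sg := smooth_on_gauss; set g := fun p => F p + N p in sg.
pose Z p := forall c v, chart_at c p -> d_ g c p v = 0.
pose Q p := \forall q \near p, Z q.
have Zchart c q : chart_at c q -> G c (e1 R) (cmap c q) = 0 -> Z q.
  move=> [ac cq] g1 c' v cq'; rewrite (d_transition v sg cq' (conj ac cq)).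
  move: (jac _ _ _) => w.
  have := gauG_eq0 ac (cimg_cmap cq) g1 w; rewrite gauGE => /eqP.
  rewrite quat_mulf_eq0 => /orP[|/eqP//].
  move=> /eqP h0; have := quat_half2 R; rewrite h0 addr0 => /eqP.
  by rewrite eq_sym oner_eq0.
have Qchart c p : chart_at c p -> (\forall z \near cmap c p, G c (e1 R) z = 0) -> Q p.
  move=> [ac cp] nz; have n1 := near_cmap cp nz; have n2 := near_cdom cp.
  by rewrite /Q; apply: filterS2 n1 n2 => q g1 cq; exact: (Zchart c q).
have ZG c q : chart_at c q -> Z q -> G c (e1 R) (cmap c q) = 0.
  by move=> cq Zq; rewrite gauGE; have := Zq c (e1 R) cq; rewrite /d_ => ->; rewrite mulr0.
have alt c p : chart_at c p -> ~ Q p -> \forall z \near (cmap c p)^', G c (e1 R) z != 0.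
  move=> cp nQ; have [ac cpp] := cp.
  have [nz|//] := gauG_isolated_zeros (HC ac) (cimg_cmap cpp).
  by case: nQ; exact: Qchart nz.
have noQ p : ~ Q p.
  move=> Qp; apply: nconst; apply: (zero_d_constant sg) => c q v cq.
  suff : Q q by move=> /nbhs_singleton; exact.
  apply: (connected_constant (P := Q)) Qp => [x|x nQ]; first exact: nbhs_interior.
  have [c' c'x] := chart_exists x.
  have n1 : \forall y \near x, y != x -> G c' (e1 R) (cmap c' y) != 0
    := near_cmap_dnbhs c'x.2 (alt _ _ c'x nQ).
  have n2 := near_cdom c'x.2.
  apply: filterS2 n1 n2 => y gy cy; have [->//|yx] := eqVneq y x.
  move=> /nbhs_singleton Zy; have := gy yx.
  by rewrite (ZG c' y) ?eqxx //; split=> //; exact: c'x.1.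
by move=> c p cp; exact: alt.
Qed.

End Cmc.
End ChartwiseData.

Section CmcPullback.
Variables (R : realType) (M X : riemannSurface R) (k : X -> M).
Hypothesis hk : holomorphic k.
Local Notation H := (quat R).

(** In charts k acts on derivatives by a Jacobian commuting with J, so that each equation of the
    chart record is one on M evaluated at a transported vector. *)
Lemma cmc_pullback (f N : M -> H) c : cmc_surface f N -> atlas c ->
  cmc_plane (cimg c) ((f \o k) \o cinv c) ((N \o k) \o cinv c).
Proof.
move=> [[sf [sN _] SN fJ _] _ fE] ac.
have P z : cimg c z -> chart_at c (cinv c z).
  by move=> /cimgP[cz _].
have J h z v c' : smooth_on setT h -> cimg c z -> chart_at c' (k (cinv c z)) ->
    dirq ((h \o k) \o cinv c) z v
    = d_ h c' (k (cinv c z)) (jac (cmap c' \o k \o cinv c) (cmap c (cinv c z)) v).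
  move=> sh zc kc'; rewrite dirq_cinv //.
  exact: (pullback_d hk v sh (P z zc) kc').
have JJ z v c' : cimg c z -> chart_at c' (k (cinv c z)) ->
    jac (cmap c' \o k \o cinv c) (cmap c (cinv c z)) (Jp v)
    = Jp (jac (cmap c' \o k \o cinv c) (cmap c (cinv c z)) v).
  by move=> zc kc'; exact: (pullback_J hk v (P z zc) kc').
split.
- exact: open_cimg.
- exact: smooth_on_cimg (pullback_smooth hk sf) ac.
- exact: smooth_on_cimg (pullback_smooth hk sN) ac.
- by move=> z zc; have [[_ ->]] := SN (k (cinv c z)).
- move=> z v zc; have [c' kc'] := chart_exists (k (cinv c z)).
  by rewrite !(J _ _ _ c') // JJ //; case: (fJ c' _ (jac (cmap c' \o k \o cinv c) (cmap c (cinv c z)) v) kc').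
- move=> z v zc; have [c' kc'] := chart_exists (k (cinv c z)).
  by rewrite !(J _ _ _ c') // JJ //; case: (fJ c' _ (jac (cmap c' \o k \o cinv c) (cmap c (cinv c z)) v) kc').
- move=> z v zc; have [c' kc'] := chart_exists (k (cinv c z)).
  by rewrite !(J _ _ _ c') // JJ //; exact: fE.
Qed.

End CmcPullback.

(** * Darboux transforms of CMC surfaces *)

Section SurfaceDarboux.
Variables (R : realType) (X : riemannSurface R).
Local Notation plane := (R * R)%type.
Local Notation H := (quat R).
Variables (F N nu beta : X -> H) (cc bb : H).
Hypothesis HD : forall c, atlas c -> darboux_plane (cimg c) (F \o cinv c)
  (N \o cinv c) (nu \o cinv c) (beta \o cinv c) cc bb.
Hypothesis HU : forall c p, chart_at c p ->
  \forall z \near (cmap c p)^', gauG (F \o cinv c) (N \o cinv c) (e1 R) z != 0.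
Implicit Types (c : chart R X) (p q : X) (z v : plane).
Local Notation fh := (darf F nu beta).
Local Notation Nh := (darN N nu beta).
Local Notation Hh := (darH N nu beta cc bb).
Local Notation Rh := (gR N beta cc bb).
Local Notation S := (gaussS fh Nh Hh Rh).
Local Notation G c := (gauG (F \o cinv c) (N \o cinv c)).

Let HC c (ac : atlas c) := darboux_cmc (HD ac).
Let HG c (ac : atlas c) := darboux_gauged (HD ac).

Local Opaque dirq.

Lemma smooth_on_darf U : smooth_on U fh.
Proof. by apply: smooth_on_chartwise => c ac; exact: smoothq_darf (HD ac). Qed.

Lemma smooth_on_darN U : smooth_on U Nh.
Proof. by apply: smooth_on_chartwise => c ac; exact: smoothq_darN (HD ac). Qed.

Lemma smooth_on_gR U : smooth_on U Rh.
Proof. by apply: smooth_on_chartwise => c ac; exact: smoothq_gR (HG ac). Qed.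

Lemma surface_NN p : Nh p * Nh p = -1.
Proof. move: p; apply: pointwise => c z ac zc; exact: (darN_sqr (HD ac) zc). Qed.

Lemma surface_RR p : Rh p * Rh p = -1.
Proof. move: p; apply: pointwise => c z ac zc; exact: (gR_sqr (HG ac) zc). Qed.

Lemma surface_HN p : Hh p * Nh p = Rh p * Hh p.
Proof. move: p; apply: pointwise => c z ac zc; exact: (darH_left (HD ac) zc). Qed.

Lemma regular_darf c p : chart_at c p ->
  regular fh p <-> G c (e1 R) (cmap c p) != 0.
Proof.
move=> cp; have [ac cpp] := cp; have zc := cimg_cmap cpp; split.
  move=> rp; apply/eqP => g0; have := rp c (e1 R) cp.
  have E : d_ fh c p (e1 R) = 0.
    apply: (etrans (dirq_darf (HD ac) (e1 R) zc)).
    by rewrite g0 mulr0 mul0r oppr0.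
  by move=> /(_ E) /(congr1 fst) /eqP; rewrite /= oner_eq0.
move=> g0 c' v c'p; rewrite (d_transition v (smooth_on_darf _) c'p cp).
move=> /(darf_zero (HD ac) zc) /(gauG_inj (HC ac) zc g0).
exact: jac_transition_inj.
Qed.

Lemma regular_darf_dense p : \forall q \near p^', regular fh q.
Proof.
have [c cp] := chart_exists p.
have n1 : \forall q \near p, q != p -> G c (e1 R) (cmap c q) != 0
  := near_cmap_dnbhs cp.2 (HU cp).
have n2 := near_cdom cp.2.
suff : \forall q \near p, q != p -> regular fh q by [].
apply: filterS2 n1 n2 => q gq cq qp; apply/(regular_darf (c := c)); last exact: gq.
by split=> //; exact: cp.1.
Qed.

Lemma conformal_darf : conformal fh Nh Rh.
Proof.
split.
- exact: smooth_on_darf.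
- by split; [exact: smooth_on_darN|exact: smooth_on_gR].
- by move=> p; split; split; rewrite ?surface_NN ?surface_RR //; apply: imaginary_sqr;
    rewrite ?surface_NN ?surface_RR.
- move=> c p v; apply: (chartwise (Q := fun c p => star (d_ fh) c p v = Nh p * d_ fh c p v /\
    star (d_ fh) c p v = - (d_ fh c p v * Rh p))) => {}c z ac zc.
  rewrite /star -!(dirq_cinv fh _ zc); split.
    exact: (darf_left (HD ac) v zc).
  exact: (darf_right (HD ac) v zc).
- exact: regular_darf_dense.
Qed.

Lemma harmonic_gR : harmonicS2 Rh.
Proof.
split; first exact: smooth_on_gR.
move=> c p [ac cp]; have zc := cimg_cmap cp.
have D x w : dirq (fun z => star (d_ Rh) c (cinv c z) x) (cmap c p) w
    = dirq (fun z => dirq (Rh \o cinv c) z (Jp x)) (cmap c p) w.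
  by apply: (dirq_ext w (@open_cimg _ _ c) zc) => y yc; rewrite /star dirq_cinv.
have key := gR_harmonic (HD ac) (e1 R) zc.
have RE : gR (N \o cinv c) (beta \o cinv c) cc bb (cmap c p) = Rh p.
  by rewrite -[in RHS](cinvK cp).
rewrite Jp_e1 RE in key; rewrite /ext (D (e2 R) (e1 R)) (D (e1 R) (e2 R)) Jp_e1.
exact: key.
Qed.

(** The surface version of [gtau], written with [d_ F] so that it is given in every chart at once
    and transforms as a form. *)
Definition surface_tau c v p : H :=
  (grho N beta cc bb p)^-1 * d_ F c p v * gconj beta cc p * (grho N beta cc bb p)^-1.
Definition surface_eta : preform X 'M[H]_2 :=
  fun c p v => gausseta fh Hh Rh (surface_tau c v) p.

Lemma surface_tauE c z v : cimg c z -> surface_tau c v (cinv c z)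
  = gtau (N \o cinv c) (beta \o cinv c) (fun v z => dirq (F \o cinv c) z v) cc bb v z.
Proof. by move=> zc; rewrite /gtau (dirq_cinv F v zc). Qed.

Lemma surface_etaE c z v : cimg c z -> surface_eta c (cinv c z) v
  = gausseta (darf (F \o cinv c) (nu \o cinv c) (beta \o cinv c))
      (darH (N \o cinv c) (nu \o cinv c) (beta \o cinv c) cc bb)
      (gR (N \o cinv c) (beta \o cinv c) cc bb)
      (gtau (N \o cinv c) (beta \o cinv c) (fun v z => dirq (F \o cinv c) z v) cc bb v) z.
Proof. by move=> zc; rewrite /surface_eta /gausseta surface_tauE. Qed.

Lemma smoothm_on_chartwise m n (U : set X) (w : X -> 'M[H]_(m, n)) :
  (forall c, atlas c -> smoothm (cimg c) (w \o cinv c)) -> smoothm_on U w.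
Proof.
move=> sw c ac i j; apply: smoothq_sub (sw c ac i j) => z [p [cp _] <-].
exact: cimg_cmap.
Qed.

Lemma realq_comm (s : R) (x : H) : x * realq s = realq s * x.
Proof. by apply: quat_eqP; rewrite !quatE /=; ring. Qed.

Lemma gausseta_linear (Y : Type) (h k r t t1 t2 : Y -> H) (s : R) (p : Y) :
  t p = realq s * t1 p + t2 p ->
  gausseta h k r t p = realq s *: gausseta h k r t1 p + gausseta h k r t2 p.
Proof.
move=> tp; apply/matrixP => i j; rewrite !mxE tp; have K := realq_comm s.
move: (if i == 0 then _ else _) (if j == 0 then _ else _) => x y.
by ncring (K x, K (4^-1 : H), K (r p)).
Qed.

Let sF : smooth_on setT F.
Proof. by apply: smooth_on_chartwise => c ac; exact: cmc_smoothf (HC ac). Qed.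

Lemma is_form_eta U : is_form U surface_eta.
Proof.
split.
- move=> c v ac i j; have oD := @open_cimg _ _ c.
  apply: (@smoothq_sub _ (cimg c)) => [z [p [cp _] <-]|]; first exact: cimg_cmap.
  have HDc := HD ac; have HGc := HG ac; have HCc := HC ac.
  have s1 := smoothq_darf HDc; have s2 := smoothq_darH HDc; have s3 := smoothq_gR HGc.
  have s4 := smoothq_grhoV HGc; have s5 := smoothq_gconj HGc cc.
  have s6 := smoothq_dirq v (cmc_smoothf HCc).
  have s7 := smoothqM oD (smoothqM oD (smoothqM oD s4 s6) s5) s4.
  have s8 := smoothqM oD (smoothqM oD s3 s7) s2.
  have s9 := smoothqM oD (smoothq_cst _ 4^-1) (smoothqD oD s8 s8).
  have sy : smoothq (cimg c) (fun z => surface_eta c (cinv c z) v 1 0).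
    apply: (smoothq_ext oD _ s9) => z zc; rewrite surface_etaE //.
    by rewrite mxE mul1r mulr1.
  move: i j; apply: ord2P; apply: ord2P.
  + apply: (smoothq_ext oD _ (smoothqM oD s1 s9)) => z zc; rewrite surface_etaE //.
    by rewrite mxE mulr1.
  + apply: (smoothq_ext oD _ (smoothqN oD (smoothqM oD (smoothqM oD s1 s9) s1))) => z zc.
    by rewrite surface_etaE // mxE mulrN.
  + exact: sy.
  + apply: (smoothq_ext oD _ (smoothqN oD (smoothqM oD s9 s1))) => z zc.
    by rewrite surface_etaE // mxE mul1r mulrN.
- move=> c p s v v' [ac cp] _; rewrite -/(realq s).
  have E : d_ F c p (s *: v + v') = realq s * d_ F c p v + d_ F c p v'.
    exact: (dirq_lin s v v' (cimg_cmap cp) (cmc_smoothf (HC ac))).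
  apply: gausseta_linear; rewrite /surface_tau E.
  have k := realq_comm s; move: (d_ F c p v) (d_ F c p v') => d d'.
  move: (grho N beta cc bb p)^-1 (gconj beta cc p) => r y.
  by ncring (k r).
- move=> c c' p v cp c'p _; rewrite /surface_eta /gausseta /surface_tau.
  by rewrite (d_transition v sF cp c'p).
Qed.

Lemma extm_eq0 m n (w : preform X 'M[H]_(m, n)) c p :
  (forall i j, dirq (fun z => w c (cinv c z) (e2 R) i j) (cmap c p) (e1 R)
    = dirq (fun z => w c (cinv c z) (e1 R) i j) (cmap c p) (e2 R)) -> extm w c p = 0.
Proof. by move=> h; apply/matrixP => i j; rewrite !mxE h subrr. Qed.

Lemma AformE c z v : cimg c z -> Aform S c (cinv c z) v
  = darA (F \o cinv c) (N \o cinv c) (nu \o cinv c) (beta \o cinv c) cc bb z v.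
Proof. by move=> zc; rewrite /Aform /star /dm_ (cimgP zc).2. Qed.

Lemma constrained_willmore_darf : constrained_willmore fh Nh Rh.
Proof.
split; first exact: conformal_darf.
exists S, surface_eta => U.
have nn := surface_NN; have rr := surface_RR; have hn := surface_HN.
split.
- split.
  + by apply: smoothm_on_chartwise => c ac; exact: smoothm_gaussS (HD ac).
  + by move=> p _; exact: gaussS_sqr.
  + by move=> p _; exact: gaussS_psi.
  + move=> c p v cp _; move: c p cp.
    apply: chartwise => c z ac zc; rewrite /dm_ (cimgP zc).2.
    exact: (gaussS_dir_psi (HD ac) v zc).
  + move=> c p v w cp _; move: c p cp.
    apply: chartwise => c z ac zc; rewrite AformE //.
    exact: (darA_line (HD ac) v w zc).
- exact: is_form_eta.
- by move=> c p v _ _; split; [exact: gausseta_psi|move=> w; exact: gausseta_line].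
- move=> c p v cp _; move: c p cp; apply: chartwise => c z ac zc.
  have tJ : surface_tau c (Jp v) (cinv c z)
      = - (Rh (cinv c z) * surface_tau c v (cinv c z)).
    rewrite !surface_tauE //.
    exact: (gtauJ (HG ac) zc (cmc_fJ (HC ac) v zc)).
  have ta : surface_tau c v (cinv c z) * Rh (cinv c z)
      = - (Rh (cinv c z) * surface_tau c v (cinv c z)).
    by rewrite !surface_tauE //; exact: (gtau_anti (HD ac) v zc).
  by split; [exact: gausseta_left|exact: gausseta_right].
- move=> c p [ac cp] _; have zc := cimg_cmap cp.
  have D x w i j : dirq (fun z => (star (Aform S) c (cinv c z) x
       + surface_eta c (cinv c z) x) i j) (cmap c p) w
    = dirq (fun z => (darA (F \o cinv c) (N \o cinv c) (nu \o cinv c) (beta \o cinv c)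
         cc bb z (Jp x) + gausseta (darf (F \o cinv c) (nu \o cinv c) (beta \o cinv c))
      (darH (N \o cinv c) (nu \o cinv c) (beta \o cinv c) cc bb)
      (gR (N \o cinv c) (beta \o cinv c) cc bb)
      (gtau (N \o cinv c) (beta \o cinv c) (fun v z => dirq (F \o cinv c) z v) cc bb x) z) i j)
        (cmap c p) w.
    apply: (dirq_ext w (@open_cimg _ _ c) zc) => y yc.
    apply: (congr1 (fun A : 'M[H]_2 => A i j)).
    apply: f_equal2; first exact: (AformE (Jp x) yc).
    exact: (surface_etaE x yc).
  apply: extm_eq0 => i j; have key := willmore_closed (HD ac) (e1 R) i j zc.
  rewrite Jp_e1 in key.
  apply: (etrans (D (e2 R) (e1 R) i j)); apply: (etrans _ (esym (D (e1 R) (e2 R) i j))).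
  rewrite [Jp (e1 R)]Jp_e1; exact: key.
Qed.

End SurfaceDarboux.

(** * Darboux transforms that are CMC surfaces, and parallel sections of d^N *)

Section CmcDarboux.
Variables (R : realType) (X : riemannSurface R).
Local Notation plane := (R * R)%type.
Local Notation H := (quat R).
Variables (F N nu beta : X -> H) (mu : H).
Local Notation cc := (a_ mu - 1).
Local Notation bb := (b_ mu).
Hypothesis HD : forall c, atlas c -> darboux_plane (cimg c) (F \o cinv c)
  (N \o cinv c) (nu \o cinv c) (beta \o cinv c) cc bb.
Hypothesis HU : forall c p, chart_at c p ->
  \forall z \near (cmap c p)^', gauG (F \o cinv c) (N \o cinv c) (e1 R) z != 0.
Implicit Types (c : chart R X) (p q : X) (z v : plane).
Local Notation fh := (darf F nu beta).
Local Notation Hh := (darH N nu beta cc bb).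
Local Notation Rh := (gR N beta cc bb).
Local Notation G c := (gauG (F \o cinv c) (N \o cinv c)).

Let HC c (ac : atlas c) := darboux_cmc (HD ac).
Let sfh : smooth_on setT fh := smooth_on_darf HD setT.

Local Opaque dirq.

Lemma dnbhs_plane_proper z : ~ \forall y \near z^', False.
Proof.
move=> h; have /nbhs_ballP[e /= e0 he] : nbhs z (fun y => y != z -> False) := h.
apply: (he (z + (e / 2) *: e1 R)).
  rewrite -ball_normE /= opprD addNKr normrN normrZ.
  have -> : `|e1 R| = 1 :> R.
    by rewrite norm_planeE /= normr1 normr0; apply/max_idPl.
  by rewrite mulr1 ger0_norm ?ltr_pdivrMr ?divr_ge0 ?ltW // mulr_natr mulr2n ltrDl.
apply/eqP => /(congr1 (fun y => (y - z).1)); rewrite /= addrAC subrr add0r /= => /eqP.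
by rewrite [_ *: _]mulr1 mulf_eq0 invr_eq0 pnatr_eq0 orbF gt_eqF.
Qed.

(** A nonzero value at p would persist near p, where regular points exist because the branch points
    are isolated and punctured neighbourhoods are nonempty. *)
Lemma regular_density (u : X -> H) : smooth_on setT u ->
  (forall p, regular fh p -> u p = 0) -> forall p, u p = 0.
Proof.
move=> su ur p; have [c cp] := chart_exists p; have [ac cpp] := cp.
apply: contrapT => /eqP up.
have zc := cimg_cmap cpp.
have n1 : \forall z \near cmap c p, (u \o cinv c) z != 0.
  by apply: (smoothq_near_neq0 (smooth_on_cimg su ac) zc); rewrite /= cinvK.
have n2 : \forall z \near cmap c p, z != cmap c p -> G c (e1 R) z != 0 := HU cp.
have n3 : \forall z \near cmap c p, cimg c z := open_nbhs_nbhs (conj (@open_cimg _ _ c) zc).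
apply: (@dnbhs_plane_proper (cmap c p)).
suff : \forall z \near cmap c p, z != cmap c p -> False by [].
apply: filterS3 n1 n2 n3 => z u0 g0 zc' zp.
have [cz ez] := cimgP zc'.
move: u0; rewrite /= ur ?eqxx //.
by apply/(regular_darf HD (c := c)) => //; rewrite ez; exact: g0.
Qed.

Lemma d_darf_neq0 c p : chart_at c p -> regular fh p -> d_ fh c p (e1 R) != 0.
Proof.
by move=> cp rp; apply/eqP => /(rp c _ cp) /(congr1 fst) /eqP; rewrite /= oner_eq0.
Qed.

Lemma surface_darf_right c p v : chart_at c p ->
  star (d_ fh) c p v = - (d_ fh c p v * Rh p).
Proof. by move=> cp; case: (conformal_darf HD HU) => _ _ _ h _; case: (h c p v cp). Qed.

Lemma surface_gR_minus c p v : chart_at c p ->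
  d_ Rh c p v - Rh p * star (d_ Rh) c p v = Hh p * d_ fh c p v + Hh p * d_ fh c p v.
Proof.
move: c p; apply: chartwise => c z ac zc; rewrite /star -!(dirq_cinv _ _ zc).
exact: (gR_minus_darf (HD ac) v zc).
Qed.

Lemma smooth_on_darH : smooth_on setT Hh.
Proof. by apply: smooth_on_chartwise => c ac; exact: smoothq_darH (HD ac). Qed.

Section Direct.
Variables (t : H) (n : X -> H).
Hypothesis Hn : cmc_surface (fun p => fh p + t) n.

(** Both sides are right normals of the same differential, hence agree wherever d fh != 0. *)
Lemma cmc_darboux_right p : n p = Rh p.
Proof.
have [[_ [sn _] _ Hc _] _ _] := Hn.
have sR := smooth_on_gR HD setT.
apply/eqP; rewrite -subr_eq0; apply/eqP; move: p.
apply: regular_density => [|p rp].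
  apply: smooth_on_chartwise => c ac.
  exact: smoothqB (@open_cimg _ _ c) (smooth_on_cimg sn ac) (smooth_on_cimg sR ac).
have [c cp] := chart_exists p; have w0 := d_darf_neq0 cp rp.
have [_ h] := Hc c p (e1 R) cp; have h' := surface_darf_right (e1 R) cp.
rewrite /star !(d_addr _ _ sfh cp) in h h'; rewrite h' in h.
have {h}/eqP := oppr_inj h; rewrite -subr_eq0 -mulrBr quat_mulf_eq0 (negPf w0) /=.
by rewrite subr_eq0 => /eqP ->; rewrite subrr.
Qed.

(** dR - R *dR equals - 2 d fh by the CMC equation and 2 H d fh by the general formula, hence (H +
    1) d fh = 0. *)
Lemma cmc_darboux_H p : Hh p = -1.
Proof.
apply/eqP; rewrite -subr_eq0 opprK; apply/eqP; move: p.
apply: regular_density => [|p rp].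
  apply: smooth_on_chartwise => c ac.
  exact: smoothqD (@open_cimg _ _ c) (smooth_on_cimg smooth_on_darH ac) (smoothq_cst _ 1).
have [c cp] := chart_exists p; have w0 := d_darf_neq0 cp rp; have [ac cpp] := cp.
have [_ _ /(_ c p (e1 R) cp)] := Hn.
rewrite (d_addr _ _ sfh cp) (_ : n = Rh); last exact/funext/cmc_darboux_right.
have e := surface_gR_minus (e1 R) cp.
rewrite e mulrDr quat_half_add => /eqP; rewrite -subr_eq0 opprK => /eqP E.
have /eqP : (Hh p + 1) * d_ fh c p (e1 R) = 0 by rewrite mulrDl mul1r addrC.
by rewrite quat_mulf_eq0 (negPf w0) orbF => /eqP.
Qed.

(** H = -1 means nu = N beta - beta b c^-1. Then N nu c + nu b = - beta c - beta b c^-1 b, which is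
    2 beta since b c^-1 b = - 2 - c. *)
Lemma cmc_darboux_beta p : 2^-1 * (N p * nu p * cc + nu p * bb) = beta p.
Proof.
have hH := cmc_darboux_H p; have [c [ac cp]] := chart_exists p.
have zc := cimg_cmap cp.
have T0 := darT_neq0 (HD ac) zc; have b0 := darboux_beta0 (HD ac) zc.
have NN := cmc_NN (HC ac) zc; rewrite /darT /= cinvK // in T0 b0 NN.
have c0 := darboux_c0 (HD ac); have bc := darboux_bc (HD ac).
have bc2 := darboux_ccbb (HD ac).
have bV := quat_mulfV b0; have Vb := quat_mulVf b0.
have cV := quat_mulfV c0; have Vc := quat_mulVf c0.
have E : N p - gE beta cc bb p = darT nu beta p.
  have V := quat_mulVf T0.
  have : (gE beta cc bb p - N p) * (darT nu beta p)^-1 * darT nu beta p = - darT nu beta p.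
    by rewrite -[_ * (darT nu beta p)^-1]/(darH N nu beta cc bb p) hH mulN1r.
  by rewrite -mulrA V mulr1 => h; rewrite -[RHS]opprK -h opprB.
have nuE : nu p = N p * beta p - beta p * bb * cc^-1.
  have -> : nu p = darT nu beta p * beta p by rewrite /darT -mulrA Vb mulr1.
  by rewrite -E /gE /gconj; ncring Vb.
move: cc bb c0 bc bc2 cV Vc nuE => c' b' c0 bc bc2 cV Vc nuE.
have bVb : b' * c'^-1 * b' = - (1 + 1) - c'.
  have e1 : c'^-1 * b' = b' * c'^-1.
    have -> : c'^-1 * b' = c'^-1 * (b' * c') * c'^-1 by ncring cV.
    by rewrite bc; ncring Vc.
  have -> : b' * c'^-1 * b' = c'^-1 * (c' * c' + b' * b') - c' by rewrite -e1; ncring Vc.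
  by rewrite bc2; ncring Vc.
have -> : N p * nu p * c' + nu p * b' = beta p + beta p.
  have -> : N p * nu p * c' + nu p * b' = N p * N p * beta p * c' - N p * beta p * b' * (c'^-1 * c')
      + N p * beta p * b' - beta p * (b' * c'^-1 * b') by rewrite nuE; ncring I.
  by rewrite bVb Vc NN; ncring I.
by rewrite mulrDr quat_half_add.
Qed.

(** The auxiliary section that d^N and D^N build from nu is beta itself, so d nu = - df beta is
    already the parallel equation. *)
Lemma cmc_darboux_parallel : dN_parallel F N mu nu.
Proof.
split.
  by apply: smooth_on_chartwise => c ac; exact: darboux_smooth_nu (HD ac).
move=> c p v; apply: (chartwise (Q := fun c p => dN F N mu nu c p v = 0)) => {}c z ac zc.
have B := cmc_darboux_beta (cinv c z).
rewrite /dN -!(dirq_cinv _ _ zc).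
rewrite (darboux_dnu (HD ac) v zc) (quat_halfC (dirq (F \o cinv c) z v)).
rewrite -(mulrA (dirq (F \o cinv c) z v) 2^-1).
by rewrite B addNr.
Qed.

Lemma cmc_darboux_DN p : fh p = DN F N mu nu p.
Proof. by rewrite /DN cmc_darboux_beta. Qed.

End Direct.

Section Converse.
Variables (t : H) (alpha : X -> H).
Hypotheses (Ha : dN_parallel F N mu alpha) (Ha0 : exists p, alpha p <> 0).
Hypothesis HDN : forall p, fh p = DN F N mu alpha p + t.
Local Notation Rt := (gR (fun p => - N p) alpha cc bb).

Let da c z v : atlas c -> cimg c z -> dirq (alpha \o cinv c) z v
  = - (2^-1 * dirq (F \o cinv c) z v
       * (N (cinv c z) * alpha (cinv c z) * cc + alpha (cinv c z) * bb)).
Proof.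
move=> ac zc; have [cz _] := cimgP zc.
have [_ /(_ c (cinv c z) v (conj ac cz))] := Ha.
by rewrite /dN -!(dirq_cinv _ _ zc) => /eqP; rewrite addr_eq0 => /eqP.
Qed.

(** The zero set of alpha is open by the Gronwall argument and closed by continuity, and it is not
    the whole connected surface. *)
Lemma parallel_neq0 p : alpha p != 0.
Proof.
have [sa _] := Ha; apply/eqP => a0; have [q] := Ha0; apply.
apply: (connected_constant (P := fun x => alpha x = 0)) a0 => {p q} p.
  move=> a0; have [c [ac cp]] := chart_exists p; have zc := cimg_cmap cp.
  have n1 := parallel_zero_near (HC ac) (smooth_on_cimg sa ac)
    (fun y v yc => da v ac yc) zc.
  have e : (alpha \o cinv c) (cmap c p) = 0 by rewrite /= cinvK.
  have n2 := near_cmap cp (n1 e).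
  by apply: filterS2 n2 (near_cdom cp) => q + cq; rewrite /= cinvK.
move=> /eqP a0; have [c [ac cp]] := chart_exists p; have zc := cimg_cmap cp.
have e : (alpha \o cinv c) (cmap c p) != 0 by rewrite /= cinvK.
have n2 := near_cmap cp (smoothq_near_neq0 (smooth_on_cimg sa ac) zc e).
by apply: filterS2 n2 (near_cdom cp) => q + cq; rewrite /= cinvK // => /eqP.
Qed.

Lemma parallel_gauged c : atlas c ->
  gauged (cimg c) (fun z => - (N \o cinv c) z) (alpha \o cinv c)
    (fun v z => 2^-1 * dirq (F \o cinv c) z v) (fun v z => G c v z + G c v z) cc bb.
Proof.
move=> ac; apply: (gauged_parallel (HC ac)).
- exact: smooth_on_cimg Ha.1 ac.
- by move=> z v zc; exact: da.
- by move=> z _; exact: parallel_neq0.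
- exact: darboux_c0 (HD ac).
- exact: darboux_bc (HD ac).
- exact: darboux_ccbb (HD ac).
Qed.

Lemma darf_parf c z : atlas c -> cimg c z ->
  (fh \o cinv c) z = parf (F \o cinv c) (N \o cinv c) (alpha \o cinv c) cc bb z + t.
Proof.
move=> ac zc; rewrite /= HDN /DN /parf; congr (_ + _); rewrite -addrA; congr (_ + _).
have a0 := parallel_neq0 (cinv c z).
apply: darboux_quotient => //.
have := grho_neq0 (parallel_gauged ac) zc; apply: contraNneq => k0.
rewrite /grho /=.
have -> : - N (cinv c z) * alpha (cinv c z) * cc - alpha (cinv c z) * bb
  = - (N (cinv c z) * alpha (cinv c z) * cc + alpha (cinv c z) * bb) by ncring I.
by rewrite k0 oppr0 mul0r.
Qed.

Lemma dirq_darf_parf c z v : atlas c -> cimg c z ->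
  dirq (fh \o cinv c) z v
  = dirq (parf (F \o cinv c) (N \o cinv c) (alpha \o cinv c) cc bb) z v.
Proof.
move=> ac zc; have oD := @open_cimg _ _ c.
have sp := smoothq_parf (HC ac) (parallel_gauged ac).
apply: (etrans (dirq_ext v oD zc (fun y yc => darf_parf ac yc))).
by apply: (etrans (dirqD v zc sp (smoothq_cst _ t))); rewrite dirq_cst addr0.
Qed.

Local Notation n := (fun p => - Rt p).

Lemma smooth_on_parallel_gauss : smooth_on setT n.
Proof.
apply: smooth_on_chartwise => c ac.
exact: smoothqN (@open_cimg _ _ c) (smoothq_gR (parallel_gauged ac)).
Qed.

Lemma parallel_gauss_sqr p : n p * n p = -1.
Proof.
by move: p; apply: pointwise => c z ac zc; rewrite mulrNN; exact: (gR_sqr (parallel_gauged ac) zc).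
Qed.

Lemma parallel_cmc c p v : chart_at c p ->
  [/\ d_ fh c p (Jp v) = n p * d_ fh c p v,
      d_ fh c p (Jp v) = - (d_ fh c p v * n p)
    & d_ fh c p v = - (2^-1 * (d_ n c p v - n p * d_ n c p (Jp v)))].
Proof.
move: c p; apply: chartwise => c z ac zc; rewrite -!(dirq_cinv _ _ zc).
have [h1 h2 h3] := parf_cmc (HC ac) (parallel_gauged ac) v zc.
have e := dirq_darf_parf v ac zc; have eJ := dirq_darf_parf (Jp v) ac zc.
split.
- by apply: (etrans eJ); apply: (etrans h1); rewrite e.
- by apply: (etrans eJ); apply: (etrans h2); rewrite e.
- by apply: (etrans e); exact: h3.
Qed.

(** fh and [parf] differ by a constant, so fh inherits the equations of [parf]; subtracting the
    constant real part moves it into Im H, and the isolated branch points come from the description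
    of fh by nu and beta. *)
Lemma cmc_darboux_converse p0 :
  cmc_surface (fun p => fh p + - realq (qre (fh p0))) n.
Proof.
have nn := parallel_gauss_sqr.
split.
- split.
  + apply: smooth_on_chartwise => c ac.
    exact: smoothqD (@open_cimg _ _ c) (smooth_on_cimg sfh ac) (smoothq_cst _ _).
  + by split; exact: smooth_on_parallel_gauss.
  + by move=> p; split; split=> //; apply: imaginary_sqr; exact: nn.
  + by move=> c p v cp; rewrite /star !(d_addr _ _ sfh cp); case: (parallel_cmc v cp).
  + move=> p; suff : \forall q \near p, q != p -> regular (fun p => fh p + - realq (qre (fh p0))) q by [].
    have n1 : \forall q \near p, q != p -> regular fh q := regular_darf_dense HD HU p.
    apply: filterS n1 => q h qp c v cq; rewrite (d_addr _ _ sfh cq).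
    exact: (h qp c v cq).
- move=> p; have E : qre (fh p) = qre (fh p0); last first.
    by change (qre (fh p) - qre (fh p0) = 0); rewrite E subrr.
  suff /(congr1 (@qre R)) : realq (qre (fh p)) = realq (qre (fh p0)) by [].
  pose h q := realq (qre (fh q)); apply: (zero_d_constant (h := h)).
    apply: smooth_on_chartwise => c ac.
    have [s0 _ _ _] := smooth_on_cimg sfh ac.
    by split => //; exact: smoothR_cst.
  move=> c q v cq; have [h1 h2 _] := parallel_cmc v cq.
  (* The two rules of type say that d fh anticommutes with n. *)
  have im : imaginary (d_ fh c q v).
    by apply: (anticommute_imaginary (nn q)); rewrite -h1.
  apply: quat_eqP; last 3 first.
  + exact: derive_cst.
  + exact: derive_cst.
  + exact: derive_cst.
  + exact: im.
- move=> c p v cp; rewrite (d_addr _ _ sfh cp).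
  by case: (parallel_cmc v cp).
Qed.

End Converse.
End CmcDarboux.

Section ParallelSection.
Variables (R : realType) (X : riemannSurface R).
Local Notation H := (quat R).
Variables (F N nu beta : X -> H) (mu : H).

Lemma section2E p i j : section2 F nu beta p i j
  = if i == 0 then nu p + F p * beta p else beta p.
Proof.
rewrite !mxE; move: i; apply: ord2P; rewrite ord1 /= ?mul1r ?mul0r //.
by rewrite add0r.
Qed.

(** If nu vanished at p, phi would lie in the line of psi and [evec] would have no decomposition:
    the bottom row gives beta a + b = 0, and the top row, f times this, would be 1. *)
Lemma darboux_bundle_neq0 p : darboux_bundle F (section2 F nu beta) -> nu p != 0.
Proof.
move=> [_ /(_ p (evec R)) [[a b] [/= e _]]]; apply/eqP => n0.
have e0 := congr1 (fun w : 'cV[H]_2 => w 0 0) e.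
have e1 := congr1 (fun w : 'cV[H]_2 => w 1 0) e.
have S i j := section2E p i j.
move: e0 e1; rewrite [in RHS]mxE [rscale (section2 _ _ _ _) _ _ _]mxE S n0 /= add0r.
rewrite [rscale _ _ _ _]mxE psiE [LHS]mxE /= => e0.
rewrite [in RHS]mxE [rscale (section2 _ _ _ _) _ _ _]mxE S /=.
rewrite [rscale _ _ _ _]mxE psiE [LHS]mxE /= mul1r => /esym e1.
by move: e0; rewrite -mulrA -mulrDr e1 mulr0 => /eqP; rewrite oner_eq0.
Qed.

(** The bottom row is the equation of beta; the top row minus f times the bottom one is that of
    nu. *)
Lemma dS_parallel_plane c z v : smooth_on setT F -> dS_parallel F N mu nu beta ->
  atlas c -> cimg c z ->
  dirq (nu \o cinv c) z v = - (dirq (F \o cinv c) z v * beta (cinv c z)) /\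
  dirq (beta \o cinv c) z v = gauG (F \o cinv c) (N \o cinv c) v z
    * (N (cinv c z) * beta (cinv c z) * (a_ mu - 1) - beta (cinv c z) * b_ mu).
Proof.
move=> sF [snu sbeta hS] ac zc; have [cz ez] := cimgP zc.
have h := hS c (cinv c z) v (conj ac cz).
have W : 2^-1 * d_ (fun q => F q + N q) c (cinv c z) v
    = gauG (F \o cinv c) (N \o cinv c) v z by rewrite -dirq_cinv.
have h0 := congr1 (fun w : 'cV[H]_2 => w 0 0) h.
have h1 := congr1 (fun w : 'cV[H]_2 => w 1 0) h.
rewrite /dS W in h0 h1; move: (gauG _ _ _ _) h0 h1 => g.
have S i : (fun x => (section2 F nu beta \o cinv c) x i 0)
    = (fun x => if i == 0 then nu (cinv c x) + F (cinv c x) * beta (cinv c x)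
        else beta (cinv c x)) by apply/funext => x; rewrite /= section2E.
have sn := smooth_on_cimg snu ac; have sb := smooth_on_cimg sbeta ac.
have sf := smooth_on_cimg sF ac.
have oD := @open_cimg _ _ c.
rewrite !mxE !S ez /= mul1r => h0 /eqP; rewrite addr_eq0 => /eqP h1.
have {}h1 : dirq (beta \o cinv c) z v
    = g * (N (cinv c z) * beta (cinv c z) * (a_ mu - 1) - beta (cinv c z) * b_ mu).
  by apply: (etrans h1); ncring I.
split=> //.
have E : dirq (fun x => nu (cinv c x) + F (cinv c x) * beta (cinv c x)) z v
    = dirq (nu \o cinv c) z v + (dirq (F \o cinv c) z v * beta (cinv c z)
       + F (cinv c z) * dirq (beta \o cinv c) z v).
  apply: (etrans (dirqD v zc sn (smoothqM oD sf sb))).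
  by rewrite (dirqM v zc sf sb).
rewrite E h1 in h0; apply/eqP; rewrite -addr_eq0; apply/eqP; apply: (etrans _ h0).
by ncring I.
Qed.

End ParallelSection.

Theorem theorem5p5 (R : realType) (M Mt : riemannSurface R) (pr : Mt -> M)
  (hpi : universal_cover pr)
  (f N : M -> quat R) (hf : cmc_surface f N) (hround : ~ round_sphere f)
  (mu : quat R) (hmu : complexq mu) (hmu0 : mu <> 0) (hmu1 : mu <> 1)
  (nu beta : Mt -> quat R)
  (hpar : dS_parallel (f \o pr) (N \o pr) mu nu beta)
  (hdarboux : darboux_bundle (f \o pr) (section2 (f \o pr) nu beta))
  (hbeta : forall p, beta p <> 0) :
  (exists Nh Rh : Mt -> quat R,
     constrained_willmore (DS (f \o pr) nu beta) Nh Rh /\ harmonicS2 Rh)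
  /\
  ((exists (t : quat R) (n : Mt -> quat R),
      cmc_surface (fun p => DS (f \o pr) nu beta p + t) n)
   <->
   (exists (t : quat R) (alpha : Mt -> quat R),
      [/\ dN_parallel (f \o pr) (N \o pr) mu alpha,
          exists p, alpha p <> 0
        & forall p, DS (f \o pr) nu beta p
                    = DN (f \o pr) (N \o pr) mu alpha p + t])).
Proof.
have [_ [_ sur _] hol] := hpi; have [[sf _ SN _ _] fi _] := hf.
have HC c (ac : atlas c) := cmc_pullback hol hf ac.
(* On an empty M every f would vacuously be a round sphere. *)
have [x0 _] : exists x : M, True.
  apply: contrapT => nM; apply: hround; exists 0, 0; split=> // p.
  by case: nM; exists p.
have prS x : exists p, pr p = x by have [p _ e] := sur x I; exists p.
have [p0 _] := prS x0.
have HU c p : chart_at c p -> \forall z \near (cmap c p)^',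
    gauG ((f \o pr) \o cinv c) ((N \o pr) \o cinv c) (e1 R) z != 0.
  apply: (isolated_umbilics HC) => g; apply: hround.
  (* If f + N is a constant m, then |f - m| = |N| = 1: f lies on the unit sphere about m. *)
  exists (f (pr p0) + N (pr p0)), 1.
  split.
    by rewrite /imaginary qreD fi (SN _).1.1 addr0.
  move=> x; have [q <-] := prS x; have /= <- := g q p0.
  have -> : f (pr q) - (f (pr q) + N (pr q)) = - N (pr q) by rewrite opprD addNKr.
  rewrite expr1n; have [[i E] _] := SN (pr q).
  have := congr1 (@qre R) E; rewrite qreM qreN /sqnq /= !sqrrN i mulr0.
  by rewrite expr0n /= !expr2; move: (qim1 _) (qim2 _) (qim3 _) => *; lra.
have [c0 bc ccbb] := spectral_constants hmu (introN eqP hmu0) (introN eqP hmu1).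
have [snu sbeta hS] := hpar.
have dS0 c z v : atlas c -> cimg c z ->
    dirq (nu \o cinv c) z v = - (dirq ((f \o pr) \o cinv c) z v * beta (cinv c z)) /\
    dirq (beta \o cinv c) z v = gauG ((f \o pr) \o cinv c) ((N \o pr) \o cinv c) v z
      * (N (pr (cinv c z)) * beta (cinv c z) * (a_ mu - 1) - beta (cinv c z) * b_ mu).
  move=> ac zc; have [cz _] := cimgP zc.
  exact: (dS_parallel_plane v (pullback_smooth hol sf) hpar ac zc).
have HD c : atlas c -> darboux_plane (cimg c) ((f \o pr) \o cinv c)
    ((N \o pr) \o cinv c) (nu \o cinv c) (beta \o cinv c) (a_ mu - 1) (b_ mu).
  move=> ac; split=> //.
  - exact: HC.
  - exact: smooth_on_cimg snu ac.
  - exact: smooth_on_cimg sbeta ac.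
  - by move=> z v zc; case: (dS0 c z v ac zc).
  - by move=> z v zc; case: (dS0 c z v ac zc).
  - move=> z _; exact: (darboux_bundle_neq0 _ hdarboux).
  - by move=> z _; apply/eqP; exact: hbeta.
split.
  exists (darN (N \o pr) nu beta), (gR (N \o pr) beta (a_ mu - 1) (b_ mu)).
  by split; [exact: constrained_willmore_darf|exact: harmonic_gR HD].
split=> [[t [n Hn]]|[t [alpha [Ha Ha0 HDN]]]].
  exists 0, nu; split.
  - exact: (cmc_darboux_parallel HD HU Hn).
  - by exists p0; apply/eqP; exact: (darboux_bundle_neq0 _ hdarboux).
  - by move=> p; rewrite addr0; exact: (cmc_darboux_DN HD HU Hn p).
exists (- realq (qre (darf (f \o pr) nu beta p0))),
  (fun p => - gR (fun p => - (N \o pr) p) alpha (a_ mu - 1) (b_ mu) p).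
exact: (cmc_darboux_converse HD HU Ha Ha0 HDN p0).
Qed.
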